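(* Let $n>k\ge1$ be coprime integers, $\eta$ in the upper half-plane, $\Lambda=\mathbb{Z}+\mathbb{Z}\eta$, $E=\mathbb{C}/\Lambda$. For all $\tau\in\mathbb{C}\setminus\big(\frac1{2n}\Lambda\setminus\frac1n\Lambda\big)$, $\dim\mathrm{rel}_{n,k}(E,\tau)=\binom n2$.
   Context: Write $e(z)=e^{2\pi i z}$ and $\theta(z)=\sum_{m\in\mathbb{Z}}(-1)^m e\big(mz+\tfrac12 m(m-1)\eta\big)$. For $\alpha\in\mathbb{Z}$ put $\theta_\alpha(z)=e\big(\alpha z+\tfrac{\alpha}{2n}+\tfrac{\alpha(\alpha-n)}{2n}\eta\big)\prod_{m=0}^{n-1}\theta\big(z+\tfrac mn+\tfrac{\alpha}{n}\eta\big)$, regarded as indexed by $\alpha\in\mathbb{Z}_n$. Let $V$ be an $n$-dimensional complex vector space with basis $x_i$, $i\in\mathbb{Z}_n$. For $\tau\in\mathbb{C}\setminus\frac1n\Lambda$ and $z\in\mathbb{C}$, define $R_\tau(z)\in\mathrm{End}(V\otimes V)$ by $$R_\tau(z)(x_i\otimes x_j)=\frac{\theta_0(-z)\cdots\theta_{n-1}(-z)}{\theta_1(0)\cdots\theta_{n-1}(0)}\sum_{r\in\mathbb{Z}_n}\frac{\theta_{j-i+r(k-1)}(-z+\tau)}{\theta_{j-i-r}(-z)\,\theta_{kr}(\tau)}\,x_{j-r}\otimes x_{i+r}.$$ The space of quadratic relations is $\mathrm{rel}_{n,k}(E,\tau):=\operatorname{im}R_\tau(\tau)\subseteq V\otimes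 V$ for $\tau\notin\frac1n\Lambda$; for $\tau\in\frac1n\Lambda$, $R_\tau(\tau)$ is replaced by $R_+(\tau):=\lim_{t\to0}R_t(t+\tau)$. *)

(* Defs.v *)
From HB Require Import structures.
From mathcomp Require Import all_boot all_order all_algebra.
From mathcomp Require Import all_classical all_reals all_analysis.
From mathcomp Require Import complex.
Import Order.TTheory GRing.Theory Num.Theory.
Import numFieldNormedType.Exports.

Set Implicit Arguments.
Unset Strict Implicit.
Unset Printing Implicit Defensive.

Local Open Scope ring_scope.
Local Open Scope classical_set_scope.

(* The complex numbers, seen as a numClosedFieldType (so that the
   normed/topological structure of MathComp-Analysis applies). *)
Definition Cx (R : realType) : numClosedFieldType := R[i].

Section Defs.
Variable R : realType.
Local Notation C := (Cx R).

Definition Imc (z : C) : R := match z with Complex _ b => b end.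

Definition cexp (z : C) : C :=
  match z with Complex a b => (Complex (expR a * cos b) (expR a * sin b) : C) end.

Definition ee (z : C) : C := cexp ((Complex 0 (2 * pi) : C) * z).

Definition theta_term (eta z : C) (m : int) : C :=
  (-1) ^ m * ee (m%:~R * z + (m * (m - 1))%:~R / 2 * eta).

(* theta(z) = sum_{m in Z} theta_term m, as the limit of the partial sums
   over m in [-N, N-1] (the series converges absolutely for Im eta > 0). *)
Definition theta (eta z : C) : C :=
  limn (fun N : nat => \sum_(m < N)
          (theta_term eta z (Posz m) + theta_term eta z (- (Posz m.+1)))).

Definition thetaA (n : nat) (eta : C) (alpha : int) (z : C) : C :=
  ee (alpha%:~R * z + alpha%:~R / (2 * n%:R)
      + (alpha * (alpha - Posz n))%:~R / (2 * n%:R) * eta)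
  * \prod_(m < n) theta eta (z + m%:R / n%:R + alpha%:~R * eta / n%:R).

(* Basis of V (x) V indexed by pairs (i,j) in 'I_n * 'I_n (i.e. Z_n x Z_n). *)
Definition NN (n : nat) := #|{: 'I_n * 'I_n}|.

(* Matrix of R_tau(z) : row (i,j) = coordinates of R_tau(z)(x_i (x) x_j)
   in the basis x_a (x) x_b, (a,b) = column index. *)
Definition Rmat (n k : nat) (eta tau z : C) : 'M[C]_(NN n) :=
  \matrix_(p, q)
    let ij := enum_val p in let ab := enum_val q in
    let i := Posz (val ij.1) in let j := Posz (val ij.2) in
    let a := Posz (val ab.1) in let b := Posz (val ab.2) in
    (\prod_(al < n) thetaA n eta (Posz al) (- z)
       / \prod_(al < n | (0 < al)%N) thetaA n eta (Posz al) 0)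
    * \sum_(r < n)
        (if ((a == j - Posz r %[mod Posz n])%Z && (b == i + Posz r %[mod Posz n])%Z)
         then thetaA n eta (j - i + Posz r * (Posz k - 1)) (- z + tau)
              / (thetaA n eta (j - i - Posz r) (- z)
                 * thetaA n eta (Posz k * Posz r) tau)
         else 0).

Definition inLat (eta : C) (d : nat) (z : C) : Prop :=
  exists a b : int, z = (a%:~R + b%:~R * eta) / d%:R.

Definition rel_dim (n k : nat) (eta tau : C) (d : nat) : Prop :=
  (~ inLat eta n tau -> \rank (Rmat n k eta tau tau) = d) /\
  (inLat eta n tau ->
     exists M : 'M[C]_(NN n),
       (forall p q, (fun t : C => Rmat n k eta t (t + tau) p q) @ (0 : C)^'
                      --> M p q)
       /\ \rank M = d).

End Defs.

(* Main.v *)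
(** Up to elementary factors the entries of R_tau(z) are the Kronecker-type
    quotients S(a+b, -z+tau) / (S(a,-z) S(b,tau)) of an odd theta function S.
    Fay's trisecant identity (a consequence of the three-term identity for
    theta) makes the off-diagonal entries of R_tau(z) R_tau(-z) telescope, and
    the diagonal ones reduce to a sum of differences of Weierstrass type; the
    outcome is R_tau(z) R_tau(-z) = c(z) 1, where c has a simple zero at
    z = tau as soon as 2 tau is not in (1/n) Lambda.  A simple zero forces
    rank R_tau(tau) + rank R_tau(-tau) = n^2.  Both ranks are lower
    semicontinuous in tau, so with a constant sum they are locally constant off
    (1/2n) Lambda, hence constant there because the complement of a lattice is
    connected.  As t tends to 0, R_t(t) tends to a multiple of (1 - flip) flip,
    of rank C(n,2), and R_t(-t) to a multiple of 1 + flip, of rank C(n,2) + n;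
    since C(n,2) + C(n,2) + n = n^2, the constant value of rank R_tau(tau) is
    C(n,2).  At a point of (1/n) Lambda the limit is computed in the same way:
    it is a multiple of (1 - D) flip for an involution D of trace n. *)
Require Import Defs.
From HB Require Import structures.
From mathcomp Require Import all_boot all_order all_algebra.
From mathcomp Require Import all_classical all_reals all_analysis.
From mathcomp Require Import complex perm.
From mathcomp Require Import ring lra zify.
Import Order.TTheory GRing.Theory Num.Theory.
Import numFieldNormedType.Exports.
Import Normc.
Set Implicit Arguments.
Unset Strict Implicit.
Unset Printing Implicit Defensive.
Local Open Scope ring_scope.
Local Open Scope classical_set_scope.

(** Zeros of theta are located by the triple product, where 1 - X is the only factor that can vanish
    on the fundamental annulus. The theta identities come from rearranging absolutely convergent
    double series. Orders of vanishing are expressed by two-sided linear bounds and by Lipschitz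
    estimates at one point. The sum of Weierstrass differences is likewise found without Liouville's
    theorem, from second-order terms of a product formula. The outcome is that near z = tau the
    scalar c(z) is a nonvanishing factor times sigma(n (tau + z)) sigma(n (tau - z)). At z = tau the
    first of these is sigma(2 n tau). This is where the points of (1/2n) Lambda outside (1/n) Lambda
    drop out: there both factors vanish and the zero is not simple. Near t = 0 the limits only bound
    the two ranks from below; the bounds are sharp because their sum is already n^2. *)

Section Norm.
Variable R : realType.
Local Notation C := (Cx R).

(* [R]-valued modulus, because the norm of [Cx R] takes values in [Cx R]. *)
Definition nm (z : C) : R := @normc R z.

Lemma nmE (z : C) : `|z| = (nm z)%:C%C.
Proof. by case: z => a b; rewrite normc_def. Qed.

Lemma nm_ge0 (z : C) : 0 <= nm z.
Proof. by case: z => a b; apply: sqrtr_ge0. Qed.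

Lemma nm0 : nm 0 = 0. Proof. exact: (@normc0 R). Qed.

Lemma nm1 : nm 1 = 1. Proof. exact: (@normc1 R). Qed.

Lemma nmM (x y : C) : nm (x * y) = nm x * nm y.
Proof. exact: (@normcM R). Qed.

Lemma nmV (x : C) : nm x^-1 = (nm x)^-1.
Proof. exact: (@normcV R). Qed.

Lemma nmD (x y : C) : nm (x + y) <= nm x + nm y.
Proof. exact: (@le_normcD R). Qed.

Lemma nmN (x : C) : nm (- x) = nm x.
Proof. exact: (@normcN R). Qed.

Lemma nmB (x y : C) : nm (x - y) <= nm x + nm y.
Proof. by rewrite -(nmN y); apply: nmD. Qed.

Lemma nmBC (x y : C) : nm (x - y) = nm (y - x).
Proof. by rewrite -nmN opprB. Qed.

Lemma nm_eq0 (x : C) : (nm x == 0) = (x == 0).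
Proof.
apply/eqP/eqP => [H|->]; last exact: nm0.
exact: (@eq0_normc R).
Qed.

Lemma nm_gt0 (x : C) : (0 < nm x) = (x != 0).
Proof. by rewrite lt_neqAle nm_ge0 andbT eq_sym nm_eq0. Qed.

Lemma nmX (x : C) k : nm (x ^+ k) = nm x ^+ k.
Proof. by elim: k => [|k IH]; rewrite ?expr0 ?nm1 // !exprS nmM IH. Qed.

Lemma nm_le_dist (x y : C) : nm x - nm y <= nm (x - y).
Proof. by rewrite lerBlDr; have := nmD (x - y) y; rewrite subrK. Qed.

Lemma nm_sum (I : Type) (r : seq I) (P : pred I) (F : I -> C) :
  nm (\sum_(i <- r | P i) F i) <= \sum_(i <- r | P i) nm (F i).
Proof.
elim/big_rec2: _ => [|i y x _ H]; first by rewrite nm0.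
by apply: le_trans (nmD _ _) _; rewrite lerD2l.
Qed.

Lemma nm_prod (I : Type) (r : seq I) (P : pred I) (F : I -> C) :
  nm (\prod_(i <- r | P i) F i) = \prod_(i <- r | P i) nm (F i).
Proof.
elim/big_rec2: _ => [|i y x _ H]; first by rewrite nm1.
by rewrite nmM H.
Qed.

Lemma nm_sign (k : nat) : nm ((-1) ^+ k) = 1.
Proof. by rewrite nmX nmN nm1 expr1n. Qed.

Lemma nm_real (r : R) : nm (r%:C%C : C) = `|r|.
Proof. by rewrite /nm /= expr0n /= addr0 sqrtr_sqr. Qed.

Lemma nm_nat k : nm k%:R = k%:R.
Proof.
have -> : (k%:R : C) = (k%:R : R)%:C%C by rewrite raddfMn.
by rewrite nm_real ger0_norm.
Qed.

Lemma Re_le_nm (z : C) : `|complex.Re z| <= nm z.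
Proof.
case: z => a b; rewrite /nm /= -sqrtr_sqr ler_sqrt ?lerDl ?sqr_ge0 //.
by rewrite addr_ge0 ?sqr_ge0.
Qed.

Lemma Im_le_nm (z : C) : `|complex.Im z| <= nm z.
Proof.
case: z => a b; rewrite /nm /= -sqrtr_sqr ler_sqrt ?lerDr ?sqr_ge0 //.
by rewrite addr_ge0 ?sqr_ge0.
Qed.

Lemma nm_le_ReIm (z : C) : nm z <= `|complex.Re z| + `|complex.Im z|.
Proof.
case: z => a b /=.
have := nmD (Complex a 0) (Complex 0 b).
have -> : (Complex a 0 : C) + (Complex 0 b : C) = Complex a b.
  by apply/eqP; rewrite eq_complex /= addr0 add0r !eqxx.
suff [-> ->] : nm (Complex a 0 : C) = `|a| /\ nm (Complex 0 b : C) = `|b| by [].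
by rewrite /nm /= expr0n /= addr0 add0r !sqrtr_sqr.
Qed.

Lemma cvg_nmP T (F : set_system T) {FF : Filter F} (f : T -> C) (l : C) :
  (f x @[x --> F] --> l) <->
  (forall e : R, 0 < e -> \forall x \near F, nm (f x - l) <= e).
Proof.
split=> [H e e0|H].
  have := (@cvgrPdist_le _ _ T F FF f l).1 H (e%:C%C : C).
  rewrite (ltcR 0 e) => /(_ e0); apply: filterS => x.
  by rewrite nmBC -lecR -nmE.
apply/(@cvgrPdist_le _ _ T F FF f l) => e e0.
(* The radius e lives in [Cx R], where being positive includes being real; its real part is
   therefore an equivalent real radius. *)
have eE : e = ((complex.Re e)%:C)%C by rewrite RRe_real // ger0_real // ltW.
have r0 : 0 < complex.Re e by rewrite -ltcR -eE.
apply: filterS (H _ r0) => x.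
by rewrite nmBC -lecR -nmE -eE.
Qed.

Lemma cvg_dist_bound (u v : nat -> C) (a b : C) (B : R) :
  u @ \oo --> a -> v @ \oo --> b -> (forall N, nm (u N - v N) <= B) -> nm (a - b) <= B.
Proof.
move=> /cvg_nmP ua /cvg_nmP vb H; apply/ler_addgt0Pr => e e0.
have e2 : 0 < e / 2 by rewrite divr_gt0.
have [N [Hu Hv]] := filter_ex (filterI (ua _ e2) (vb _ e2)).
have -> : a - b = (u N - v N) - (u N - a) + (v N - b) by ring.
have := nmD (u N - v N - (u N - a)) (v N - b); have := nmB (u N - v N) (u N - a).
move: (H N) Hu Hv; lra.
Qed.

Lemma real_seq_cvgC (u : nat -> C) (a b : R) :
  (fun n => complex.Re (u n)) @ \oo --> a ->
  (fun n => complex.Im (u n)) @ \oo --> b ->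
  u @ \oo --> (Complex a b : C).
Proof.
move=> Ha Hb; apply/cvg_nmP => e e0.
have e2 : 0 < e / 2 by rewrite divr_gt0.
move/cvgrPdist_le/(_ _ e2): Ha => Ha.
move/cvgrPdist_le/(_ _ e2): Hb => Hb.
apply: filterS2 Ha Hb => n Ha Hb; apply: le_trans (nm_le_ReIm _) _.
move: Ha Hb; case: (u n) => x y /= Ha Hb.
rewrite -(distrC a) -(distrC b); lra.
Qed.

(** The real and imaginary parts are dominated by the modulus, so completeness is needed only for
    real series. *)
Lemma abs_summable_cvgC (u : nat -> C) (K : R) :
  (forall N, \sum_(m < N) nm (u m) <= K) ->
  exists l : C, (fun N => \sum_(m < N) u m) @ \oo --> l.
Proof.
move=> HK.
have key (g : nat -> R) : (forall m, `|g m| <= nm (u m)) ->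
    exists l : R, (fun N => \sum_(m < N) g m) @ \oo --> l.
  move=> Hg.
  have : cvgn (series (fun m => `|g m|)).
    apply: nondecreasing_is_cvgn.
      by apply: nondecreasing_series => i _ _.
    exists K => _ [N _ <-]; apply: le_trans (HK N).
    by rewrite /series /= big_mkord; apply: ler_sum.
  move/normed_cvg => H; exists (limn (series g)).
  by move: H; under [series g]eq_fun => N do rewrite /series /= big_mkord.
have [a Ha] := key (fun m => complex.Re (u m)) (fun m => Re_le_nm (u m)).
have [b Hb] := key (fun m => complex.Im (u m)) (fun m => Im_le_nm (u m)).
exists (Complex a b : C); apply: real_seq_cvgC.
  have E N : complex.Re (\sum_(m < N) u m) = \sum_(m < N) complex.Re (u m).
    by elim/big_rec2: _ => // i y x _ <-; case: (u i) => ? ?; case: x.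
  by under eq_fun do rewrite E.
have E N : complex.Im (\sum_(m < N) u m) = \sum_(m < N) complex.Im (u m).
  by elim/big_rec2: _ => // i y x _ <-; case: (u i) => ? ?; case: x.
by under eq_fun do rewrite E.
Qed.

Lemma cvgC_lim T (F : set_system T) {FF : ProperFilter F} (f : T -> C) (l : C) :
  (f x @[x --> F] --> l) -> lim (f x @[x --> F]) = l.
Proof. exact: (cvg_lim (@norm_hausdorff C C)). Qed.

Lemma cvgC_unique T (F : set_system T) {FF : ProperFilter F} (f : T -> C) (l l' : C) :
  (f x @[x --> F] --> l) -> (f x @[x --> F] --> l') -> l = l'.
Proof. by move=> /cvgC_lim <- /cvgC_lim <-. Qed.

Lemma nbhs_nm (x : C) (r : R) : 0 < r -> \forall z \near x, nm (z - x) <= r.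
Proof.
have H : (fun z : C => z) @ x --> x by exact: cvg_id.
by move/cvg_nmP: H; apply.
Qed.

Lemma nbhs_nmP (x : C) (P : C -> Prop) :
  (\forall z \near x, P z) -> exists2 r : R, 0 < r & forall z, nm (z - x) <= r -> P z.
Proof.
move=> /nbhs_ballP[e /= e0 H].
have eE : e = ((complex.Re e)%:C)%C by rewrite RRe_real // ger0_real // ltW.
have r0 : 0 < complex.Re e by rewrite -ltcR -eE.
exists (complex.Re e / 2); first by rewrite divr_gt0.
move=> z Hz; apply: H; rewrite -ball_normE /ball_ /= nmE nmBC eE ltcR.
by apply: le_lt_trans Hz _; lra.
Qed.

End Norm.
Arguments nm {R} z : simpl never.

Section CvgC.
Variable R : realType.
Local Notation C := (Cx R).
Variables (T : Type) (F : set_system T).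
Context {FF : Filter F}.
Lemma cvgC_add (f g : T -> C) (a b : C) : f @ F --> a -> g @ F --> b -> (fun x => f x + g x) @ F --> a + b.
Proof. exact: (@cvgD C C T F FF f g a b). Qed.

Lemma cvgC_sub (f g : T -> C) (a b : C) : f @ F --> a -> g @ F --> b -> (fun x => f x - g x) @ F --> a - b.
Proof. exact: (@cvgB C C T F FF f g a b). Qed.

Lemma cvgC_opp (f : T -> C) (a : C) : f @ F --> a -> (fun x => - f x) @ F --> - a.
Proof. exact: (@cvgN C C T F FF f a). Qed.

Lemma cvgC_mul (f g : T -> C) (a b : C) : f @ F --> a -> g @ F --> b -> (fun x => f x * g x) @ F --> a * b.
Proof. exact: (@cvgM C T F FF f g a b). Qed.

Lemma cvgC_inv (f : T -> C) (a : C) : a != 0 -> f @ F --> a -> (fun x => (f x)^-1) @ F --> a^-1.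
Proof. exact: (@cvgV C T F FF f a). Qed.

Lemma cvgC_div (f g : T -> C) (a b : C) : b != 0 -> f @ F --> a -> g @ F --> b -> (fun x => f x / g x) @ F --> a / b.
Proof. by move=> b0 fa gb; exact: (cvgC_mul fa (cvgC_inv b0 gb)). Qed.

Lemma cvgC_cst (a : C) : (fun _ : T => a) @ F --> a.
Proof. exact: cvg_cst. Qed.

Lemma cvgC_prod (I : Type) (s : seq I) (P : pred I) (f : I -> T -> C) (a : I -> C) :
  (forall i, P i -> f i @ F --> a i) ->
  (fun x => \prod_(i <- s | P i) f i x) @ F --> \prod_(i <- s | P i) a i.
Proof.
move=> H; elim: s => [|i s IH].
  by rewrite big_nil; under eq_fun do rewrite big_nil; exact: cvgC_cst.
rewrite big_cons; under eq_fun do rewrite big_cons.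
by case Pi : (P i); [exact: (cvgC_mul (H i Pi) IH)|exact: IH].
Qed.

Lemma cvgC_sum (I : Type) (s : seq I) (P : pred I) (f : I -> T -> C) (a : I -> C) :
  (forall i, P i -> f i @ F --> a i) ->
  (fun x => \sum_(i <- s | P i) f i x) @ F --> \sum_(i <- s | P i) a i.
Proof.
move=> H; elim: s => [|i s IH].
  by rewrite big_nil; under eq_fun do rewrite big_nil; exact: cvgC_cst.
rewrite big_cons; under eq_fun do rewrite big_cons.
by case Pi : (P i); [exact: (cvgC_add (H i Pi) IH)|exact: IH].
Qed.

Lemma cvgC_eq (f g : T -> C) (a : C) : (\forall x \near F, f x = g x) -> f @ F --> a -> g @ F --> a.
Proof.
move=> fg /cvg_nmP H; apply/cvg_nmP => e e0.
by apply: filterS2 fg (H e e0) => x ->.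
Qed.

End CvgC.

(** * Lipschitz calculus at a point *)

Section Lip.
Variable R : realType.
Local Notation C := (Cx R).

(* Lipschitz at the single point [x]; this replaces holomorphy throughout. *)
Definition Lip (f : C -> C) (x : C) : Prop :=
  exists L r : R, [/\ 0 <= L, 0 < r &
    forall z, nm (z - x) <= r -> nm (f z - f x) <= L * nm (z - x)].

Lemma Lip_cvg f x : Lip f x -> f z @[z --> x] --> f x.
Proof.
move=> [L [r [L0 r0 H]]]; apply: (@cvg_nmP R C (nbhs x) (nbhs_filter x) f (f x)).2 => e e0; set m := Num.min r (e / (L + 1)).
have m0 : 0 < m.
  by rewrite lt_min r0 divr_gt0 // ltr_wpDl.
have {m0} := nbhs_nm x m0; apply: filterS => z; rewrite le_min => /andP[Hz Hz2].
apply: le_trans (H _ Hz) _.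
rewrite ler_pdivlMr ?ltr_wpDl // in Hz2; apply: le_trans Hz2.
by rewrite mulrC ler_wpM2l ?nm_ge0 // lerDl.
Qed.

Lemma Lip_bounded f x : Lip f x -> exists B r : R, [/\ 0 <= B, 0 < r &
   forall z, nm (z - x) <= r -> nm (f z) <= B].
Proof.
move=> [L [r [L0 r0 H]]]; exists (nm (f x) + L * r), r; split=> // [|z Hz].
  by rewrite addr_ge0 ?nm_ge0 ?mulr_ge0 // ltW.
have := nm_le_dist (f z) (f x); rewrite lerBlDr => /le_trans; apply.
by rewrite addrC lerD2l; apply: le_trans (H z Hz) _; rewrite ler_wpM2l.
Qed.

Lemma Lip_cst c x : Lip (fun=> c) x.
Proof. by exists 0, 1; split=> // z _; rewrite subrr nm0 mul0r. Qed.

Lemma Lip_id x : Lip id x.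
Proof. by exists 1, 1; split=> // z _; rewrite mul1r. Qed.

Lemma LipD f g x : Lip f x -> Lip g x -> Lip (fun z => f z + g z) x.
Proof.
move=> [L [r [L0 r0 H]]] [L' [r' [L0' r0' H']]].
exists (L + L'), (Num.min r r'); split; rewrite ?addr_ge0 ?lt_min ?r0 //.
move=> z; rewrite le_min => /andP[h h'].
have -> : f z + g z - (f x + g x) = (f z - f x) + (g z - g x) by ring.
by rewrite mulrDl; apply: le_trans (nmD _ _) _; apply: lerD; [apply: H|apply: H'].
Qed.

Lemma LipM f g x : Lip f x -> Lip g x -> Lip (fun z => f z * g z) x.
Proof.
move=> Hf [L' [r' [L0' r0' H']]].
have [B [s [B0 s0 HB]]] := Lip_bounded Hf.
have [L [r [L0 r0 H]]] := Hf.
exists (B * L' + L * nm (g x)), (Num.min r (Num.min r' s)); split.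
- by rewrite addr_ge0 ?mulr_ge0 ?nm_ge0.
- by rewrite !lt_min r0 r0' s0.
move=> z; rewrite !le_min => /and3P[h h' h''].
have -> : f z * g z - f x * g x = f z * (g z - g x) + (f z - f x) * g x by ring.
apply: le_trans (nmD _ _) _; rewrite !nmM mulrDl; apply: lerD.
  by rewrite -mulrA ler_pM ?nm_ge0 // ?HB ?H'.
by rewrite mulrAC ler_wpM2r ?nm_ge0 ?H.
Qed.

Lemma eq_Lip f g x : f =1 g -> Lip f x -> Lip g x.
Proof. by move=> /funext ->. Qed.

Lemma LipN f x : Lip f x -> Lip (fun z => - f z) x.
Proof.
move=> H; apply: eq_Lip (LipM (Lip_cst (-1) x) H) => z.
by rewrite mulN1r.
Qed.

Lemma Lip_lower f x : f x != 0 -> Lip f x -> exists2 r : R, 0 < r &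
  forall z, nm (z - x) <= r -> nm (f x) / 2 <= nm (f z).
Proof.
move=> fx0 [L [r [L0 r0 H]]].
have n0 : 0 < nm (f x) by rewrite nm_gt0.
exists (Num.min r (nm (f x) / 2 / (L + 1))).
  by rewrite lt_min r0 !divr_gt0 // ltr_wpDl.
move=> z; rewrite le_min => /andP[h h'].
have h2 : nm (f z - f x) <= nm (f x) / 2.
  apply: le_trans (H _ h) _.
  rewrite ler_pdivlMr ?ltr_wpDl // in h'; apply: le_trans h'.
  by rewrite mulrC ler_wpM2l ?nm_ge0 // lerDl.
have := nm_le_dist (f x) (f z); rewrite nmBC; lra.
Qed.

Lemma LipV f x : f x != 0 -> Lip f x -> Lip (fun z => (f z)^-1) x.
Proof.
move=> fx0 Lf; have [s s0 Hs] := Lip_lower fx0 Lf.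
have [L [r [L0 r0 H]]] := Lf.
have n0 : 0 < nm (f x) by rewrite nm_gt0.
exists (L * (2 / nm (f x) ^+ 2)), (Num.min r s); split; rewrite ?lt_min ?r0 //.
  by rewrite mulr_ge0 // divr_ge0 // exprn_ge0 // ltW.
move=> z; rewrite le_min => /andP[h h']; have fz := Hs z h'.
have fz0 : f z != 0 by rewrite -nm_gt0; apply: lt_le_trans fz; rewrite divr_gt0.
have -> : (f z)^-1 - (f x)^-1 = (f x - f z) / (f z * f x) by field; rewrite fz0 fx0.
rewrite nmM nmV nmM nmBC mulrAC.
apply: ler_pM; rewrite ?nm_ge0 ?invr_ge0 ?mulr_ge0 ?nm_ge0 ?H //.
have -> : 2 / nm (f x) ^+ 2 = (nm (f x) / 2 * nm (f x))^-1.
  by field; rewrite gt_eqF.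
rewrite lef_pV2 ?posrE ?mulr_gt0 ?divr_gt0 //; last by rewrite nm_gt0.
by rewrite ler_wpM2r ?nm_ge0.
Qed.

Lemma Lip_prod (I : Type) (s : seq I) (P : pred I) (F : I -> C -> C) x :
  (forall i, Lip (F i) x) -> Lip (fun z => \prod_(i <- s | P i) F i z) x.
Proof.
move=> H; elim: s => [|i s IH].
  by apply: eq_Lip (Lip_cst 1 x) => z; rewrite big_nil.
case Pi : (P i); last by apply: eq_Lip IH => z; rewrite big_cons Pi.
by apply: eq_Lip (LipM (H i) IH) => z; rewrite big_cons Pi.
Qed.

Lemma Lip_comp f g x : Lip g x -> Lip f (g x) -> Lip (fun z => f (g z)) x.
Proof.
move=> [L [r [L0 r0 H]]] [L' [r' [L0' r0' H']]].
exists (L' * L), (Num.min r (r' / (L + 1))); split; rewrite ?mulr_ge0 //.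
  by rewrite lt_min r0 divr_gt0 // ltr_wpDl.
move=> z; rewrite le_min => /andP[h h'].
have hg : nm (g z - g x) <= r'.
  apply: le_trans (H _ h) _.
  rewrite ler_pdivlMr ?ltr_wpDl // in h'; apply: le_trans h'.
  by rewrite mulrC ler_wpM2l ?nm_ge0 // lerDl.
by apply: le_trans (H' _ hg) _; rewrite -mulrA ler_wpM2l ?H.
Qed.

Lemma Lip_affine (a b x : C) : Lip (fun z => a * z + b) x.
Proof. by apply: LipD; [apply: LipM; [exact: Lip_cst|exact: Lip_id]|exact: Lip_cst]. Qed.

End Lip.

(** * The complex exponential: periods and linear bounds near 0 *)

Section Exp.
Variable R : realType.
Local Notation C := (Cx R).

Lemma cexpD (w z : C) : cexp (w + z) = cexp w * cexp z.
Proof.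
case: w z => [a b] [c d]; apply/eqP; rewrite eq_complex /=.
by rewrite expRD sinD cosD; apply/andP; split; apply/eqP; ring.
Qed.

Lemma nm_cexp (z : C) : nm (cexp z) = expR (complex.Re z).
Proof.
case: z => a b; rewrite /nm /= !exprMn -mulrDr cos2Dsin2 mulr1 sqrtr_sqr.
by rewrite ger0_norm // expR_ge0.
Qed.

Lemma cexp0 : cexp (0 : C) = 1.
Proof.
by apply/eqP; rewrite eq_complex /= expR0 cos0 sin0 mulr0 mulr1 !eqxx.
Qed.

(** By the mean value theorem sin t = t cos c with 0 < c < t <= 1, and cos decreases on [0, pi], so
    cos c >= cos 1 > 0. *)
Lemma sin_lin_bounds : exists2 c : R, 0 < c & forall y : R, `|y| <= 1 ->
  c * `|y| <= `|sin y| <= `|y|.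
Proof.
exists (cos 1); first exact: cos1_gt0.
move=> y y1.
have key (t : R) : 0 < t <= 1 -> cos 1 * t <= sin t <= t.
  move=> /andP[t0 t1].
  have [|c /=] := @MVT R sin cos 0 t t0 (fun x _ => is_derive_sin x).
    by apply: continuous_subspaceT => x; exact: continuous_sin.
  rewrite in_itv /= => /andP[c0 ct]; rewrite sin0 !subr0 => ->.
  have c1 : c <= 1 by apply: le_trans (ltW ct) t1.
  rewrite ler_pM2r // ler_piMl ?cos_le1 ?(ltW t0) // andbT.
  have pi2 : (2 : R) <= pi := pi_ge2 R.
  rewrite leNgt; apply/negP; rewrite ltr_cos ?in_itv /= ?ler01 ?(ltW c0) //=.
  - by rewrite ltNge c1.
  - lra.
  - lra.
have [->|y0] := eqVneq y 0; first by rewrite sin0 normr0 mulr0 lexx.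
have := key `|y|; rewrite normr_gt0 y0 y1 => /(_ isT).
have -> : sin `|y| = `|sin y|.
  have pi2 : (2 : R) <= pi := pi_ge2 R.
  case: (ltrgt0P y) y1 y0 => [yp|yn|->] y1 _; last by rewrite sin0 normr0.
    by rewrite (ger0_norm (sin_ge0_pi _)) //; lra.
  by rewrite -(normrN (sin y)) -sinN (ger0_norm (sin_ge0_pi _)) //; lra.
by [].
Qed.

(** Everything follows from the tangent inequality e^x >= 1 + x, used at x and at -x; the latter
    gives e^x (1 - x) <= 1. *)
Lemma expR_lin_bounds (x : R) : `|x| <= 1 / 2 ->
  `|x| / 2 <= `|expR x - 1| <= 2 * `|x| /\ 1 / 2 <= expR x <= 2.
Proof.
move=> x1.
have h1 := expR_ge1Dx x; have h2 := expR_ge1Dx (- x).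
have e0 := expR_gt0 x.
have E : expR x * expR (- x) = 1 by rewrite -expRD subrr expR0.
have h3 : expR x * (1 - x) <= 1 by have := ler_wpM2l (ltW e0) h2; rewrite E.
case: (ltrgt0P x) x1 => [xp|xn|x0] x1; last 1 first.
  by rewrite x0 expR0 subrr normr0; split; lra.
  have -> : `|expR x - 1| = expR x - 1 by rewrite ger0_norm //; lra.
  by split; apply/andP; split; nra.
have -> : `|expR x - 1| = 1 - expR x by rewrite ler0_norm ?opprB //; nra.
by split; apply/andP; split; nra.
Qed.

Lemma nm_sqr (z : C) : nm z ^+ 2 = complex.Re z ^+ 2 + complex.Im z ^+ 2.
Proof. by case: z => a b; rewrite /nm /= sqr_sqrtr // addr_ge0 ?sqr_ge0. Qed.

(** The half-angle form has no cross term, so the contributions of x and y can be bounded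
    separately. *)
Lemma nm_cexpB1 (x y : R) :
  nm (cexp (Complex x y : C) - 1) ^+ 2 =
  (expR x - 1) ^+ 2 + expR x * (4 * sin (y / 2) ^+ 2).
Proof.
rewrite nm_sqr /=.
have -> : cos y = 1 - 2 * sin (y / 2) ^+ 2.
  have {1}-> : y = (y / 2) *+ 2 by rewrite mulr2n; lra.
  rewrite cos_mulr2n; have := cos2Dsin2 (y / 2); lra.
have -> : sin y = 2 * (cos (y / 2) * sin (y / 2)).
  have {1}-> : y = (y / 2) *+ 2 by rewrite mulr2n; lra.
  rewrite sin_mulr2n; lra.
have := cos2Dsin2 (y / 2).
set c := cos _; set s := sin _; set e := expR x => H.
have -> : (e * (2 * (c * s)) + - 0) = e * (2 * (c * s)) by rewrite subr0.
have -> : (e * (1 - 2 * s ^+ 2) - 1) ^+ 2 + (e * (2 * (c * s))) ^+ 2 =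
  (e * (1 - 2 * s ^+ 2) - 1) ^+ 2 + 4 * e ^+ 2 * (c ^+ 2) * s ^+ 2 by ring.
have -> : c ^+ 2 = 1 - s ^+ 2 by lra.
ring.
Qed.

(** The real arithmetic behind [cexp_lin_bounds], for w = x + i y: n = |w|, m = |e^w - 1|, u = |e^x
    - 1|, v = |sin (y/2)|, e = e^x, a = |x|, b = |y|. Abstracting these quantities leaves polynomial
    inequalities. *)
Lemma exp_bounds_combine (c d n m u v e a b : R) : 0 < c -> c <= 1 / 4 -> c <= d / 2 ->
  0 <= n -> 0 <= m -> 0 <= u -> 0 <= v -> 0 <= a -> 0 <= b ->
  a / 2 <= u -> u <= 2 * a -> 1 / 2 <= e -> e <= 2 ->
  d * (b / 2) <= v -> v <= b / 2 ->
  m ^+ 2 = u ^+ 2 + e * (4 * v ^+ 2) -> n ^+ 2 = a ^+ 2 + b ^+ 2 ->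
  c * n <= m <= 3 * n.
Proof.
move=> c0 c1 cd n0 m0 u0 v0 a0 b0 ua ub e1 e2 va vb mE nE.
apply/andP; split.
  rewrite -(ler_pXn2r (n := 2)) ?nnegrE ?mulr_ge0 ?(ltW c0) // exprMn mE nE mulrDr.
  have c2 : c ^+ 2 <= 1 / 4 by nra.
  have h1 : c ^+ 2 * a ^+ 2 <= u ^+ 2 by nra.
  have h2 : c * b <= v by nra.
  have h3 : (c * b) ^+ 2 <= v ^+ 2 by rewrite ler_pXn2r ?nnegrE ?mulr_ge0 ?(ltW c0).
  have h4 : 0 <= v ^+ 2 by rewrite sqr_ge0.
  nra.
rewrite -(ler_pXn2r (n := 2)) ?nnegrE ?mulr_ge0 // exprMn mE nE mulrDr.
have h1 : u ^+ 2 <= 4 * a ^+ 2 by nra.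
have h2 : v ^+ 2 <= b ^+ 2 / 4 by nra.
have h4 : 0 <= v ^+ 2 by rewrite sqr_ge0.
nra.
Qed.

Lemma cexp_lin_bounds : exists2 c : R, 0 < c & forall w : C, nm w <= 1 / 2 ->
  c * nm w <= nm (cexp w - 1) <= 3 * nm w.
Proof.
have [d d0 Hd] := sin_lin_bounds.
pose c := Num.min (1 / 2) d / 2.
have c0 : 0 < c by rewrite divr_gt0 // lt_min d0 andbT; lra.
exists c => // w w1.
have c1 : c <= 1 / 4.
  have : Num.min (1 / 2) d <= 1 / 2 by rewrite ge_min lexx.
  rewrite /c; lra.
have cd : c <= d / 2.
  have : Num.min (1 / 2) d <= d by rewrite ge_min lexx orbT.
  rewrite /c; lra.
case: w w1 => x y w1.
have x1 : `|x| <= 1 / 2 by apply: le_trans w1; exact: (Re_le_nm (Complex x y)).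
have y1 : `|y| <= 1 / 2 by apply: le_trans w1; exact: (Im_le_nm (Complex x y)).
have [/andP[ex1 ex2] /andP[ex3 ex4]] := expR_lin_bounds x1.
have yh : `|y / 2| = `|y| / 2 by rewrite normrM (ger0_norm (x := 2^-1)) // invr_ge0.
have /Hd/andP[s1 s2] : `|y / 2| <= 1 by rewrite yh; lra.
rewrite yh in s1 s2.
have [X2 Y2] : `|x| ^+ 2 = x ^+ 2 /\ `|y| ^+ 2 = y ^+ 2 by rewrite !real_normK ?num_real.
have [E2 S2] : `|expR x - 1| ^+ 2 = (expR x - 1) ^+ 2 /\ `|sin (y / 2)| ^+ 2 = sin (y / 2) ^+ 2.
  by rewrite !real_normK ?num_real.
have a0 := normr_ge0 x; have b0 := normr_ge0 y.
have N := nm_cexpB1 x y.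
have M : nm (Complex x y : C) ^+ 2 = x ^+ 2 + y ^+ 2 := nm_sqr _.
rewrite -E2 -S2 in N; rewrite -X2 -Y2 in M.
have := exp_bounds_combine c0 c1 cd (nm_ge0 (Complex x y)) (nm_ge0 (cexp (Complex x y) - 1))
  (normr_ge0 (expR x - 1)) (normr_ge0 (sin (y / 2))) a0 b0 ex1 ex2 ex3 ex4 s1 s2.
by move=> /(_ N M).
Qed.

Lemma eeD (w z : C) : ee (w + z) = ee w * ee z.
Proof. by rewrite /ee mulrDr cexpD. Qed.

Lemma ee0 : ee (0 : C) = 1.
Proof. by rewrite /ee mulr0 cexp0. Qed.

Lemma ee_neq0 (z : C) : ee z != 0.
Proof.
apply/negP => /eqP H; have := eeD z (- z).
by rewrite subrr ee0 H mul0r => /eqP; rewrite oner_eq0.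
Qed.

Lemma eeN (z : C) : ee (- z) = (ee z)^-1.
Proof.
by apply: (mulfI (ee_neq0 z)); rewrite -eeD subrr ee0 mulfV // ee_neq0.
Qed.

Lemma eeMn (z : C) (k : nat) : ee (z *+ k) = ee z ^+ k.
Proof. by elim: k => [|k IH]; rewrite ?mulr0n ?ee0 // mulrS exprS eeD IH. Qed.

Lemma ee_natM (z : C) (k : nat) : ee (k%:R * z) = ee z ^+ k.
Proof. by rewrite mulr_natl eeMn. Qed.

Lemma ee_intM (z : C) (k : int) : ee (k%:~R * z) = ee z ^ k.
Proof.
case: k => k; first by rewrite -pmulrn ee_natM.
by rewrite NegzE mulrNz mulNr eeN -pmulrn ee_natM -exprnN.
Qed.

Lemma ee1 : ee (1 : C) = 1.
Proof.
rewrite /ee mulr1; apply/eqP; rewrite eq_complex /= expR0 !mul1r.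
by rewrite mulr_natl cos2pi sin2pi !eqxx.
Qed.

Lemma ee_int (k : int) : ee (k%:~R : C) = 1.
Proof. by rewrite -[k%:~R]mulr1 ee_intM ee1 exp1rz. Qed.

Lemma nm_ee (z : C) : nm (ee z) = expR (- (2 * pi * Imc z)).
Proof. by rewrite nm_cexp; case: z => a b /=; rewrite mul0r sub0r. Qed.

Lemma ee_eq1 (z : C) : ee z = 1 -> exists k : int, z = k%:~R.
Proof.
case: z => a b Hz.
have b0 : b = 0.
  have := nm_ee (Complex a b); rewrite Hz nm1 /= => /esym; rewrite -[RHS]expR0.
  move/expR_inj/eqP; rewrite oppr_eq0 mulf_eq0 => /orP[|/eqP //].
  by rewrite mulf_eq0 (gt_eqF (pi_gt0 R)) orbF pnatr_eq0.
pose k := Num.floor a; exists k.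
have [k1 k2] : k%:~R <= a /\ a < k%:~R + 1.
  by split; [exact: floor_le|have := lt_succ_floor a; rewrite intrD].
set t := a - k%:~R.
have aE : (Complex a b : C) = k%:~R + t%:C%C.
  have -> : (k%:~R : C) = (k%:~R : R)%:C%C by rewrite rmorph_int.
  by apply/eqP; rewrite eq_complex /= b0 addr0 /t addrC subrK !eqxx.
move: Hz; rewrite aE eeD ee_int mul1r => Ht.
have t0 : 0 <= t < 1 by rewrite /t; lra.
have ct : cos (2 * pi * t) = 1.
  by have := congr1 (@complex.Re R) Ht; rewrite /= mul0r mulr0 subr0 expR0 mul1r (mul0r 0) add0r.
suff -> : t = 0 by rewrite addr0.
have pi0 := pi_gt0 R.
(* Since cos is injective only on [0, pi], an angle beyond pi is reflected to 2 pi - 2 pi t; that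
   case then contradicts t < 1. *)
have [] : 2 * pi * t = 0 \/ 2 * pi - 2 * pi * t = 0.
  case: (lerP t (1/2)) => h; [left|right]; apply: (@cos_inj R).
  - by rewrite in_itv /=; nra.
  - by rewrite in_itv /= lexx ltW.
  - by rewrite ct cos0.
  - by rewrite in_itv /=; nra.
  - by rewrite in_itv /= lexx ltW.
  - rewrite -cosN opprB -(cosD2pi (_ - _)).
  by rewrite (_ : _ + pi *+ 2 = 2 * pi * t) ?ct ?cos0 // mulr2n; ring.
- by move/eqP; rewrite !mulf_eq0 pnatr_eq0 (gt_eqF pi0) => /eqP.
- by move=> h; exfalso; nra.
Qed.

Lemma ee_lin_bounds : exists c L r : R, [/\ 0 < c, 0 < L, 0 < r & forall h : C, nm h <= r ->
  c * nm h <= nm (ee h - 1) <= L * nm h].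
Proof.
have [c c0 H] := cexp_lin_bounds.
have pi0 := pi_gt0 R.
have E (h : C) : nm ((Complex 0 (2 * pi) : C) * h) = 2 * pi * nm h.
  rewrite nmM; congr (_ * _).
  by rewrite /nm /= expr0n /= add0r sqrtr_sqr ger0_norm // mulr_ge0 // ltW.
exists (c * (2 * pi)), (3 * (2 * pi)), (1 / 2 / (2 * pi)); split; try by rewrite ?divr_gt0 ?mulr_gt0.
move=> h Hh; rewrite -!mulrA ![2 * (pi * _)]mulrA -E; apply: H.
by rewrite E mulrC -ler_pdivlMr // mulr_gt0.
Qed.

Lemma Lip_ee (x : C) : Lip (@ee R) x.
Proof.
have [c [L [r [c0 L0 r0 H]]]] := ee_lin_bounds.
exists (nm (ee x) * L), r; split=> //; first by rewrite mulr_ge0 ?nm_ge0 ?ltW.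
move=> z /H/andP[_ h].
have -> : ee z - ee x = ee x * (ee (z - x) - 1).
  by rewrite mulrBr mulr1 -eeD (addrC x) subrK.
by rewrite nmM -mulrA ler_wpM2l ?nm_ge0.
Qed.

End Exp.

(** * The theta series as a pair of power series in X and 1/X *)

Section Theta.
Variable R : realType.
Local Notation C := (Cx R).

Lemma expr_small (p c : R) : 0 <= p < 1 -> exists M : nat, forall m, (M <= m)%N -> p ^+ m * c <= 1 / 2.
Proof.
move=> /andP[p0 p1].
have H : (fun n => p ^+ n * c) @ \oo --> (0 : R).
  by rewrite -[X in _ --> X](mul0r c); apply: cvgMl; apply: cvg_expr; rewrite ger0_norm.
have [|M _ HM] := (cvgrPdist_le _ _).1 H (1 / 2); first by [].
exists M => m Hm; have := HM m Hm; rewrite /= sub0r normrN => h.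
exact: le_trans (ler_norm _) h.
Qed.

(** The ratio of consecutive terms is p^m c, at most 1/2 from some M on. From there S_N + 2 a_N is
    nonincreasing, which bounds the partial sums. *)
Lemma psum_bound (p c : R) : 0 <= p < 1 -> 0 <= c -> exists2 K : R, 0 <= K &
  forall N, \sum_(m < N) p ^+ 'C(m, 2) * c ^+ m <= K.
Proof.
move=> p01 c0; have /andP[p0 p1] := p01.
pose a m := p ^+ 'C(m, 2) * c ^+ m.
have a0 m : 0 <= a m by rewrite mulr_ge0 ?exprn_ge0.
have aS m : a m.+1 = a m * (p ^+ m * c).
  by rewrite /a binS bin1 exprD exprSr; ring.
have [M HM] := expr_small c p01.
pose S N := \sum_(m < N) a m.
have S0 N : 0 <= S N by apply: sumr_ge0 => i _; exact: a0.
have SS N : S N.+1 = S N + a N by rewrite /S big_ord_recr.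
have key k : S (M + k)%N + 2 * a (M + k)%N <= S M + 2 * a M.
  elim: k => [|k IH]; first by rewrite addn0.
  rewrite addnS SS; apply: le_trans IH.
  have := ler_wpM2l (a0 (M + k)%N) (HM _ (leq_addr k M)); rewrite -aS; lra.
exists (S M + 2 * a M) => [|N]; first by have := S0 M; have := a0 M; lra.
have [MN|NM] := leqP M N.
  have := key (N - M)%N; rewrite subnKC // -/(S N); have := a0 N; lra.
have SM : S N <= S M.
  rewrite -(subnKC (ltnW NM)); elim: (M - N)%N => [|k IH]; first by rewrite addn0.
  by rewrite addnS SS; apply: le_trans IH _; rewrite lerDl.
by have := a0 M; move: SM; rewrite /S /a; lra.
Qed.

Lemma expr_dist (x y : C) (r : R) m : nm x <= r -> nm y <= r ->
  nm (x ^+ m.+1 - y ^+ m.+1) <= m.+1%:R * r ^+ m * nm (x - y).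
Proof.
move=> xr yr; rewrite subrXX nmM mulrC.
apply: ler_wpM2r; first exact: nm_ge0.
apply: le_trans (nm_sum _ _ _) _.
have r0 : 0 <= r by apply: le_trans xr; exact: nm_ge0.
rewrite -[m.+1 in X in _ <= X]card_ord -sumr_const mulr_suml; apply: ler_sum => i _.
rewrite mul1r nmM !nmX /=.
have -> : r ^+ m = r ^+ (m - i) * r ^+ i by rewrite -exprD subnK // -ltnS.
by apply: ler_pM; rewrite ?exprn_ge0 ?nm_ge0 // lerXn2r ?nnegrE ?nm_ge0.
Qed.

Definition theta_coef (q : C) (m : nat) : C := (-1) ^+ m * q ^+ 'C(m, 2).

Lemma nm_theta_coef q m : nm (theta_coef q m) = nm q ^+ 'C(m, 2).
Proof. by rewrite nmM nm_sign mul1r nmX. Qed.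

(* The terms m >= 0 of sum_m (-1)^m q^(m(m-1)/2) X^m. *)
Definition half_theta (q X : C) : C := limn (fun N => \sum_(m < N) theta_coef q m * X ^+ m).

Lemma theta_coef_sum_bound (q : C) (c : R) : nm q < 1 -> 0 <= c -> exists2 K : R, 0 <= K &
  forall N, \sum_(m < N) nm (theta_coef q m) * c ^+ m <= K.
Proof.
move=> q1 c0; have [|K K0 HK] := @psum_bound (nm q) c _ c0; first by rewrite nm_ge0.
by exists K => // N; under eq_bigr do rewrite nm_theta_coef.
Qed.

Lemma half_theta_cvg (q X : C) : nm q < 1 ->
  (fun N => \sum_(m < N) theta_coef q m * X ^+ m) @ \oo --> half_theta q X.
Proof.
move=> q1; have [K K0 HK] := theta_coef_sum_bound q1 (nm_ge0 X).
have [|l Hl] := @abs_summable_cvgC R (fun m => theta_coef q m * X ^+ m) K.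
  by move=> N; under eq_bigr do rewrite nmM nmX.
by rewrite /half_theta (cvgC_lim Hl).
Qed.

Lemma Lip_half_theta (q X : C) : nm q < 1 -> Lip (half_theta q) X.
Proof.
move=> q1; pose r := nm X + 1.
have r1 : 1 <= r by rewrite lerDr nm_ge0.
have r0 : 0 <= r by apply: le_trans r1.
(* The radius is doubled because differentiating X^(m+1) costs a factor m + 1 <= 2^(m+1); r >= 1
   allows r^m <= r^(m+1). *)
have [K K0 HK] := theta_coef_sum_bound q1 (mulr_ge0 (ler0n R 2) r0).
exists K, 1; split=> // z zX.
have zr : nm z <= r by have := nm_le_dist z X; rewrite /r; lra.
have Xr : nm X <= r by rewrite lerDl.
apply: (cvg_dist_bound (@half_theta_cvg q z q1) (@half_theta_cvg q X q1)) => N.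
rewrite -sumrB; apply: le_trans (nm_sum _ _ _) _.
apply: le_trans (ler_wpM2r (nm_ge0 _) (HK N)); rewrite mulr_suml.
apply: ler_sum => -[m _] _ /=.
rewrite -mulrBr nmM -mulrA; apply: ler_wpM2l; first exact: nm_ge0.
case: m => [|m]; first by rewrite !expr0 subrr nm0 mul1r nm_ge0.
apply: le_trans (expr_dist _ zr Xr) _; apply: ler_wpM2r; first exact: nm_ge0.
rewrite exprMn; apply: ler_pM; rewrite ?exprn_ge0 //.
  by rewrite -natrX ler_nat ltnW // ltn_expl.
by rewrite exprS ler_peMl ?exprn_ge0.
Qed.

(* The bilateral series: [half_theta] at X counts m >= 0, and -X times
   [half_theta] at 1/X counts m <= 1, so the terms m = 0, 1 (that is, 1 - X)
   are subtracted once.  Then theta eta z = qtheta (ee eta) (ee z). *)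
Definition qtheta (q X : C) : C := half_theta q X - X * half_theta q X^-1 + X - 1.

Lemma Lip_qtheta (q X : C) : nm q < 1 -> X != 0 -> Lip (qtheta q) X.
Proof.
move=> q1 X0; apply: LipD; last exact: Lip_cst.
apply: LipD; last exact: Lip_id.
apply: LipD; first exact: Lip_half_theta.
apply: LipN; apply: LipM; first exact: Lip_id.
by apply: (Lip_comp (f := half_theta q)); [apply: LipV => //; exact: Lip_id|exact: Lip_half_theta].
Qed.

(** The bilateral partial sum over indices from -N to N - 1. The term of index -(m+1) has exponent
    (m+1)(m+2)/2 = C(m+2, 2), hence equals -X times term m+2 of the series in 1/X. *)
Definition qtheta_part (q X : C) (N : nat) : C :=
  \sum_(m < N) (theta_coef q m * X ^+ m - X * (theta_coef q m.+2 * X^-1 ^+ m.+2)).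

Lemma qtheta_cvg (q X : C) : nm q < 1 -> X != 0 -> qtheta_part q X @ \oo --> qtheta q X.
Proof.
move=> q1 X0.
have H1 := @half_theta_cvg q X q1; have H2 := @half_theta_cvg q X^-1 q1.
have H3 : (fun N => \sum_(m < N.+2) theta_coef q m * X^-1 ^+ m) @ \oo --> half_theta q X^-1.
  by rewrite (cvg_shiftS (fun N => \sum_(m < N.+1) _)) (cvg_shiftS (fun N => \sum_(m < N) _)).
have H5 := cvgB (cvgD (cvgB H1 (cvgM (cvg_cst X) H3)) (cvg_cst X)) (cvg_cst (1 : C)).
have -> : qtheta_part q X = (fun N => \sum_(m < N) theta_coef q m * X ^+ m
    - X * \sum_(m < N.+2) theta_coef q m * X^-1 ^+ m + X - 1); last exact: H5.
apply/funext => N.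
rewrite /qtheta_part /= sumrB !big_ord_recl /= -mulr_sumr.
rewrite /theta_coef !bin0n /= /bump /= !expr0 !expr1 !mulr1.
set A := \sum_(i < N) _; set B := \sum_(i < N) _.
by field.
Qed.

End Theta.

(** * The Jacobi triple product *)

Section QBinom.
Variable F : fieldType.
Variable q : F.

Definition qpoch (n : nat) : F := \prod_(m < n) (1 - q ^+ m.+1).

(** The Gaussian binomial, defined by its Pascal rule so that it makes sense for every q, including
    roots of unity; [qbin_qpoch] gives the quotient formula in division-free form. *)
Fixpoint qbin (n j : nat) : F :=
  match n, j with
  | 0, 0 => 1
  | 0, _.+1 => 0
  | _.+1, 0 => 1
  | n'.+1, j'.+1 => qbin n' j'.+1 + q ^+ (n' - j') * qbin n' j'
  end.

Lemma qbin0 n : qbin n 0 = 1. Proof. by case: n. Qed.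

Lemma qbin_small n j : (n < j)%N -> qbin n j = 0.
Proof.
elim: n j => [|n IH] [|j] //=; rewrite ltnS => nj.
by rewrite !IH ?mulr0 ?addr0 // ltnW.
Qed.

Lemma qpochS n : qpoch n.+1 = qpoch n * (1 - q ^+ n.+1).
Proof. by rewrite /qpoch big_ord_recr. Qed.

Lemma qbin_qpoch n j : (j <= n)%N -> qbin n j * (qpoch j * qpoch (n - j)) = qpoch n.
Proof.
elim: n j => [|n IH] [|j] //=; first by rewrite /qpoch big_ord0 !mulr1.
  by move=> _; rewrite mul1r {1}/qpoch big_ord0 mul1r subn0.
rewrite ltnS => jn; rewrite subSS mulrDl.
have E2 : q ^+ (n - j) * qbin n j * (qpoch j.+1 * qpoch (n - j)) =
   q ^+ (n - j) * (1 - q ^+ j.+1) * qpoch n.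
  by rewrite -(IH j jn) qpochS; ring.
rewrite E2; have [jn'|] := ltnP j n; last first.
  move=> nj; have -> : j = n by apply/eqP; rewrite eqn_leq jn nj.
  by rewrite qbin_small // mul0r add0r subnn expr0 mul1r qpochS mulrC.
have E1 : qbin n j.+1 * (qpoch j.+1 * qpoch (n - j)) = (1 - q ^+ (n - j)) * qpoch n.
  have e : (n - j = (n - j.+1).+1)%N by rewrite -subSn.
  by rewrite -(IH j.+1 jn') e [qpoch (n - j.+1).+1]qpochS -e; ring.
rewrite E1 qpochS.
have -> : q ^+ n.+1 = q ^+ (n - j) * q ^+ j.+1 by rewrite -exprD addnS subnK.
by ring.
Qed.

Definition theta_coefF (m : nat) : F := (-1) ^+ m * q ^+ 'C(m, 2).

Lemma theta_coefFS m : theta_coefF m.+1 = - theta_coefF m * q ^+ m.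
Proof. by rewrite /theta_coefF binS bin1 exprD exprS; ring. Qed.

Lemma theta_coefF0 : theta_coefF 0 = 1. Proof. by rewrite /theta_coefF bin0n !expr0 mulr1. Qed.

Lemma qbinomial n (Y : F) :
  \prod_(m < n) (1 - q ^+ m * Y) = \sum_(j < n.+1) qbin n j * theta_coefF j * Y ^+ j.
Proof.
elim: n => [|n IH].
  by rewrite big_ord0 big_ord_recl big_ord0 addr0 /= /theta_coefF bin0n !expr0 !mulr1.
rewrite big_ord_recr /= IH mulrBr mulr1.
have E1 : \sum_(j < n.+1) qbin n j * theta_coefF j * Y ^+ j =
   1 + \sum_(j < n.+1) qbin n j.+1 * theta_coefF j.+1 * Y ^+ j.+1.
  rewrite big_ord_recl big_ord_recr /= (qbin_small (ltnSn n)) !mul0r addr0.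
  by rewrite qbin0 /theta_coefF bin0n !expr0 !mulr1.
rewrite {1}E1 [in RHS]big_ord_recl /= theta_coefF0 expr0 !mulr1 -addrA; congr (_ + _).
rewrite mulr_suml -sumrB; apply: eq_bigr => i _.
rewrite /bump /= add1n /= theta_coefFS.
have -> : q ^+ n = q ^+ (n - i) * q ^+ i by rewrite -exprD subnK // -ltnS.
by rewrite [Y ^+ i.+1]exprS; ring.
Qed.

Lemma bin2D m : ('C(m, 2) * 2 + m = m * m)%N.
Proof. by elim: m => // m IH; rewrite binS bin1; lia. Qed.

Definition jacobi_prod (X : F) (N : nat) : F :=
  \prod_(m < N) ((1 - q ^+ m * X) * (1 - q ^+ m.+1 / X)).

(* The q-binomial theorem at 2N, with the summation index shifted by N. *)
Lemma jacobi_prod_finite (X : F) N : q != 0 -> X != 0 ->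
  jacobi_prod X N = \sum_(m < N.+1) qbin (N + N) (N + m) * (theta_coefF m * X ^+ m)
   - X * \sum_(m < N) qbin (N + N) (N - m.+1) * (theta_coefF m.+2 * X^-1 ^+ m.+2).
Proof.
move=> q0 X0.
have H := qbinomial (N + N) (q ^- N * X).
have HL : \prod_(m < N + N) (1 - q ^+ m * (q ^- N * X)) =
    jacobi_prod X N * ((-1) ^+ N * X ^+ N / q ^+ 'C(N.+1, 2)).
  rewrite big_split_ord /= mulrC.
  have -> : \prod_(i < N) (1 - q ^+ (N + i) * (q ^- N * X)) = \prod_(i < N) (1 - q ^+ i * X).
    apply: eq_bigr => i _; rewrite exprD; congr (1 - _).
    by field; rewrite expf_neq0.
  rewrite /jacobi_prod big_split /= -!mulrA; congr (_ * _).
  rewrite (reindex_inj rev_ord_inj) /=.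
  (* In reversed order the factor is 1 - X / q^(m+1), which is the wanted factor in 1/X times a
     monomial. *)
  transitivity (\prod_(m < N) ((1 - q ^+ m.+1 / X) * (- X / q ^+ m.+1))).
    apply: eq_bigr => i _.
    have -> : q ^- N = q ^- (N - i.+1) * q ^- i.+1 by rewrite -invfM -exprD subnK.
    by field; rewrite X0 !expf_neq0.
  rewrite big_split /=; congr (_ * _).
  elim: (N) => [|k IH]; first by rewrite big_ord0 !expr0 invr1 !mulr1.
  rewrite big_ord_recr /= IH [in RHS]binS bin1 exprD !exprS.
  by field; rewrite !expf_neq0 // q0.
rewrite HL in H.
have U0 : (-1) ^+ N * X ^+ N / q ^+ 'C(N.+1, 2) != 0.
  by rewrite !mulf_neq0 ?invr_eq0 ?expf_neq0 // oppr_eq0 oner_eq0.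
apply: (mulIf U0); rewrite H {H HL}.
have -> : ((N + N).+1 = N + N.+1)%N by rewrite addnS.
rewrite big_split_ord /= addrC mulrBl mulr_suml; congr (_ + _).
  apply: eq_bigr => i _; rewrite /theta_coefF.
  have e : ('C(N + i, 2) + 'C(N.+1, 2) = 'C(i, 2) + N * (N + i))%N.
    by have := bin2D (N + i); have := bin2D N.+1; have := bin2D i; nia.
  have -> : q ^+ 'C(N + i, 2) = q ^+ 'C(i, 2) * q ^+ (N * (N + i)) / q ^+ 'C(N.+1, 2).
    by rewrite -exprD -e exprD mulfK // expf_neq0.
  rewrite exprMn exprVn -exprM !exprD.
  by field; rewrite !expf_neq0.
rewrite mulr_sumr mulr_suml -sumrN (reindex_inj rev_ord_inj) /=.
apply: eq_bigr => i _; rewrite /theta_coefF.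
move: (nat_of_ord i) (ltn_ord i) => {}i iN.
have e : (N = (N - i.+1) + i.+1)%N by rewrite subnK.
move: (N - i.+1)%N e => k -> {U0}.
have e : ('C(k, 2) + 'C((k + i.+1).+1, 2) = 'C(i.+2, 2) + (k + i.+1) * k)%N.
  by have := bin2D k; have := bin2D (k + i.+1).+1; have := bin2D i.+2; nia.
have -> : q ^+ 'C(k, 2) = q ^+ 'C(i.+2, 2) * q ^+ ((k + i.+1) * k) / q ^+ 'C((k + i.+1).+1, 2).
  by rewrite -exprD -e exprD mulfK // expf_neq0.
have -> : (q ^- (k + i.+1) * X) ^+ k = X ^+ k / q ^+ ((k + i.+1) * k).
  by rewrite exprMn exprVn -exprM mulrC.
rewrite !exprVn.
have -> : (-1 : F) ^+ (k + i.+1) = (-1) ^+ k * (-1) ^+ i * -1 by rewrite exprD exprSr mulrA.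
have -> : X ^+ (k + i.+1) = X ^+ k * X ^+ i * X by rewrite exprD exprSr mulrA.
rewrite [(-1) ^+ i.+2]exprS [(-1) ^+ i.+1]exprS [X ^+ i.+2]exprS [X ^+ i.+1]exprS.
have s2 : (-1 : F) ^+ i * (-1) ^+ i = 1 by rewrite -exprMn mulrNN mulr1 expr1n.
have Xi : X ^+ i != 0 by rewrite expf_neq0.
have q1 : q ^+ ((k + i.+1) * k) != 0 by rewrite expf_neq0.
have q2 : q ^+ 'C((k + i.+1).+1, 2) != 0 by rewrite expf_neq0.
move: ((-1) ^+ i) ((-1) ^+ k) s2 (X ^+ i) Xi (q ^+ (_ * _)) q1 (q ^+ 'C((_ + _).+1, _)) q2.
(* Here s is (-1)^i, now an indeterminate; inserting s s = 1 on the left balances the powers of s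
   and makes the equation a field identity. *)
move=> s t s2 Y Y0 Q Q0 Q' Q'0; rewrite -[LHS]mulr1 -[X in _ * X = _]s2; field.
by rewrite X0 Y0 Q0 Q'0.
Qed.

End QBinom.

(** * Passage to the limit in the finite triple product *)

Section Triple.
Variable R : realType.
Local Notation C := (Cx R).

(** The inequality prod (1 - a_m) >= 1 - sum a_m is applied to a tail whose sum is at most 1/2; the
    finitely many earlier factors are positive. *)
Lemma prod_lower_bound (p B : R) : 0 <= p < 1 -> 0 <= B -> p * B < 1 ->
  exists2 d : R, 0 < d & forall N, d <= \prod_(m < N) (1 - p ^+ m.+1 * B).
Proof.
move=> p01 B0 pB; have /andP[p0 p1] := p01.
pose Q N := \prod_(m < N) (1 - p ^+ m.+1 * B).
have QS N : Q N.+1 = Q N * (1 - p ^+ N.+1 * B) by rewrite /Q big_ord_recr.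
have f0 m : 0 <= p ^+ m.+1 * B < 1.
  rewrite mulr_ge0 ?exprn_ge0 //=; apply: le_lt_trans pB.
  by rewrite exprS -mulrA ler_wpM2l // ler_piMl // exprn_ile1 // ltW.
have Q0 N : 0 < Q N by apply: prodr_gt0 => i _; rewrite subr_gt0; case/andP: (f0 i).
(* With this choice [p ^+ N * B'] is the sum of p^(m+1) B over all m >= N, the mass still to be
   removed after N factors. *)
pose B' := B * p / (1 - p).
have B'0 : 0 <= B' by rewrite divr_ge0 ?mulr_ge0 // subr_ge0 ltW.
have [M HM] := expr_small B' p01.
exists (Q M / 2); first by rewrite divr_gt0.
have key k : Q M * (1 / 2 + p ^+ (M + k) * B') <= Q (M + k)%N.
  elim: k => [|k IH].
    by rewrite addn0 ger_pMr //; have := HM M (leqnn M); lra.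
  rewrite addnS QS.
  set x := p ^+ (M + k) * B'.
  have x0 : 0 <= x by rewrite mulr_ge0 ?exprn_ge0.
  have x1 : x <= 1 / 2 by apply: HM; rewrite leq_addr.
  have -> : p ^+ (M + k).+1 * B = x * (1 - p).
    by rewrite /x /B' exprS; field; rewrite subr_eq0 gt_eqF.
  have -> : p ^+ (M + k).+1 * B' = p * x by rewrite exprS /x mulrA.
  have h : 0 <= 1 - x * (1 - p) by nra.
  apply: le_trans (ler_wpM2r h IH); rewrite -mulrA ler_wpM2l ?(ltW (Q0 _)) // -/x.
  have h1 : 0 <= (1 - p) * x * (1 / 2 - x) by apply: mulr_ge0; [apply: mulr_ge0 => //|]; lra.
  by rewrite -subr_ge0; apply: le_trans h1 _; rewrite le_eqVlt; apply/orP; left; apply/eqP; field.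
move=> N; rewrite -/(Q N); have [MN|NM] := leqP M N.
  rewrite -(subnKC MN); apply: le_trans (key _); rewrite ler_wpM2l ?(ltW (Q0 _)) //.
  have h : 0 <= p ^+ (M + (N - M)) * B' by rewrite mulr_ge0 ?exprn_ge0.
  lra.
have QM : Q M <= Q N.
  rewrite -(subnKC (ltnW NM)); elim: (M - N)%N => [|k IH]; first by rewrite addn0.
  rewrite addnS QS; apply: le_trans IH; rewrite ger_pMr //.
  by have := f0 (N + k)%N; lra.
by have := Q0 M; lra.
Qed.

Variable q : C.
Hypotheses (q0 : q != 0) (q1 : nm q < 1).
Let p := nm q.

Let p01 : 0 <= p < 1. Proof. by rewrite nm_ge0. Qed.
Let pp : 0 < p. Proof. by rewrite nm_gt0. Qed.

Lemma prod_nm_lower (B : R) : 0 <= B -> p * B < 1 ->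
  exists2 d : R, 0 < d & forall N (X : C), nm X <= B ->
    d <= nm (\prod_(m < N) (1 - q ^+ m.+1 * X)).
Proof.
move=> B0 pB; have [d d0 Hd] := prod_lower_bound p01 B0 pB.
exists d => // N X XB; apply: le_trans (Hd N) _; rewrite nm_prod.
apply: ler_prod => i _; apply/andP; split.
  rewrite subr_ge0; apply: le_trans (ltW pB).
  rewrite exprS -mulrA ler_wpM2l ?(ltW pp) // ler_piMl // exprn_ile1 ?(ltW pp) //.
  exact: ltW.
have := nm_le_dist 1 (q ^+ i.+1 * X); rewrite nm1 nmM nmX => h.
by apply: le_trans h; rewrite lerD2l lerN2 ler_wpM2l // exprn_ge0 // ltW.
Qed.

Lemma qpoch_bounds : exists2 d : R, 0 < d & forall n, d <= nm (qpoch q n) <= d^-1.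
Proof.
have [|d d0 Hd] := @prod_lower_bound p 1 p01 ler01; first by rewrite mulr1.
exists d => // n; apply/andP; split.
  apply: le_trans (Hd n) _; rewrite nm_prod.
  apply: ler_prod => i _; rewrite mulr1; apply/andP; split.
    by rewrite subr_ge0 exprn_ile1 // ltW.
  by have := nm_le_dist 1 (q ^+ i.+1); rewrite nm1 nmX.
have h : nm (qpoch q n) <= \prod_(m < n) (1 + p ^+ m.+1).
  rewrite nm_prod; apply: ler_prod => i _; rewrite nm_ge0 /=.
  by apply: le_trans (nmB _ _) _; rewrite nm1 nmX.
(* Factorwise (1 + a)(1 - a) <= 1, so the lower bound d for the product of 1 - p^m becomes the upper
   bound 1/d for the product of 1 + p^m. *)
apply: le_trans h _; rewrite -[leRHS]mul1r ler_pdivlMr //.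
have h0 : 0 <= \prod_(m < n) (1 + p ^+ m.+1).
  by apply: prodr_ge0 => i _; rewrite addr_ge0 // exprn_ge0 // ltW.
apply: le_trans (ler_wpM2l h0 (Hd n)) _; rewrite -big_split /=.
apply: prodr_ile1 => i _; rewrite mulr1.
have a0 : 0 <= p ^+ i.+1 by rewrite exprn_ge0 // ltW.
have a1 : p ^+ i.+1 <= 1 by rewrite exprn_ile1 // ltW.
by apply/andP; split; nra.
Qed.

Lemma qpoch_neq0 n : qpoch q n != 0.
Proof.
by have [d d0 /(_ n)/andP[h _]] := qpoch_bounds; rewrite -nm_gt0; apply: lt_le_trans h.
Qed.

(* [jacobi_scale N] is the reciprocal of the central Gaussian binomial [2N, N],
   and [jacobi_coef N m] is the quotient [2N, N+m] / [2N, N]. *)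
Definition jacobi_scale (N : nat) : C := qpoch q N ^+ 2 / qpoch q (N + N).
Definition jacobi_coef (N m : nat) : C := qpoch q N ^+ 2 / (qpoch q (N + m) * qpoch q (N - m)).

Lemma jacobi_scale_lower : exists2 d : R, 0 < d & forall N, d <= nm (jacobi_scale N).
Proof.
have [d d0 Hd] := qpoch_bounds; exists (d ^+ 2 * d); first by rewrite mulr_gt0 ?exprn_gt0.
move=> N; have /andP[h1 _] := Hd N; have /andP[_ h2] := Hd (N + N)%N.
rewrite nmM nmV nmX; apply: ler_pM; rewrite ?exprn_ge0 ?(ltW d0) //.
  by rewrite lerXn2r ?nnegrE ?nm_ge0 // ltW.
by rewrite -(invrK d) lef_pV2 ?posrE ?invr_gt0 // nm_gt0 qpoch_neq0.
Qed.

Lemma jacobi_coef0 N : jacobi_coef N 0 = 1.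
Proof. by rewrite /jacobi_coef addn0 subn0 -expr2 divff // expf_neq0 ?qpoch_neq0. Qed.

Lemma jacobi_coefS N m : (m < N)%N -> jacobi_coef N m.+1 = jacobi_coef N m * ((1 - q ^+ (N - m)) / (1 - q ^+ (N + m).+1)).
Proof.
move=> mN; have e : (N - m = (N - m.+1).+1)%N by rewrite -subSn.
have n1 := qpoch_neq0 (N - m); have n2 := qpoch_neq0 (N + m).+1.
rewrite e qpochS -e mulf_eq0 negb_or in n1; rewrite qpochS mulf_eq0 negb_or in n2.
case/andP: n1 => n1 n3; case/andP: n2 => n2 n4.
rewrite /jacobi_coef addnS qpochS [in RHS]e [qpoch q (N - m.+1).+1]qpochS -e.
by field; rewrite n1 n2 n3 n4.
Qed.

Lemma jacobi_coef_dist : exists2 K : R, 0 <= K & forall N m, (m <= N)%N ->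
  nm (jacobi_coef N m - 1) <= K * p ^+ (N - m).
Proof.
have [d d0 Hd] := qpoch_bounds.
pose K1 := (d^-1) ^+ 2 * (d^-1 * d^-1).
have K10 : 0 <= K1 by rewrite mulr_ge0 ?exprn_ge0 ?mulr_ge0 ?invr_ge0 ?(ltW d0).
have HK1 N m : nm (jacobi_coef N m) <= K1.
  rewrite nmM nmX nmV nmM; apply: ler_pM; rewrite ?exprn_ge0 ?nm_ge0 ?invr_ge0 ?mulr_ge0 ?nm_ge0 //.
    by rewrite lerXn2r ?nnegrE ?nm_ge0 ?invr_ge0 ?(ltW d0) //; case/andP: (Hd N).
  rewrite invfM; apply: ler_pM; rewrite ?invr_ge0 ?nm_ge0 // lef_pV2 ?posrE ?nm_gt0 ?qpoch_neq0 //.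
    by case/andP: (Hd (N + m)%N).
  by case/andP: (Hd (N - m)%N).
pose K2 := K1 * (2 / (1 - p)).
have p1 : 0 < 1 - p by rewrite subr_gt0.
have K20 : 0 <= K2 by rewrite mulr_ge0 // divr_ge0 // ltW.
(* Passing from m to m + 1 changes the coefficient by at most K2 p^(N-m). This K solves K p + K2 p =
   K, so the bound reproduces itself in the induction. *)
pose K := K2 * p / (1 - p).
have K0 : 0 <= K by apply: divr_ge0; [apply: mulr_ge0 => //; exact: ltW|exact: ltW].
exists K => // N; elim=> [|m IH] mN.
  by rewrite jacobi_coef0 subrr nm0 mulr_ge0 // exprn_ge0 // ltW.
have n4 : 1 - q ^+ (N + m).+1 != 0.
  by have := qpoch_neq0 (N + m).+1; rewrite qpochS mulf_eq0 negb_or => /andP[].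
have e : (N - m = (N - m.+1).+1)%N by rewrite -subSn.
have -> : jacobi_coef N m.+1 - 1 = (jacobi_coef N m - 1) +
    jacobi_coef N m * ((q ^+ (N + m).+1 - q ^+ (N - m)) / (1 - q ^+ (N + m).+1)).
  by rewrite jacobi_coefS //; field.
have h : nm (jacobi_coef N m * ((q ^+ (N + m).+1 - q ^+ (N - m)) / (1 - q ^+ (N + m).+1)))
   <= K2 * p ^+ (N - m).
  rewrite nmM /K2 -mulrA; apply: ler_pM; rewrite ?nm_ge0 //.
  rewrite nmM nmV mulrAC.
  have a0 : 0 <= p ^+ (N - m) by rewrite exprn_ge0 // ltW.
  have h1 : nm (q ^+ (N + m).+1 - q ^+ (N - m)) <= 2 * p ^+ (N - m).
    apply: le_trans (nmB _ _) _; rewrite !nmX -/p.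
    have : p ^+ (N + m).+1 <= p ^+ (N - m).
      have -> : ((N + m).+1 = (N - m) + (m + m).+1)%N.
        by rewrite addnS addnA subnK // ltnW.
      by rewrite exprD; apply: ler_piMr => //; apply: exprn_ile1; exact: ltW.
    lra.
  apply: ler_pM; rewrite ?invr_ge0 ?nm_ge0 //.
  rewrite lef_pV2 ?posrE ?nm_gt0 //.
  have := nm_le_dist 1 (q ^+ (N + m).+1); rewrite nm1 nmX -/p => /(le_trans _); apply.
  rewrite lerD2l lerN2 exprS; apply: ler_piMr; first exact: ltW.
  by apply: exprn_ile1; exact: ltW.
apply: le_trans (nmD _ _) _; apply: le_trans (lerD (IH (ltnW mN)) h) _.
rewrite -mulrDl e exprS mulrA ler_wpM2r //; first by rewrite exprn_ge0 // ltW.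
rewrite le_eqVlt; apply/orP; left; apply/eqP; rewrite /K; field.
by rewrite gt_eqF.
Qed.

Lemma jacobi_prod_expand X N : X != 0 -> jacobi_scale N * jacobi_prod q X N =
   \sum_(m < N.+1) jacobi_coef N m * (theta_coef q m * X ^+ m)
   - X * \sum_(m < N) jacobi_coef N m.+1 * (theta_coef q m.+2 * X^-1 ^+ m.+2).
Proof.
move=> X0.
have A1 (m : nat) : (m <= N)%N -> jacobi_coef N m = jacobi_scale N * qbin q (N + N) (N + m).
  move=> mN; have h2 := qpoch_neq0 (N + N).
  have E := @qbin_qpoch _ q (N + N) (N + m).
  rewrite leq_add2l subnDl in E; have {}E := E mN.
  have h3 : qbin q (N + N) (N + m) != 0.
    by move: h2; rewrite -E mulf_eq0 negb_or => /andP[].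
  by rewrite /jacobi_scale /jacobi_coef -E; field; rewrite h3 !qpoch_neq0.
have A2 (m : nat) : (m < N)%N -> jacobi_coef N m.+1 = jacobi_scale N * qbin q (N + N) (N - m.+1).
  move=> mN; have h2 := qpoch_neq0 (N + N).
  have E := @qbin_qpoch _ q (N + N) (N - m.+1).
  have l1 : (N - m.+1 <= N + N)%N by rewrite (leq_trans (leq_subr _ _)) // leq_addr.
  have e : (N + N - (N - m.+1) = N + m.+1)%N by lia.
  have {}E := E l1; rewrite e in E.
  have h3 : qbin q (N + N) (N - m.+1) != 0.
    by move: h2; rewrite -E mulf_eq0 negb_or => /andP[].
  by rewrite /jacobi_scale /jacobi_coef -E; field; rewrite h3 !qpoch_neq0.
rewrite jacobi_prod_finite // mulrBr [jacobi_scale N * (X * _)]mulrCA [jacobi_scale N * _]mulr_sumr [jacobi_scale N * _]mulr_sumr.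
congr (_ - _ * _); apply: eq_bigr => i _.
  by rewrite (A1 i (ltn_ord i)) -!mulrA.
by rewrite (A2 i (ltn_ord i)) -!mulrA.
Qed.

Lemma rescaled_bound (K P a b G Y : R) : 0 <= K * P * (G * Y) -> a <= b ->
  K * (P * a) * (G * Y) <= P * K * (G * (Y * b)).
Proof.
move=> h ab; have -> : K * (P * a) * (G * Y) = K * P * (G * Y) * a by ring.
have -> : P * K * (G * (Y * b)) = K * P * (G * Y) * b by ring.
exact: ler_wpM2l.
Qed.

(* Tannery: the coefficients tend to 1 with the uniform error of
   [jacobi_coef_dist]. *)
Lemma jacobi_prod_cvg X : X != 0 -> (fun N => jacobi_scale N * jacobi_prod q X N) @ \oo --> qtheta q X.
Proof.
move=> X0; have p1 : 0 < 1 - p by rewrite subr_gt0.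
have [K K0 HK] := jacobi_coef_dist.
have c1 : 0 <= nm X / p by rewrite divr_ge0 ?nm_ge0 ?(ltW pp).
have c2 : 0 <= nm X^-1 / p by rewrite divr_ge0 ?nm_ge0 ?(ltW pp).
have [K1 K10 H1] := theta_coef_sum_bound q1 c1.
have [K2 K20 H2] := theta_coef_sum_bound q1 c2.
pose S N := \sum_(m < N.+1) theta_coef q m * X ^+ m - X * \sum_(m < N) theta_coef q m.+2 * X^-1 ^+ m.+2.
have SE N : S N = qtheta_part q X N + theta_coef q N * X ^+ N.
  by rewrite /S /qtheta_part big_ord_recr /= sumrB -mulr_sumr addrAC.
(* The factor p^N makes the total error vanish; p^(-m) is absorbed by taking the theta series at the
   radius |X| / p, where it still converges absolutely. *)
have HX N m : (m <= N)%N -> p ^+ (N - m) = p ^+ N / p ^+ m.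
  by move=> mN; rewrite -{2}(subnK mN) exprD mulfK // expf_neq0 // gt_eqF.
have D N : nm (jacobi_scale N * jacobi_prod q X N - S N) <= p ^+ N * (K * (K1 + nm X * K2)).
  have E (A B A' B' : C) : (A - X * B) - (A' - X * B') = (A - A') + - X * (B - B') by ring.
  rewrite jacobi_prod_expand // /S E -!sumrB.
  apply: le_trans (nmD _ _) _; rewrite mulrDr mulrDr; apply: lerD.
    apply: le_trans (nm_sum _ _ _) _.
    rewrite mulrA; apply: le_trans (ler_wpM2l _ (H1 N.+1)); last first.
      by rewrite mulr_ge0 // exprn_ge0 // ltW.
    rewrite mulr_sumr; apply: ler_sum => i _.
    have iN : (i <= N)%N by rewrite -ltnS.
    rewrite -[X in _ - X]mul1r -mulrBl nmM [nm (theta_coef _ _ * _)]nmM [nm (_ ^+ _)]nmX.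
    have := HK _ _ iN; rewrite HX // => h.
    have g0 : 0 <= nm (theta_coef q i) * nm X ^+ i by rewrite mulr_ge0 ?exprn_ge0 ?nm_ge0.
    apply: le_trans (ler_wpM2r g0 h) _.
    rewrite expr_div_n le_eqVlt; apply/orP; left; apply/eqP.
    by field; rewrite expf_neq0 // gt_eqF.
  have -> : p ^+ N * (K * (nm X * K2)) = nm X * (p ^+ N * K * K2) by ring.
  rewrite nmM nmN; apply: ler_wpM2l; first exact: nm_ge0.
  apply: le_trans (nm_sum _ _ _) _.
  apply: le_trans (ler_wpM2l _ (H2 N.+2)); last first.
    by rewrite mulr_ge0 // exprn_ge0 // ltW.
  (* The sum in 1/X starts at index 2, so the first two terms of the bound are discarded. *)
  rewrite mulr_sumr 2!big_ord_recl; apply: ler_wpDl.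
    by rewrite !mulr_ge0 ?exprn_ge0 ?nm_ge0 ?invr_ge0 ?(ltW pp).
  apply: ler_wpDl.
    by rewrite !mulr_ge0 ?exprn_ge0 ?nm_ge0 ?invr_ge0 ?mulr_ge0 ?(ltW pp).
  apply: ler_sum => i _; rewrite /bump /=.
  rewrite -[X in _ - X]mul1r -mulrBl nmM [nm (theta_coef _ _ * _)]nmM [nm (_ ^+ _)]nmX.
  have := HK _ _ (ltn_ord i); rewrite HX // => h.
  have g0 : 0 <= nm (theta_coef q i.+2) * nm X^-1 ^+ i.+2 by rewrite mulr_ge0 ?exprn_ge0 ?nm_ge0.
  apply: le_trans (ler_wpM2r g0 h) _.
  have h2 : (p ^+ i.+1)^-1 <= (p ^+ i.+2)^-1.
    rewrite lef_pV2 ?posrE ?exprn_gt0 // [leLHS]exprS ler_piMl ?exprn_ge0 ?(ltW pp) //.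
    exact: ltW.
  rewrite expr_div_n.
  have h3 := mulr_ge0 (mulr_ge0 K0 (exprn_ge0 N (ltW pp))) g0.
  exact: rescaled_bound h3 h2.
have Sc : S @ \oo --> qtheta q X.
  have HA : (fun N => theta_coef q N * X ^+ N) @ \oo --> (0 : C).
    have P := @half_theta_cvg R q X q1.
    have P1 : (fun N => \sum_(m < N.+1) theta_coef q m * X ^+ m) @ \oo --> half_theta q X.
      by rewrite (cvg_shiftS (fun N => \sum_(m < N) _)).
    have -> : (fun N => theta_coef q N * X ^+ N) =
       (fun N => \sum_(m < N.+1) theta_coef q m * X ^+ m - \sum_(m < N) theta_coef q m * X ^+ m).
      by apply/funext => N; rewrite big_ord_recr /= addrAC subrr add0r.
    have E := cvgC_sub P1 P; rewrite subrr in E; exact: E.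
  have -> : S = (fun N => qtheta_part q X N + theta_coef q N * X ^+ N) by apply/funext => N.
  have E := cvgC_add (qtheta_cvg q1 X0) HA; rewrite addr0 in E; exact: E.
apply/cvg_nmP => e e0.
set L := K * (K1 + nm X * K2).
have [M HM] := expr_small (L / e) p01.
have /cvg_nmP/(_ (e / 2)) := Sc; rewrite divr_gt0 // => /(_ isT) HS.
near=> N.
have h1 : nm (S N - qtheta q X) <= e / 2 by near: N.
have h2 : p ^+ N * (L / e) <= 1 / 2 by apply: HM; near: N; exact: nbhs_infty_ge.
have -> : jacobi_scale N * jacobi_prod q X N - qtheta q X = (jacobi_scale N * jacobi_prod q X N - S N) + (S N - qtheta q X) by ring.
apply: le_trans (nmD _ _) _; have := D N; rewrite -/L.
have : p ^+ N * L <= e / 2.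
  by move: h2; rewrite mulrA ler_pdivrMr // => /le_trans; apply; lra.
move: h1; lra.
Unshelve. all: by end_near. Qed.

End Triple.

(** * Theta functions *)

Section ThetaProps.
Variable R : realType.
Local Notation C := (Cx R).

Lemma cvg_nm_lower (u : nat -> C) (l : C) (b : R) :
  u @ \oo --> l -> (\forall N \near \oo, b <= nm (u N)) -> b <= nm l.
Proof.
move=> /cvg_nmP ul H; apply/ler_addgt0Pr => e e0.
have [N [h1 h2]] := filter_ex (filterI (ul _ e0) H).
have := nm_le_dist (u N) l; move: h1 h2; lra.
Qed.

Lemma theta_coef0 (q : C) : theta_coef q 0 = 1. Proof. exact: theta_coefF0. Qed.

Lemma theta_coefS (q : C) m : theta_coef q m.+1 = - theta_coef q m * q ^+ m. Proof. exact: theta_coefFS. Qed.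

Lemma qtheta_inv (q X : C) : X != 0 -> qtheta q X^-1 = - X^-1 * qtheta q X.
Proof. by move=> X0; rewrite /qtheta invrK; move: (half_theta q X) (half_theta q X^-1) => u v; field. Qed.

Lemma qtheta1 (q : C) : qtheta q 1 = 0.
Proof. by rewrite /qtheta invr1; ring. Qed.

Section Q.
Variable q : C.
Hypotheses (q0 : q != 0) (q1 : nm q < 1).

(** On the annulus 1/B <= |X| <= B every factor of the triple product except 1 - X stays away from
    0, by [prod_nm_lower] for X and for 1/X. This locates the zeros and shows that the one at X = 1
    is simple. *)
Lemma qtheta_lower (B : R) : 0 <= B -> nm q * B < 1 ->
  exists2 d : R, 0 < d & forall X : C, X != 0 -> nm X <= B -> nm X^-1 <= B ->
    d * nm (1 - X) <= nm (qtheta q X).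
Proof.
move=> B0 pB; have [d d0 Hd] := prod_nm_lower q0 q1 B0 pB.
have [c c0 Hc] := jacobi_scale_lower q0 q1.
exists (c * (d * d)); first by rewrite !mulr_gt0.
move=> X X0 XB YB; apply: (cvg_nm_lower (jacobi_prod_cvg q0 q1 X0)).
near=> N.
have [M ->] : exists M, N = M.+1.
  by exists N.-1; rewrite prednK //; near: N; exact: nbhs_infty_gt.
have h1 := Hd M _ XB; have h2 := Hd M.+1 _ YB.
rewrite nmM -mulrA; apply: ler_pM; [exact: ltW| |exact: Hc|].
  by rewrite !mulr_ge0 ?nm_ge0 ?(ltW d0).
rewrite /jacobi_prod big_split /= big_ord_recl /= expr0 mul1r -[in leRHS]mulrA nmM mulrC.
apply: ler_wpM2l; first exact: nm_ge0.
by rewrite nmM; apply: ler_pM => //; exact: ltW.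
Unshelve. all: by end_near. Qed.

Lemma half_theta_q (X : C) : X * half_theta q (q * X) = 1 - half_theta q X.
Proof.
have H1 := @half_theta_cvg R q (q * X) q1; have H2 := @half_theta_cvg R q X q1.
have H3 : (fun N => \sum_(m < N.+1) theta_coef q m * X ^+ m) @ \oo --> half_theta q X.
  by rewrite (cvg_shiftS (fun N => \sum_(m < N) _)).
have E : (fun N => 1 - \sum_(m < N.+1) theta_coef q m * X ^+ m) @ \oo --> (1 - half_theta q X : C).
  exact: (cvgC_sub (@cvgC_cst R nat \oo _ (1 : C)) H3).
have E2 : (fun N => X * \sum_(m < N) theta_coef q m * (q * X) ^+ m) @ \oo --> (X * half_theta q (q * X) : C).
  exact: (cvgC_mul (@cvgC_cst R nat \oo _ X) H1).
have H : (fun N => X * \sum_(m < N) theta_coef q m * (q * X) ^+ m) =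
   (fun N => 1 - \sum_(m < N.+1) theta_coef q m * X ^+ m).
  apply/funext => N; rewrite big_ord_recl /= theta_coef0 expr0 mulr1 opprD addrA subrr add0r.
  rewrite mulr_sumr -sumrN; apply: eq_bigr => i _.
  by rewrite /bump /= theta_coefS exprMn exprS; ring.
by rewrite H in E2; exact: (cvgC_unique (F := \oo) E2 E).
Qed.

Lemma qtheta_q (X : C) : X != 0 -> qtheta q (q * X) = - X^-1 * qtheta q X.
Proof.
move=> X0; have h1 := half_theta_q X; have h2 := half_theta_q (q * X)^-1.
have e : q * (q * X)^-1 = X^-1 by field; rewrite q0 X0.
rewrite e in h2; rewrite /qtheta.
have -> : half_theta q (q * X) = X^-1 * (1 - half_theta q X) by rewrite -h1 mulKf.
have -> : half_theta q (q * X)^-1 = 1 - (q * X)^-1 * half_theta q X^-1 by rewrite h2; ring.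
by move: (half_theta q X) (half_theta q X^-1) => u v; field; rewrite q0 X0.
Qed.

(** The annulus is a fundamental domain for X -> q X. The radius B = 1/|X| is admissible in
    [qtheta_lower] precisely because |q| < |X|. *)
Lemma qtheta_root_annulus (X : C) : nm q < nm X -> nm X <= 1 -> qtheta q X = 0 -> X = 1.
Proof.
move=> qX X1 tX.
have nX : 0 < nm X by apply: le_lt_trans qX; exact: nm_ge0.
have X0 : X != 0 by rewrite -nm_gt0.
have B1 : 1 <= nm X^-1 by rewrite nmV invf_ge1.
have [|d d0 Hd] := @qtheta_lower (nm X^-1) (nm_ge0 _); first by rewrite nmV ltr_pdivrMr // mul1r.
have := Hd X X0 (le_trans X1 B1) (lexx _); rewrite tX nm0 pmulr_rle0 // => h.
have : nm (1 - X) == 0 by rewrite eq_le h nm_ge0.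
by rewrite nm_eq0 subr_eq0 => /eqP.
Qed.

Lemma qtheta_neq0_unit (X : C) : nm X = 1 -> X != 1 -> qtheta q X != 0.
Proof.
move=> X1 Xn1; apply/eqP => H; move/eqP: Xn1; apply; apply: qtheta_root_annulus => //.
  by rewrite X1.
by rewrite X1.
Qed.

End Q.

Lemma prod_root_unity (F : fieldType) n (w Y : F) : n.-primitive_root w ->
  \prod_(j < n) (1 - w ^+ j * Y) = 1 - Y ^+ n.
Proof.
move=> pw; have n0 := prim_order_gt0 pw.
have [->|Y0] := eqVneq Y 0.
  rewrite expr0n (gtn_eqF n0) subr0 big1 // => i _.
  by rewrite mulr0 subr0.
have := congr1 (fun P : {poly F} => P.[Y^-1]) (factor_Xn_sub_1 pw).
rewrite horner_prod big_mkord !hornerE => H.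
have -> : \prod_(j < n) (1 - w ^+ j * Y) = \prod_(j < n) (Y * (('X - (w ^+ j)%:P).[Y^-1])).
  by apply: eq_bigr => i _; rewrite !hornerE mulrBr divff // mulrC.
rewrite big_split /= H prodr_const card_ord mulrBr mulr1 -exprMn divff // expr1n.
by [].
Qed.

End ThetaProps.

Section AddTheta.
Variable R : realType.
Local Notation C := (Cx R).

Lemma ImcD (x y : C) : Imc (x + y) = Imc x + Imc y.
Proof. by case: x y => [a b] [c d]. Qed.

Lemma ImcN (x : C) : Imc (- x) = - Imc x.
Proof. by case: x. Qed.

Lemma Imc_realM (r : R) (x : C) : Imc (r%:C%C * x) = r * Imc x.
Proof. by case: x => [a b] /=; rewrite mul0r addr0. Qed.

Lemma Imc_intM (k : int) (x : C) : Imc (k%:~R * x) = k%:~R * Imc x.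
Proof.
have -> : (k%:~R : C) = (k%:~R : R)%:C%C by rewrite rmorph_int.
exact: Imc_realM.
Qed.

Lemma Imc_natM (k : nat) (x : C) : Imc (k%:R * x) = k%:R * Imc x.
Proof. exact: (Imc_intM k x). Qed.

Lemma Imc_int (k : int) : Imc (k%:~R : C) = 0.
Proof. by have := Imc_intM k 1; rewrite mulr1 => ->; rewrite mulr0. Qed.

Variable eta : C.
Hypothesis eta0 : 0 < Imc eta.
Let q : C := ee eta.

Lemma nm_ee_lt1 : nm q < 1.
Proof.
rewrite nm_ee -[ltRHS]expR0 ltr_expR oppr_lt0 !mulr_gt0 //; exact: pi_gt0.
Qed.
Let q1 := nm_ee_lt1.
Let q0 : q != 0 := ee_neq0 eta.

Lemma ee_tri (m : int) (c : nat) : m * (m - 1) = (2 * c)%N ->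
  ee ((m * (m - 1))%:~R / 2 * eta) = q ^+ c.
Proof.
move=> ->; rewrite -ee_natM; congr (ee (_ * _)).
by rewrite -pmulrn natrM mulrAC divff ?mul1r // pnatr_eq0.
Qed.

Lemma thetaE (z : C) : theta eta z = qtheta q (ee z).
Proof.
have H := qtheta_cvg q1 (ee_neq0 z).
rewrite -(cvgC_lim H) /theta; congr (lim (_ @ \oo)); apply/funext => N.
rewrite /qtheta_part; apply: eq_bigr => m _; congr (_ + _).
  rewrite /theta_term eeD ee_intM (@ee_tri _ 'C(m, 2)).
    by rewrite /theta_coef -!exprnP; ring.
  by have := bin2D m; case: (nat_of_ord m) => // k; lia.
rewrite /theta_term eeD ee_intM (@ee_tri _ 'C(m.+2, 2)); last by have := bin2D m.+2; lia.
rewrite /theta_coef -!exprnN -!exprVn invrN1 [X in _ = - (_ * (X * _ * _))]exprS [_^-1 ^+ m.+2]exprS.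
by field; rewrite ee_neq0.
Qed.

Lemma Lip_theta (z : C) : Lip (theta eta) z.
Proof.
apply: (@eq_Lip _ (fun z => qtheta q (ee z))); first by move=> y; rewrite thetaE.
by apply: (Lip_comp (f := qtheta q)); [exact: Lip_ee|exact: Lip_qtheta q1 (ee_neq0 z)].
Qed.

Lemma theta_add1 (z : C) : theta eta (z + 1) = theta eta z.
Proof. by rewrite !thetaE eeD ee1 mulr1. Qed.

Lemma theta_addeta (z : C) : theta eta (z + eta) = - ee (- z) * theta eta z.
Proof. by rewrite !thetaE eeD mulrC qtheta_q ?ee_neq0 // eeN. Qed.

Lemma theta_opp (z : C) : theta eta (- z) = - ee (- z) * theta eta z.
Proof. by rewrite !thetaE eeN qtheta_inv ?ee_neq0. Qed.

Lemma theta0 : theta eta 0 = 0.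
Proof. by rewrite thetaE ee0 qtheta1. Qed.

Lemma theta_add_nat_eta (z : C) (k : nat) :
  theta eta (z + k%:R * eta) = 0 <-> theta eta z = 0.
Proof.
elim: k => [|k IH]; first by rewrite mul0r addr0.
rewrite -natr1 mulrDl mul1r addrA theta_addeta -IH; split=> [/eqP|->]; last by rewrite mulr0.
by rewrite mulf_eq0 oppr_eq0 (negbTE (ee_neq0 _)) => /eqP.
Qed.

Lemma theta_add_int_eta (z : C) (k : int) :
  theta eta (z + k%:~R * eta) = 0 <-> theta eta z = 0.
Proof.
case: k => k; first by rewrite -pmulrn theta_add_nat_eta.
rewrite NegzE -(theta_add_nat_eta _ k.+1) mulrNz mulNr pmulrn subrK.
by [].
Qed.

Lemma theta_root (z : C) : theta eta z = 0 -> exists a b : int, z = a%:~R + b%:~R * eta.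
Proof.
(* Subtracting b eta moves z into the strip 0 <= Im < Im eta, which [ee] maps into the fundamental
   annulus. *)
pose b := Num.floor (Imc z / Imc eta).
have b1 : b%:~R <= Imc z / Imc eta by exact: floor_le.
have b2 : Imc z / Imc eta < b%:~R + 1 by have := lt_succ_floor (Imc z / Imc eta); rewrite intrD.
rewrite ler_pdivlMr // in b1; rewrite ltr_pdivrMr // in b2.
move/(theta_add_int_eta z (- b)).2; rewrite thetaE => H.
have I : Imc (z + (- b)%:~R * eta) = Imc z - b%:~R * Imc eta.
  by rewrite ImcD Imc_intM mulrNz mulNr.
have pi0 := pi_gt0 R.
have : ee (z + (- b)%:~R * eta) = 1.
  apply: (qtheta_root_annulus q0 q1) H; rewrite [nm (ee (z + _))]nm_ee I.
    by rewrite nm_ee ltr_expR ltrN2 ltr_pM2l ?mulr_gt0 //; lra.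
  by rewrite -[leRHS]expR0 ler_expR oppr_le0; apply: mulr_ge0; [rewrite mulr_ge0 ?(ltW pi0)|lra].
move/ee_eq1 => [a Ha]; exists a, b.
by rewrite -Ha mulrNz mulNr subrK.
Qed.

Lemma theta_bounds : exists c L r : R, [/\ 0 < c, 0 < L, 0 < r & forall h : C, nm h <= r ->
  c * nm h <= nm (theta eta h) <= L * nm h].
Proof.
have [c1 [L1 [r1 [c10 L10 r10 H1]]]] := ee_lin_bounds R.
have [L2 [r2 [L20 r20 H2]]] := Lip_theta 0.
have q2 : 0 < nm q by rewrite nm_gt0.
(* Chosen so that |q| B = (1 + |q|)/2 < 1 while B > 1: the annulus of [qtheta_lower] then contains a
   neighbourhood of X = 1. *)
pose B : R := 1 + (1 - nm q) / (2 * nm q).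
have B1 : 1 < B by rewrite ltrDl divr_gt0 ?mulr_gt0 // subr_gt0.
have B0 : 0 <= B by apply: ltW; apply: lt_trans B1.
have [|d d0 Hd] := @qtheta_lower _ q q0 q1 B B0.
  rewrite /B; have -> : nm q * (1 + (1 - nm q) / (2 * nm q)) = (1 + nm q) / 2.
    by field; rewrite gt_eqF.
  by have := q1; rewrite -/(nm q); lra.
have [r3 r30 Hr3] : exists2 r3 : R, 0 < r3 & forall h : C, nm h <= r3 -> nm (ee h) <= B.
  exists (Num.min r1 ((B - 1) / L1)).
    by rewrite lt_min r10 divr_gt0 // subr_gt0.
  move=> h; rewrite le_min => /andP[h1 h2]; have /andP[_ h3] := H1 _ h1.
  rewrite ler_pdivlMr // mulrC in h2.
  by have := nm_le_dist (ee h) 1; rewrite nm1; lra.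
exists (d * c1), (L2 + 1), (Num.min r1 (Num.min r2 r3)); split.
- by rewrite mulr_gt0.
- by rewrite ltr_wpDl.
- by rewrite !lt_min r10 r20 r30.
move=> h; rewrite !le_min => /and3P[h1 h2 h3].
have hN : nm (- h) <= r3 by rewrite nmN.
apply/andP; split.
  have := Hd _ (ee_neq0 h) (Hr3 _ h3); rewrite -eeN thetaE => /(_ (Hr3 _ hN)).
  apply: le_trans; rewrite -mulrA ler_pM2l // nmBC; by case/andP: (H1 _ h1).
have := H2 h; rewrite theta0 !subr0 => /(_ h2) /le_trans; apply.
by rewrite ler_wpM2r ?nm_ge0 // lerDl.
Qed.

End AddTheta.

(** * Product formulas over division points and over multiples of eta *)

Section Products.
Variable R : realType.
Local Notation C := (Cx R).

(** Cross-multiplication with the values at the reference point i0 eliminates the scalar sequences,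
    so the limit of their ratio never has to be computed. *)
Lemma lim_proportional (I : Type) (P : I -> nat -> C) (a c : nat -> C) (f g : I -> C) (i0 : I) :
  (forall i, (fun N => a N * P i N) @ \oo --> f i) ->
  (forall i, (fun N => c N * P i N) @ \oo --> g i) ->
  f i0 != 0 -> g i0 != 0 -> exists2 k : C, k != 0 & forall i, f i = k * g i.
Proof.
move=> Hf Hg f0 g0; exists (f i0 / g i0); first by rewrite mulf_neq0 // invr_eq0.
move=> i;
have E1 : (fun N => a N * P i N * (c N * P i0 N)) @ \oo --> (f i * g i0 : C).
  exact: (cvgC_mul (Hf i) (Hg i0)).
have E2 : (fun N => c N * P i N * (a N * P i0 N)) @ \oo --> (g i * f i0 : C).
  exact: (cvgC_mul (Hg i) (Hf i0)).
have H : (fun N => a N * P i N * (c N * P i0 N)) = (fun N => c N * P i N * (a N * P i0 N)).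
  by apply/funext => N; ring.
rewrite H in E1; have := cvgC_unique (F := \oo) E1 E2 => E.
by rewrite mulrAC [f i0 * _]mulrC -E mulfK.
Qed.

Lemma cvg_subseq (u : nat -> C) (f : nat -> nat) (l : C) :
  (forall N, (N <= f N)%N) -> u @ \oo --> l -> (fun N => u (f N)) @ \oo --> l.
Proof.
move=> Hf /cvg_nmP H; apply/cvg_nmP => e e0; have [M _ HM] := H e e0.
by exists M => // N MN /=; apply: HM; exact: leq_trans MN (Hf N).
Qed.

Lemma prim_ee (n : nat) : (0 < n)%N -> n.-primitive_root (ee (n%:R^-1 : C)).
Proof.
move=> n0; have nn : (n%:R : C) != 0 by rewrite pnatr_eq0 -lt0n.
apply/andP; split=> //; apply/forallP => i; apply/eqP; rewrite unity_rootE -ee_natM.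
apply/eqP/eqP => [/ee_eq1[k Hk]|->]; last by rewrite divff // ee1.
have E : i.+1%:Z = k * n%:Z.
  apply: (@intr_inj C); rewrite rmorphM /= -Hk -!pmulrn.
  by rewrite mulfVK.
have := ltn_ord i; move: E; case: k Hk => [[|[|k]]|k] _; lia.
Qed.

Lemma prim_rootV (F : fieldType) n (w : F) : n.-primitive_root w -> n.-primitive_root w^-1.
Proof.
move=> pw; have n0 := prim_order_gt0 pw.
case/andP: pw => _ /forallP H; apply/andP; split=> //; apply/forallP => i.
by rewrite unity_rootE exprVn invr_eq1 -unity_rootE; exact: H.
Qed.

Lemma jacobi_prod_root_unity (F : fieldType) (q X w : F) n N : n.-primitive_root w ->
  \prod_(j < n) jacobi_prod q (w ^+ j * X) N = jacobi_prod (q ^+ n) (X ^+ n) N.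
Proof.
move=> pw; rewrite /jacobi_prod exchange_big /=; apply: eq_bigr => l _.
rewrite big_split /=; congr (_ * _).
  under eq_bigr do rewrite mulrCA.
  by rewrite prod_root_unity // exprMn -!exprM mulnC.
under eq_bigr do rewrite invfM mulrCA -exprVn.
by rewrite prod_root_unity ?prim_rootV // exprMn exprVn -!exprM mulnC.
Qed.

(** The factors are grouped by the residue of their exponent modulo n; in the factors with 1/X the
    residues occur in reverse order. *)
Lemma jacobi_prod_split (F : fieldType) (q X : F) n N : q != 0 -> X != 0 ->
  \prod_(b < n) jacobi_prod (q ^+ n) (q ^+ b * X) N = jacobi_prod q X (n * N).
Proof.
move=> q0 X0; elim: N => [|N IH].
  by rewrite muln0 /jacobi_prod big_ord0 big1 // => i _; rewrite big_ord0.
have -> : (n * N.+1 = n * N + n)%N by rewrite mulnSr.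
have JS (p Y : F) : jacobi_prod p Y N.+1 = jacobi_prod p Y N * ((1 - p ^+ N * Y) * (1 - p ^+ N.+1 / Y)).
  by rewrite /jacobi_prod big_ord_recr.
under eq_bigr do rewrite JS.
rewrite big_split /= IH [in RHS]/jacobi_prod big_split_ord /=; congr (_ * _).
rewrite !big_split /=; congr (_ * _).
  by apply: eq_bigr => i _; rewrite mulrA -exprM -exprD.
rewrite (reindex_inj rev_ord_inj) /=; apply: eq_bigr => i _.
congr (1 - _); rewrite invfM mulrA; congr (_ / _).
have e : (n * N.+1 = (n * N + i).+1 + (n - i.+1))%N by have := ltn_ord i; nia.
by rewrite -exprM e exprD mulfK // expf_neq0.
Qed.

Lemma ee_half : ee (1 / 2 : C) = -1.
Proof.
have : ee (1 / 2 : C) ^+ 2 = 1 by rewrite -ee_natM mulrCA divff ?mulr1 ?ee1 // pnatr_eq0.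
move/eqP; rewrite sqrf_eq1 => /orP[/eqP/ee_eq1[k Hk]|/eqP //].
have : 1 = (k * 2)%:~R :> C by rewrite rmorphM /= -Hk mulfVK // pnatr_eq0.
by move/eqP; rewrite -[1]/(1%:~R) eqr_int => /eqP; lia.
Qed.

Lemma neg1_neq1 : (-1 : C) != 1.
Proof. by rewrite -subr_eq0 -opprD oppr_eq0 (_ : 1 + 1 = 2%:R) // pnatr_eq0. Qed.

Lemma nm_ee_real (r : R) : nm (ee (r%:C%C : C)) = 1.
Proof. by rewrite nm_ee /= mulr0 oppr0 expR0. Qed.

Variable eta : C.
Hypothesis eta0 : 0 < Imc eta.
Variable n : nat.
Hypothesis n0 : (0 < n)%N.

Let nn : (n%:R : C) != 0. Proof. by rewrite pnatr_eq0 -lt0n. Qed.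

Lemma Imc_neta : 0 < Imc (n%:R * eta).
Proof. by rewrite Imc_natM mulr_gt0 // ltr0n. Qed.

Let q := ee eta.
Let q0 : q != 0 := ee_neq0 eta.
Let q1 : nm q < 1 := nm_ee_lt1 eta0.
Let qn : ee (n%:R * eta) = q ^+ n. Proof. exact: ee_natM. Qed.
Let qn0 : q ^+ n != 0. Proof. by rewrite expf_neq0. Qed.
Let qn1 : nm (q ^+ n) < 1. Proof. by rewrite -qn; exact: nm_ee_lt1 Imc_neta. Qed.

Lemma theta_prod_root : exists2 k : C, k != 0 & forall z,
  \prod_(m < n) theta eta (z + m%:R / n%:R) = k * theta (n%:R * eta) (n%:R * z).
Proof.
pose w := ee (n%:R^-1 : C); have pw : n.-primitive_root w := prim_ee n0.
have W m z : ee (z + m%:R / n%:R) = w ^+ m * ee z :> C.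
  by rewrite eeD ee_natM mulrC.
(* Reference point z = 1/(2n): every X occurring there satisfies X^n = -1, so it lies on the unit
   circle and differs from 1. *)
apply: (@lim_proportional C (fun z N => jacobi_prod (q ^+ n) (ee z ^+ n) N)
  (fun N => jacobi_scale q N ^+ n) (fun N => jacobi_scale (q ^+ n) N) _ _ (1 / 2 / n%:R)).
- move=> z.
  have -> : (fun N => jacobi_scale q N ^+ n * jacobi_prod (q ^+ n) (ee z ^+ n) N) =
      (fun N => \prod_(m < n) (jacobi_scale q N * jacobi_prod q (w ^+ m * ee z) N)).
    apply/funext => N; rewrite -(@jacobi_prod_root_unity _ q (ee z) w n N pw).
    by rewrite big_split /= prodr_const card_ord.
  apply: cvgC_prod => i _; rewrite thetaE // W.
  by apply: jacobi_prod_cvg => //; rewrite mulf_neq0 ?expf_neq0 ?ee_neq0.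
- move=> z; rewrite thetaE ?Imc_neta // qn ee_natM.
  by apply: jacobi_prod_cvg => //; rewrite expf_neq0 ?ee_neq0.
- have E m : ee (1 / 2 / n%:R + m%:R / n%:R) ^+ n = -1 :> C.
    rewrite -ee_natM mulrDr ![n%:R * _]mulrC !mulfVK // eeD ee_half.
    by rewrite -[m%:R]/(m%:Z%:~R) ee_int mulr1.
  apply/prodf_neq0 => m _; rewrite thetaE //; apply: qtheta_neq0_unit => //.
    have -> : (1 / 2 / n%:R + m%:R / n%:R : C) = ((1 / 2 / n%:R + m%:R / n%:R : R)%:C)%C.
      by rewrite !(rmorphD, rmorphM, fmorphV, rmorph_nat, rmorph1).
    exact: nm_ee_real.
  apply/eqP => H; have := E m; rewrite H expr1n.
  by move/eqP; rewrite eq_sym (negbTE neg1_neq1).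
- rewrite thetaE ?Imc_neta // qn [n%:R * _]mulrC mulfVK // ee_half.
  apply: qtheta_neq0_unit => //; first by rewrite nmN nm1.
  exact: neg1_neq1.
Qed.

Lemma theta_prod_eta : exists2 k : C, k != 0 & forall z,
  \prod_(b < n) theta (n%:R * eta) (z + b%:R * eta) = k * theta eta z.
Proof.
have W b z : ee (z + b%:R * eta) = q ^+ b * ee z :> C by rewrite eeD ee_natM mulrC.
apply: (@lim_proportional C (fun z N => jacobi_prod q (ee z) (n * N))
  (fun N => jacobi_scale (q ^+ n) N ^+ n) (fun N => jacobi_scale q (n * N)) _ _ (1 / 2)).
- move=> z.
  have -> : (fun N => jacobi_scale (q ^+ n) N ^+ n * jacobi_prod q (ee z) (n * N)) =
      (fun N => \prod_(b < n) (jacobi_scale (q ^+ n) N * jacobi_prod (q ^+ n) (q ^+ b * ee z) N)).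
    apply/funext => N; rewrite -(@jacobi_prod_split _ q (ee z) n N) ?ee_neq0 //.
    by rewrite big_split /= prodr_const card_ord.
  apply: cvgC_prod => i _; rewrite thetaE ?Imc_neta // W qn.
  by apply: jacobi_prod_cvg => //; rewrite mulf_neq0 ?expf_neq0 ?ee_neq0.
- move=> z; rewrite thetaE //.
  apply: (@cvg_subseq (fun N => jacobi_scale q N * jacobi_prod q (ee z) N) (fun N => n * N)%N).
    by move=> N; rewrite leq_pmull.
  exact: (jacobi_prod_cvg q0 q1 (ee_neq0 z)).
(* At z = 1/2 no translate by b eta meets Z + Z n eta: the imaginary part forces b = 0, and 1/2 is
   not an integer. *)
- apply/prodf_neq0 => b _; apply/eqP => /(theta_root Imc_neta)[x [y Hxy]].
  have I : b%:R * Imc eta = y%:~R * (n%:R * Imc eta).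
    rewrite -!Imc_natM -Imc_intM -[RHS]add0r -(Imc_int R x) -ImcD -Hxy ImcD.
    have -> : Imc (1 / 2 : C) = 0; last by rewrite add0r.
    have -> : (1 / 2 : C) = ((1 / 2 : R)%:C)%C by rewrite rmorphM fmorphV rmorph1 rmorph_nat.
    by [].
  have bn : b%:Z = y * n%:Z.
    apply: (@intr_inj R); rewrite rmorphM /= -!pmulrn.
    by apply: (mulIf (lt0r_neq0 eta0)); rewrite I mulrA.
  have y0 : y = 0 by have := ltn_ord b; move: bn; case: (y) => [[|m]|m]; nia.
  have b0 : (b : nat) = 0%N by move: bn; rewrite y0 mul0r => -[].
  move: Hxy; rewrite y0 b0 !mul0r !addr0 => H.
  have : 1 = (x * 2)%:~R :> C by rewrite rmorphM /= -H mulfVK // pnatr_eq0.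
  by move/eqP; rewrite -[1]/(1%:~R) eqr_int => /eqP; lia.
- rewrite thetaE // ee_half; apply: qtheta_neq0_unit => //; first by rewrite nmN nm1.
  exact: neg1_neq1.
Qed.

End Products.

(** * The three-term identity *)

Section Plucker.
Variable R : realType.
Local Notation C := (Cx R).

Definition tri (j : int) : nat := match j with Posz m => 'C(m, 2) | Negz m => 'C(m.+2, 2) end.

Lemma triE (j : int) : (2 * tri j)%:Z = j * (j - 1).
Proof.
by case: j => m; rewrite /tri; [have := bin2D m|have := bin2D m.+2]; rewrite ?NegzE; lia.
Qed.

Definition theta_mono (q X : C) (j : int) : C := (-1) ^ j * q ^+ tri j * X ^ j.

Definition box (N : nat) : seq int := [seq Posz m | m <- iota 0 N] ++ [seq Negz m | m <- iota 0 N].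

Lemma mem_box N (j : int) : (j \in box N) = (- (N%:Z) <= j < N%:Z).
Proof.
rewrite mem_cat; case: j => m.
  rewrite mem_map; last by move=> ? ? [].
  have -> : (Posz m \in [seq Negz m0 | m0 <- iota 0 N]) = false.
    by apply/mapP => -[].
  rewrite mem_iota orbF; apply/idP/idP; lia.
have -> : (Negz m \in [seq Posz m0 | m0 <- iota 0 N]) = false.
  by apply/mapP => -[].
rewrite mem_map; last by move=> ? ? [].
rewrite mem_iota NegzE; apply/idP/idP; lia.
Qed.

Lemma uniq_box N : uniq (box N).
Proof.
rewrite cat_uniq !map_inj_uniq ?iota_uniq ?andbT /=; try by move=> ? ? [].
by apply/hasPn => _ /mapP[m _ ->]; apply/mapP => -[].
Qed.

Lemma sum_box (V : nmodType) (f : int -> V) N :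
  \sum_(j <- box N) f j = \sum_(m < N) (f (Posz m) + f (Negz m)).
Proof.
rewrite /box big_cat !big_map.
have -> : iota 0 N = index_iota 0 N by rewrite /index_iota subn0.
by rewrite !big_mkord big_split.
Qed.

Lemma sum_box_theta_mono (q X : C) N : X != 0 -> \sum_(j <- box N) theta_mono q X j = qtheta_part q X N.
Proof.
move=> X0; rewrite sum_box; apply: eq_bigr => m _; congr (_ + _).
rewrite /theta_mono /tri NegzE -!exprnN -!exprVn invrN1 /theta_coef.
rewrite [(-1) ^+ m.+2]exprS [X^-1 ^+ m.+2]exprS.
by field; rewrite X0.
Qed.

Lemma sum_uniq_diff (V : zmodType) (T : eqType) (s1 s2 : seq T) (f : T -> V) :
  uniq s1 -> uniq s2 -> {subset s1 <= s2} ->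
  \sum_(x <- s2) f x - \sum_(x <- s1) f x = \sum_(x <- s2 | x \notin s1) f x.
Proof.
move=> u1 u2 s12; rewrite (bigID (mem s1)) /= -big_filter.
have P : perm_eq [seq x <- s2 | x \in s1] s1.
  apply: uniq_perm; rewrite ?filter_uniq // => x; rewrite mem_filter.
  by case: (boolP (x \in s1)) => //= /s12.
by rewrite (perm_big _ P) addrAC subrr add0r.
Qed.

Lemma abs_sum_box (q X : C) : nm q < 1 -> X != 0 ->
  exists2 K : R, 0 <= K & forall N, \sum_(j <- box N) nm (theta_mono q X j) <= K.
Proof.
move=> q1 X0.
have [K K0 HK] := theta_coef_sum_bound q1 (nm_ge0 X).
have [K' K0' HK'] := theta_coef_sum_bound q1 (nm_ge0 X^-1).
exists (K + nm X * K') => [|N]; first by rewrite addr_ge0 ?mulr_ge0 ?nm_ge0.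
rewrite sum_box big_split /=; apply: lerD.
  apply: le_trans (HK N); apply: ler_sum => m _.
  by rewrite /theta_mono nmM nmX.
apply: le_trans (ler_wpM2l (nm_ge0 _) (HK' N.+2)).
rewrite mulr_sumr 2!big_ord_recl; apply: ler_wpDl.
  by rewrite mulr_ge0 ?nm_ge0 // mulr_ge0 ?exprn_ge0 ?nm_ge0.
apply: ler_wpDl.
  by rewrite mulr_ge0 ?nm_ge0 // mulr_ge0 ?exprn_ge0 ?nm_ge0.
apply: ler_sum => m _; rewrite /bump /=.
rewrite -nmX -!nmM le_eqVlt; apply/orP; left; apply/eqP.
rewrite -(nmN (X * _)); congr nm.
rewrite /theta_mono /tri NegzE -!exprnN -!exprVn invrN1 /theta_coef.
rewrite [(-1) ^+ m.+2]exprS [X^-1 ^+ m.+2]exprS.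
by field; rewrite X0.
Qed.

Lemma cvg_bounded_nondec (u : nat -> R) (K : R) :
  (forall N M, (N <= M)%N -> u N <= u M) -> (forall N, u N <= K) ->
  forall e, 0 < e -> exists M, forall N N', (M <= N)%N -> (N <= N')%N -> u N' - u N <= e.
Proof.
move=> um uK e e0.
have : cvgn u.
  by apply: nondecreasing_is_cvgn => //; exists K => _ [N _ <-].
move=> /cvgrPdist_le/(_ (e / 2)); rewrite divr_gt0 // => /(_ isT)[M _ HM].
exists M => N N' MN NN'.
have := HM N MN; have := HM N' (leq_trans MN NN'); rewrite /= !ler_norml; lra.
Qed.

(* The lattice of pairs (j1, j2) splits, by the parity of j1 + j2, into the
   images of [pair_even] and [pair_odd]. *)
Definition pair_even (p : int * int) : int * int := (p.1 + p.2, p.1 - p.2).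
Definition pair_odd (p : int * int) : int * int := (p.1 + p.2, p.1 + 1 - p.2).
Definition box2 (N : nat) : seq (int * int) := [seq (i, j) | i <- box N, j <- box N].
Definition ebox (N : nat) := [seq pair_even p | p <- box2 N] ++ [seq pair_odd p | p <- box2 N].

Lemma mem_box2 N p : (p \in box2 N) = (p.1 \in box N) && (p.2 \in box N).
Proof.
apply/allpairsP/andP => [[[i j] /= [hi hj ->]] //|[h1 h2]].
by exists p; split=> //; case: p {h1 h2}.
Qed.

Lemma uniq_box2 N : uniq (box2 N).
Proof. by apply: allpairs_uniq; rewrite ?uniq_box // => -[a b] [c d]. Qed.

Lemma box2_sub N M : (N <= M)%N -> {subset box2 N <= box2 M}.
Proof. by move=> NM p; rewrite !mem_box2 !mem_box; lia. Qed.

Lemma ebox_size N : (N <= (N.+1 + N.+1).+1)%N.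
Proof. lia. Qed.

Lemma uniq_ebox N : uniq (ebox N).
Proof.
have i0 : injective pair_even.
  by move=> [a b] [c d] [h1 h2]; congr (_, _); lia.
have i1 : injective pair_odd.
  by move=> [a b] [c d] [h1 h2]; congr (_, _); lia.
rewrite cat_uniq !map_inj_uniq // uniq_box2 andbT /=.
apply/hasPn => _ /mapP[[a b] _ ->]; apply/mapP => -[[c d] _ [h1 h2]].
lia.
Qed.

(** With [ebox_box2] this sandwiches the parity-adapted truncation between two squares, so both
    exhaustions of the lattice give the same sum of an absolutely convergent series. *)
Lemma box2_ebox N : {subset box2 N <= ebox N.+1}.
Proof.
move=> [i j]; rewrite mem_box2 /= !mem_box => /andP[hi hj].
rewrite mem_cat; apply/orP.
have [a [ha|ha]] : exists a : int, i + j = 2 * a \/ i + j = 2 * a + 1.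
  exists ((i + j) %/ 2)%Z; have := divz_eq (i + j) 2.
  have := @modz_ge0 (i + j) 2 isT; have := @ltz_pmod (i + j) 2 isT.
  by move: (_ %/ _)%Z (_ %% _)%Z; lia.
- left; apply/mapP; exists (a, i - a); last by rewrite /pair_even /=; congr (_, _); lia.
  by rewrite mem_box2 /= !mem_box; lia.
- right; apply/mapP; exists (a, i - a); last by rewrite /pair_odd /=; congr (_, _); lia.
  by rewrite mem_box2 /= !mem_box; lia.
Qed.

Lemma ebox_box2 N : {subset ebox N <= box2 (N + N).+1}.
Proof.
move=> p; rewrite mem_cat => /orP[] /mapP[[a b]];
  rewrite mem_box2 /= !mem_box => h ->; rewrite mem_box2 /= !mem_box; lia.
Qed.

Lemma sum_box2 (f g : int -> C) N :
  \sum_(p <- box2 N) f p.1 * g p.2 = (\sum_(j <- box N) f j) * (\sum_(j <- box N) g j).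
Proof. by rewrite /box2 big_allpairs /= big_distrlr. Qed.

Lemma sum_box2_theta_mono (q q' X Y : C) N : X != 0 -> Y != 0 ->
  \sum_(p <- box2 N) theta_mono q X p.1 * theta_mono q' Y p.2 = qtheta_part q X N * qtheta_part q' Y N.
Proof. by move=> X0 Y0; rewrite sum_box2 (sum_box_theta_mono q N X0) (sum_box_theta_mono q' N Y0). Qed.

Lemma sum_box2R (f g : int -> R) N :
  \sum_(p <- box2 N) f p.1 * g p.2 = (\sum_(j <- box N) f j) * (\sum_(j <- box N) g j).
Proof. by rewrite /box2 big_allpairs /= big_distrlr. Qed.

Lemma ler_sum_uniq_sub (T : eqType) (s1 s2 : seq T) (P : pred T) (f : T -> R) :
  uniq s1 -> uniq s2 -> {subset s1 <= s2} -> (forall x, 0 <= f x) ->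
  \sum_(x <- s1 | P x) f x <= \sum_(x <- s2 | P x) f x.
Proof.
move=> u1 u2 s12 f0; rewrite -subr_ge0 [X in X - _]big_mkcond [X in _ - X]big_mkcond.
rewrite (sum_uniq_diff _ u1 u2 s12); apply: sumr_ge0 => x _.
by case: (P x).
Qed.

Section Id.
Variables (q X Y : C).
Hypotheses (q0 : q != 0) (q1 : nm q < 1) (X0 : X != 0) (Y0 : Y != 0).

Let mono (e1 e2 e3 e4 : int) : C := (-1) ^ e1 * q ^ e2 * X ^ e3 * Y ^ e4.

Let n10 : (-1 : C) != 0. Proof. by rewrite oppr_eq0 oner_eq0. Qed.

Let monoM a b c d a' b' c' d' :
  mono a b c d * mono a' b' c' d' = mono (a + a') (b + b') (c + c') (d + d').
Proof. by rewrite /mono !expfzDr //; ring. Qed.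

Let sgn2 (a : int) : (-1 : C) ^ (2 * a) = 1.
Proof. by rewrite -exprz_exp -exprnP sqrrN expr1n exp1rz. Qed.

Let sgnaa (a : int) : (-1 : C) ^ a * (-1) ^ a = 1.
Proof. by rewrite -expfzDr // -[RHS](sgn2 a); congr (_ ^ _); lia. Qed.

Let monoA j : theta_mono q (X * Y) j = mono j (tri j) j j.
Proof. by rewrite /theta_mono /mono expfzMl -exprnP mulrA. Qed.

Let monoB j : theta_mono q (X / Y) j = mono j (tri j) j (- j).
Proof. by rewrite /theta_mono /mono expfzMl -exprnP exprz_inv mulrA. Qed.

Let pow2 (Z : C) (a : int) : (Z ^+ 2) ^ a = Z ^ (2 * a).
Proof. by rewrite exprnP exprz_exp. Qed.

Let powN (Z : C) (a : int) : (- Z) ^ a = (-1) ^ a * Z ^ a.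
Proof. by rewrite -expfzMl mulN1r. Qed.

Let tt2 (Z : C) a : theta_mono (q ^+ 2) (- Z) a = q ^ (2 * tri a)%N * Z ^ a.
Proof. by rewrite /theta_mono powN mulrACA sgnaa mul1r -exprM -exprnP. Qed.

Let monoU a : theta_mono (q ^+ 2) (- X ^+ 2) a = mono 0 (2 * tri a)%N (2 * a) 0.
Proof. by rewrite tt2 pow2 /mono !expr0z mul1r mulr1. Qed.

Let monoUY a : theta_mono (q ^+ 2) (- Y ^+ 2) a = mono 0 (2 * tri a)%N 0 (2 * a).
Proof. by rewrite tt2 pow2 /mono !expr0z mul1r mulr1. Qed.

Let monoV a : theta_mono (q ^+ 2) (- (q * X ^+ 2)) a = mono 0 ((2 * tri a)%N%:Z + a) (2 * a) 0.
Proof. by rewrite tt2 expfzMl pow2 /mono expfzDr // !expr0z mul1r mulr1 mulrA. Qed.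

Let monoVY a : theta_mono (q ^+ 2) (- (q * Y ^+ 2)) a = mono 0 ((2 * tri a)%N%:Z + a) 0 (2 * a).
Proof. by rewrite tt2 expfzMl pow2 /mono expfzDr // !expr0z mul1r mulr1 mulrA. Qed.

Let F (p : int * int) : C := theta_mono q (X * Y) p.1 * theta_mono q (X / Y) p.2.

(** The quadratic exponents separate: with tri j = j(j-1)/2, tri(a+b) + tri(a-b) = 2 tri a + 2 tri b
    + b. In the odd class the extra linear term is a instead, which moves the factor q from Y to X
    in [F1]. *)
Let F0 p : F (pair_even p) = theta_mono (q ^+ 2) (- X ^+ 2) p.1 * theta_mono (q ^+ 2) (- (q * Y ^+ 2)) p.2.
Proof.
case: p => a b; rewrite /F /pair_even /= monoA monoB monoU monoVY !monoM /mono.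
have -> : a + b + (a - b) = 2 * a by lia.
rewrite sgn2 expr0z.
have T1 := triE (a + b); have T2 := triE (a - b); have T3 := triE a; have T4 := triE b.
congr (_ * _ ^ _ * _ ^ _ * _ ^ _); lia.
Qed.

Let F1 p : F (pair_odd p) = - (X / Y) * (theta_mono (q ^+ 2) (- (q * X ^+ 2)) p.1 * theta_mono (q ^+ 2) (- Y ^+ 2) p.2).
Proof.
have -> : - (X / Y) = mono 1 0 1 (-1).
  by rewrite /mono !expr1z expr0z exprN1; ring.
case: p => a b; rewrite /F /pair_odd /= monoA monoB monoV monoUY !monoM /mono.
have -> : a + b + (a + 1 - b) = 2 * a + 1 by lia.
rewrite expfzDr // sgn2 mul1r addr0.
have T1 := triE (a + b); have T2 := triE (a + 1 - b); have T3 := triE a; have T4 := triE b.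
congr (_ ^ _ * _ ^ _ * _ ^ _ * _ ^ _); lia.
Qed.

Let q20 : nm (q ^+ 2) < 1.
Proof. by rewrite nmX expr2 mulr_ilt1 ?nm_ge0. Qed.

(* The product on the left has rank 2 as a function of (X, Y): split the
   double series by the parity of the sum of the two indices. *)
Lemma qtheta_plucker : qtheta q (X * Y) * qtheta q (X / Y) =
  qtheta (q ^+ 2) (- X ^+ 2) * qtheta (q ^+ 2) (- (q * Y ^+ 2))
  - X / Y * (qtheta (q ^+ 2) (- (q * X ^+ 2)) * qtheta (q ^+ 2) (- Y ^+ 2)).
Proof.
have XY0 : X * Y != 0 by rewrite mulf_neq0.
have XY0' : X / Y != 0 by rewrite mulf_neq0 ?invr_eq0.
have e1 : - X ^+ 2 != 0 by rewrite oppr_eq0 expf_neq0.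
have e2 : - Y ^+ 2 != 0 by rewrite oppr_eq0 expf_neq0.
have e3 : - (q * X ^+ 2) != 0 by rewrite oppr_eq0 mulf_neq0 ?expf_neq0.
have e4 : - (q * Y ^+ 2) != 0 by rewrite oppr_eq0 mulf_neq0 ?expf_neq0.
pose A N := \sum_(p <- box2 N) F p.
pose B N := \sum_(p <- ebox N) F p.
have AE N : A N = qtheta_part q (X * Y) N * qtheta_part q (X / Y) N.
  exact: sum_box2_theta_mono.
have BE N : B N = qtheta_part (q ^+ 2) (- X ^+ 2) N * qtheta_part (q ^+ 2) (- (q * Y ^+ 2)) N
  - X / Y * (qtheta_part (q ^+ 2) (- (q * X ^+ 2)) N * qtheta_part (q ^+ 2) (- Y ^+ 2) N).
  rewrite /B big_cat !big_map /=.
  under eq_bigr do rewrite F0.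
  under [X in _ + X]eq_bigr do rewrite F1.
  congr (_ + _); first exact: sum_box2_theta_mono.
  by rewrite -mulr_sumr mulNr; congr (- (_ * _)); exact: sum_box2_theta_mono.
have [K1 K10 HK1] := abs_sum_box q1 XY0; have [K2 K20 HK2] := abs_sum_box q1 XY0'.
pose G N := \sum_(p <- box2 N) nm (F p).
have GE N : G N = (\sum_(j <- box N) nm (theta_mono q (X * Y) j)) * (\sum_(j <- box N) nm (theta_mono q (X / Y) j)).
  by rewrite -sum_box2R; apply: eq_bigr => p _; rewrite nmM.
have GK N : G N <= K1 * K2.
  have s0 Z : 0 <= \sum_(j <- box N) nm (theta_mono q Z j) by apply: sumr_ge0 => i _; exact: nm_ge0.
  by rewrite GE; exact: (ler_pM (s0 _) (s0 _) (HK1 N) (HK2 N)).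
have Gm N M : (N <= M)%N -> G N <= G M.
  move=> NM; apply: (ler_sum_uniq_sub xpredT); rewrite ?uniq_box2 //; first exact: box2_sub.
  by move=> p; exact: nm_ge0.
(* The two truncations differ only by pairs between nested squares, and the absolute sums [G] over
   squares are monotone and bounded, hence Cauchy. *)
have D N : nm (B N.+1 - A N) <= G (N.+1 + N.+1).+1 - G N.
  rewrite /B /A (sum_uniq_diff _ (uniq_box2 N) (uniq_ebox N.+1) (@box2_ebox N)).
  apply: le_trans (nm_sum _ _ _) _.
  rewrite /G (sum_uniq_diff _ (uniq_box2 N) (uniq_box2 _)); last exact: box2_sub (ebox_size N).
  apply: ler_sum_uniq_sub; rewrite ?uniq_box2 ?uniq_ebox //; first exact: ebox_box2.
  by move=> p; exact: nm_ge0.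
have BA : (fun N => B N.+1 - A N) @ \oo --> (0 : C).
  apply/cvg_nmP => e e0; have [M HM] := cvg_bounded_nondec Gm GK e0.
  exists M => // N MN /=; rewrite subr0; apply: le_trans (D N) _.
  by apply: HM => //; exact: ebox_size.
have Ac : A @ \oo --> (qtheta q (X * Y) * qtheta q (X / Y) : C).
  have -> : A = (fun N => qtheta_part q (X * Y) N * qtheta_part q (X / Y) N) by apply/funext.
  exact: (cvgC_mul (qtheta_cvg q1 XY0) (qtheta_cvg q1 XY0')).
have Bc : B @ \oo --> (qtheta (q ^+ 2) (- X ^+ 2) * qtheta (q ^+ 2) (- (q * Y ^+ 2))
  - X / Y * (qtheta (q ^+ 2) (- (q * X ^+ 2)) * qtheta (q ^+ 2) (- Y ^+ 2)) : C).
  have -> : B = (fun N => qtheta_part (q ^+ 2) (- X ^+ 2) N * qtheta_part (q ^+ 2) (- (q * Y ^+ 2)) N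
    - X / Y * (qtheta_part (q ^+ 2) (- (q * X ^+ 2)) N * qtheta_part (q ^+ 2) (- Y ^+ 2) N)) by apply/funext.
  exact: (cvgC_sub (cvgC_mul (qtheta_cvg q20 e1) (qtheta_cvg q20 e4))
    (cvgC_mul (@cvgC_cst R nat \oo _ (X / Y)) (cvgC_mul (qtheta_cvg q20 e3) (qtheta_cvg q20 e2)))).
have Bc' := @cvg_subseq R B S _ (fun N => leqnSn N) Bc.
apply/esym/eqP; rewrite -subr_eq0; apply/eqP.
exact: (cvgC_unique (F := \oo) (cvgC_sub Bc' Ac) BA).
Qed.

End Id.

End Plucker.

(** * The odd theta function, the three-term relation and Fay's identity *)

Section Sigma.
Variable R : realType.
Local Notation C := (Cx R).

Section One.
Variable eta : C.
Hypothesis eta0 : 0 < Imc eta.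

(* The odd normalisation of theta. *)
Definition sigma (u : C) : C := ee (- u / 2) * theta eta u.

Lemma ee_invhalf : ee (- (1 / 2) : C) = -1.
Proof. by rewrite eeN ee_half invrN1. Qed.

Lemma sigma_opp u : sigma (- u) = - sigma u.
Proof.
rewrite /sigma theta_opp // opprK.
have -> : ee (u / 2) = ee u * ee (- u / 2) by rewrite -eeD; congr ee; field.
by rewrite eeN; field; exact: ee_neq0.
Qed.

Lemma sigma_add1 u : sigma (u + 1) = - sigma u.
Proof.
rewrite /sigma theta_add1 //.
have -> : - (u + 1) / 2 = - u / 2 + (- (1 / 2)) by field.
by rewrite eeD ee_invhalf; ring.
Qed.

Lemma sigma_sub1 u : sigma (u - 1) = - sigma u.
Proof. by rewrite -[in RHS](subrK 1 u) sigma_add1 opprK. Qed.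

Lemma sigma_subint u (p : int) : sigma (u - p%:~R) = (-1) ^ p * sigma u.
Proof.
have n10 : (-1 : C) != 0 by rewrite oppr_eq0 oner_eq0.
elim/int_ind: p u => [|k IH|k IH] u; first by rewrite subr0 mul1r.
  rewrite -addn1 PoszD rmorphD /= opprD addrA sigma_sub1 IH expfzDr //.
  by rewrite expr1z; ring.
rewrite -addn1 PoszD opprD rmorphD /= opprD addrA.
have -> : u - (- k%:Z)%:~R - (-1)%:~R = u - (- k%:Z)%:~R + 1 by rewrite mulrN1z opprK.
by rewrite sigma_add1 IH expfzDr // exprN1 invrN1; ring.
Qed.

Lemma sigma_addeta u : sigma (u + eta) = - ee (- u - eta / 2) * sigma u.
Proof.
rewrite /sigma theta_addeta //.
have -> : ee (- (u + eta) / 2) = ee (- eta / 2) * ee (- u / 2).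
  by rewrite -eeD; congr ee; field.
have -> : ee (- u - eta / 2) = ee (- eta / 2) * ee (- u).
  by rewrite -eeD; congr ee; field.
by ring.
Qed.

Lemma sigma0 : sigma 0 = 0. Proof. by rewrite /sigma theta0 // mulr0. Qed.

Lemma sigma_root u : sigma u = 0 -> exists a b : int, u = a%:~R + b%:~R * eta.
Proof.
move/eqP; rewrite mulf_eq0 (negbTE (ee_neq0 _)) /= => /eqP; exact: theta_root.
Qed.

Lemma Lip_sigma u : Lip sigma u.
Proof.
apply: LipM; last exact: Lip_theta.
apply: (@Lip_comp _ (@ee R) (fun u => - u / 2)); last exact: Lip_ee.
by apply: (eq_Lip _ (Lip_affine (- 1 / 2) 0 u)) => z; rewrite addr0; field.
Qed.

(** Two second-order theta functions ([pla] and [plb], with parameter q^2) whose span contains x ->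
    sigma (x + y) sigma (x - y) for every y. *)
Definition pla (x : C) : C := (ee x)^-1 * qtheta (ee eta ^+ 2) (- ee x ^+ 2).
Definition plb (x : C) : C := qtheta (ee eta ^+ 2) (- (ee eta * ee x ^+ 2)).

Lemma sigma_rank2 x y : sigma (x + y) * sigma (x - y) = pla x * plb y - plb x * pla y.
Proof.
have E : ee (- (x + y) / 2) * ee (- (x - y) / 2) = (ee x)^-1.
  by rewrite -eeD -eeN; congr ee; field.
rewrite /sigma mulrACA E !thetaE // [ee (x + y)]eeD [ee (x - y)]eeD eeN.
rewrite qtheta_plucker ?ee_neq0 //; last exact: nm_ee_lt1.
by rewrite /pla /plb; field; rewrite !ee_neq0.
Qed.

(* Pluecker relation between the 2 x 2 minors given by [sigma_rank2]. *)
Lemma sigma_three_term x y u v :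
  sigma (x + y) * sigma (x - y) * (sigma (u + v) * sigma (u - v))
  - sigma (x + u) * sigma (x - u) * (sigma (y + v) * sigma (y - v))
  + sigma (x + v) * sigma (x - v) * (sigma (y + u) * sigma (y - u)) = 0.
Proof. by rewrite !sigma_rank2; ring. Qed.

Lemma sigma_bounds : exists c L r : R, [/\ 0 < c, 0 < L, 0 < r & forall h : C, nm h <= r ->
  c * nm h <= nm (sigma h) <= L * nm h].
Proof.
have [L2 [r2 [L20 r20 H2]]] := Lip_sigma 0.
have [c [L [r [c0 L0 r0 H]]]] := theta_bounds eta0.
have LE : Lip (fun u : C => ee (u / 2)) 0.
  apply: (@Lip_comp _ (@ee R) (fun u => u / 2)); last exact: Lip_ee.
  by apply: (eq_Lip _ (Lip_affine (1 / 2) 0 0)) => z; rewrite addr0; field.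
have [B [r3 [B0 r30 HB]]] := Lip_bounded LE.
exists (c / (B + 1)), (L2 + 1), (Num.min r (Num.min r2 r3)); split.
- by rewrite divr_gt0 // ltr_wpDl.
- by rewrite ltr_wpDl.
- by rewrite !lt_min r0 r20 r30.
move=> h; rewrite !le_min => /and3P[h1 h2 h3]; apply/andP; split.
  have /andP[k1 _] := H _ h1.
  have E : theta eta h = ee (h / 2) * sigma h.
    by rewrite /sigma mulrA -eeD mulNr subrr ee0 mul1r.
  have := HB h; rewrite subr0 => /(_ h3) k2.
  rewrite mulrAC ler_pdivrMr ?ltr_wpDl //; apply: le_trans k1 _.
  rewrite E nmM mulrC ler_wpM2l ?nm_ge0 //; apply: le_trans k2 _.
  by rewrite lerDl.
have := H2 h; rewrite sigma0 !subr0 => /(_ h2) /le_trans; apply.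
by rewrite ler_wpM2r ?nm_ge0 // lerDl.
Qed.

End One.

Section Es.
Variable eta : C.
Hypothesis eta0 : 0 < Imc eta.
Variable n : nat.
Hypothesis n0 : (0 < n)%N.

Let nn : (n%:R : C) != 0. Proof. by rewrite pnatr_eq0 -lt0n. Qed.
Let neta0 := Imc_neta eta0 n0.
Local Notation sn := (sigma (n%:R * eta)).

(* [thetaA] up to elementary factors, see [thetaA_sigmaA]; unlike [thetaA] it is
   odd jointly in (a, x). *)
Definition sigmaA (a : int) (x : C) : C :=
  ee (a%:~R * x + a%:~R ^+ 2 * eta / (2 * n%:R)) * sn (n%:R * x + a%:~R * eta).

Lemma sigmaA_opp a x : sigmaA (- a) (- x) = - sigmaA a x.
Proof.
rewrite /sigmaA rmorphN mulrNN sqrrN.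
have -> : n%:R * - x + - a%:~R * eta = - (n%:R * x + a%:~R * eta) by ring.
by rewrite sigma_opp // mulrN.
Qed.

Lemma sigmaA00 : sigmaA 0 0 = 0.
Proof.
rewrite /sigmaA; have -> : (n%:R * 0 + 0%:~R * eta : C) = 0 by rewrite mulr0 add0r mul0r.
by rewrite sigma0 // mulr0.
Qed.

Lemma sigmaA_addn (a : int) x : sigmaA (a + n%:Z) x = - sigmaA a x.
Proof.
rewrite /sigmaA rmorphD /= -?pmulrn.
have -> : n%:R * x + (a%:~R + n%:R) * eta = n%:R * x + a%:~R * eta + n%:R * eta by ring.
rewrite sigma_addeta // mulNr !mulrN mulrA -eeD; congr (- (ee _ * _)).
by field; rewrite nn.
Qed.

Let phi (a : int) (x : C) : C := ee (2 * a%:~R * x + a%:~R ^+ 2 * eta / n%:R).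

Let sigmaA_phase (a b : int) (x y : C) : sigmaA (a + b) (x + y) * sigmaA (a - b) (x - y) =
  phi a x * phi b y *
  (sn ((n%:R * x + a%:~R * eta) + (n%:R * y + b%:~R * eta)) *
   sn ((n%:R * x + a%:~R * eta) - (n%:R * y + b%:~R * eta))).
Proof.
rewrite /sigmaA mulrACA -!eeD; congr (ee _ * (sigma _ _ * sigma _ _)); rewrite ?rmorphD ?rmorphB /=.
- by field; rewrite nn.
- by ring.
- by ring.
Qed.

(** The three-term relation with v = 0. Divided by the three squares it reads G(x, y) = G(x, z) -
    G(y, z), the additivity of a difference wp(y) - wp(x). *)
Lemma sigmaA_cocycle (a b c : int) (x y z : C) :
  sigmaA (a + b) (x + y) * sigmaA (a - b) (x - y) * sigmaA c z ^+ 2 =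
  sigmaA (a + c) (x + z) * sigmaA (a - c) (x - z) * sigmaA b y ^+ 2 -
  sigmaA (b + c) (y + z) * sigmaA (b - c) (y - z) * sigmaA a x ^+ 2.
Proof.
have sq (d : int) (w : C) : sigmaA d w ^+ 2 = phi d w * sn (n%:R * w + d%:~R * eta) ^+ 2.
  rewrite /sigmaA exprMn expr2 -eeD; congr (ee _ * _).
  by field; rewrite nn.
rewrite !sigmaA_phase !sq.
have := @sigma_three_term _ neta0 (n%:R * x + a%:~R * eta) (n%:R * y + b%:~R * eta)
   (n%:R * z + c%:~R * eta) 0.
rewrite !addr0 !subr0; set sx := sigma _ (_ + _); set sy := sigma _ (_ - _).
move=> H; apply/eqP; rewrite -subr_eq0; apply/eqP.
rewrite -[RHS](mulr0 (phi a x * phi b y * phi c z)) -H; ring.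
Qed.

(* Fay's trisecant identity. *)
Lemma sigmaA_fay (a1 b1 a2 b2 : int) (u1 v1 u2 v2 : C) :
  sigmaA (a1 + b1) (u1 + v1) * sigmaA (a2 + b2) (u2 + v2) * sigmaA (b1 - b2) (v1 - v2) * sigmaA (a1 + a2) (u1 + u2) =
  sigmaA a2 u2 * sigmaA b1 v1 * sigmaA (a1 + b1 - b2) (u1 + v1 - v2) * sigmaA (a1 + a2 + b2) (u1 + u2 + v2) +
  sigmaA a1 u1 * sigmaA b2 v2 * sigmaA (- a2 + b1 - b2) (- u2 + v1 - v2) * sigmaA (a1 + a2 + b1) (u1 + u2 + v1).
Proof.
pose U1 := n%:R * u1 + a1%:~R * eta; pose U2 := n%:R * u2 + a2%:~R * eta.
pose V1 := n%:R * v1 + b1%:~R * eta; pose V2 := n%:R * v2 + b2%:~R * eta.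
have T : sn (U1 + V1) * sn (U2 + V2) * sn (V1 - V2) * sn (U1 + U2) =
   sn U2 * sn V1 * sn (U1 + V1 - V2) * sn (U1 + U2 + V2) +
   sn U1 * sn V2 * sn (- U2 + V1 - V2) * sn (U1 + U2 + V1).
  (* The half-sums are chosen so that their pairwise sums and differences are, up to sign, the
     twelve arguments of Fay's identity. *)
  have := @sigma_three_term _ neta0 ((U1 + V1 - U2 - V2) / 2) ((U1 + V1 + U2 + V2) / 2)
    ((V1 - V2 - U1 - U2) / 2) ((V1 - V2 + U1 + U2) / 2).
  have -> : (U1 + V1 - U2 - V2) / 2 + (U1 + V1 + U2 + V2) / 2 = U1 + V1 by field.
  have -> : (U1 + V1 - U2 - V2) / 2 - (U1 + V1 + U2 + V2) / 2 = - (U2 + V2) by field.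
  have -> : (V1 - V2 - U1 - U2) / 2 + (V1 - V2 + U1 + U2) / 2 = V1 - V2 by field.
  have -> : (V1 - V2 - U1 - U2) / 2 - (V1 - V2 + U1 + U2) / 2 = - (U1 + U2) by field.
  have -> : (U1 + V1 - U2 - V2) / 2 + (V1 - V2 - U1 - U2) / 2 = - U2 + V1 - V2 by field.
  have -> : (U1 + V1 - U2 - V2) / 2 - (V1 - V2 - U1 - U2) / 2 = U1 by field.
  have -> : (U1 + V1 + U2 + V2) / 2 + (V1 - V2 + U1 + U2) / 2 = U1 + U2 + V1 by field.
  have -> : (U1 + V1 + U2 + V2) / 2 - (V1 - V2 + U1 + U2) / 2 = V2 by field.
  have -> : (U1 + V1 - U2 - V2) / 2 + (V1 - V2 + U1 + U2) / 2 = U1 + V1 - V2 by field.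
  have -> : (U1 + V1 - U2 - V2) / 2 - (V1 - V2 + U1 + U2) / 2 = - U2 by field.
  have -> : (U1 + V1 + U2 + V2) / 2 + (V1 - V2 - U1 - U2) / 2 = V1 by field.
  have -> : (U1 + V1 + U2 + V2) / 2 - (V1 - V2 - U1 - U2) / 2 = U1 + U2 + V2 by field.
  rewrite !(@sigma_opp _ neta0) => H; apply/eqP; rewrite -subr_eq0; apply/eqP.
  by rewrite -[RHS]H; ring.
(* The elementary factor of a fourfold product depends only on the sum of the c_i w_i and the sum of
   the c_i^2, which agree for the three terms. *)
have phase (c1 c2 c3 c4 : int) (w1 w2 w3 w4 W1 W2 W3 W4 : C) :
   n%:R * w1 + c1%:~R * eta = W1 -> n%:R * w2 + c2%:~R * eta = W2 ->
   n%:R * w3 + c3%:~R * eta = W3 -> n%:R * w4 + c4%:~R * eta = W4 ->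
   sigmaA c1 w1 * sigmaA c2 w2 * sigmaA c3 w3 * sigmaA c4 w4 =
   ee ((c1%:~R * w1 + c2%:~R * w2 + c3%:~R * w3 + c4%:~R * w4) +
       (c1%:~R ^+ 2 + c2%:~R ^+ 2 + c3%:~R ^+ 2 + c4%:~R ^+ 2) * eta / (2 * n%:R)) *
   (sn W1 * sn W2 * sn W3 * sn W4).
  move=> <- <- <- <-; rewrite /sigmaA.
  set s1 := sigma _ _; set s2 := sigma _ _; set s3 := sigma _ _; set s4 := sigma _ _.
  transitivity ((ee (c1%:~R * w1 + c1%:~R ^+ 2 * eta / (2 * n%:R)) *
    ee (c2%:~R * w2 + c2%:~R ^+ 2 * eta / (2 * n%:R)) *
    ee (c3%:~R * w3 + c3%:~R ^+ 2 * eta / (2 * n%:R)) *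
    ee (c4%:~R * w4 + c4%:~R ^+ 2 * eta / (2 * n%:R))) * (s1 * s2 * s3 * s4)); first by ring.
  by rewrite -!eeD; congr (ee _ * _); field; rewrite nn.
rewrite (phase _ _ _ _ _ _ _ _ (U1 + V1) (U2 + V2) (V1 - V2) (U1 + U2));
  try by rewrite /U1 /U2 /V1 /V2 ?(rmorphD, rmorphB, rmorphN) /=; ring.
rewrite (phase _ _ _ _ _ _ _ _ U2 V1 (U1 + V1 - V2) (U1 + U2 + V2));
  try by rewrite /U1 /U2 /V1 /V2 ?(rmorphD, rmorphB, rmorphN) /=; ring.
rewrite (phase _ _ _ _ _ _ _ _ U1 V2 (- U2 + V1 - V2) (U1 + U2 + V1));
  try by rewrite /U1 /U2 /V1 /V2 ?(rmorphD, rmorphB, rmorphN) /=; ring.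
rewrite T mulrDr !(rmorphD, rmorphB, rmorphN) /=; congr (ee _ * _ + ee _ * _);
  by field; rewrite nn.
Qed.

Lemma sigmaA_root a x : sigmaA a x = 0 -> exists p b : int, n%:R * x + a%:~R * eta = p%:~R + b%:~R * (n%:R * eta).
Proof. by move/eqP; rewrite mulf_eq0 (negbTE (ee_neq0 _)) /= => /eqP; exact: sigma_root. Qed.

Lemma Lip_sigmaA a x : Lip (sigmaA a) x.
Proof.
apply: LipM.
  apply: (@Lip_comp _ (@ee R)); last exact: Lip_ee.
  exact: Lip_affine.
by apply: (@Lip_comp _ sn); [exact: Lip_affine|exact: Lip_sigma].
Qed.

End Es.
End Sigma.

Section Es2.
Variable R : realType.
Local Notation C := (Cx R).
Variable eta : C.
Hypothesis eta0 : 0 < Imc eta.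
Variable n : nat.
Hypothesis n0 : (0 < n)%N.

Let nn : (n%:R : C) != 0. Proof. by rewrite pnatr_eq0 -lt0n. Qed.
Let neta0 := Imc_neta eta0 n0.
Local Notation sn := (sigma (n%:R * eta)).
Local Notation S := (sigmaA eta n).

Lemma sigmaA_addMn (a c : int) x : S (a + c * n%:Z) x = (-1) ^ c * S a x.
Proof.
have n10 : (-1 : C) != 0 by rewrite oppr_eq0 oner_eq0.
elim/int_ind: c a => [|k IH|k IH] a; first by rewrite mul0r addr0 expr0z mul1r.
  have -> : a + k.+1%:Z * n%:Z = (a + k%:Z * n%:Z) + n%:Z by lia.
  by rewrite (sigmaA_addn eta0) // IH exprSz mulN1r mulNr.
have -> : S (a + - k.+1%:Z * n%:Z) x = - S (a + - k%:Z * n%:Z) x.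
  have -> : a + - k%:Z * n%:Z = (a + - k.+1%:Z * n%:Z) + n%:Z by lia.
  by rewrite (sigmaA_addn eta0) // opprK.
by rewrite IH -addn1 PoszD opprD expfzDr // exprN1 invrN1; ring.
Qed.

Lemma sigmaA0_neq0 (a : int) : ~~ (n%:Z %| a)%Z -> S a 0 != 0.
Proof.
move=> H; apply/eqP => /(sigmaA_root eta0 n0)[p [b E]]; move/negP: H; apply.
apply/dvdzP; exists b; apply: (@intr_inj R).
apply: (mulIf (lt0r_neq0 eta0)).
have := congr1 (@Imc R) E.
rewrite !ImcD mulr0 Imc_intM Imc_int Imc_intM Imc_natM.
have -> : Imc (0 : C) = 0 by [].
by rewrite !add0r => ->; rewrite rmorphM /= -[n%:~R]pmulrn mulrA.
Qed.

(** Translation by a point of (1/n) Lambda is a shift of the index by b, up to elementary factors.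
    The power [ee (- p%:~R / n%:R) ^ beta] is the source of the character in [twist_coef]. *)
Lemma sigmaA_shift (p b : int) (beta : int) (x : C) :
  let tau := (p%:~R + b%:~R * eta) / n%:R in
  S (b + beta) (x - tau) = (-1) ^ p * ee (- b%:~R * tau + b%:~R ^+ 2 * eta / (2 * n%:R)) *
    ee (b%:~R * x) * ee (- p%:~R / n%:R) ^ beta * S beta x.
Proof.
move=> tau; rewrite /sigmaA.
have -> : n%:R * (x - tau) + (b + beta)%:~R * eta = n%:R * x + beta%:~R * eta - p%:~R.
  by rewrite rmorphD /= /tau; field.
rewrite (sigma_subint neta0) -ee_intM.
have E : ee ((b + beta)%:~R * (x - tau) + (b + beta)%:~R ^+ 2 * eta / (2 * n%:R)) =
    ee (- b%:~R * tau + b%:~R ^+ 2 * eta / (2 * n%:R)) *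
    ee (b%:~R * x) * ee (beta%:~R * (- p%:~R / n%:R)) *
    ee (beta%:~R * x + beta%:~R ^+ 2 * eta / (2 * n%:R)).
  rewrite -!eeD; congr ee; rewrite rmorphD /= /tau; field.
  by rewrite nn.
by rewrite E; ring.
Qed.

(** By [theta_prod_eta] the n thetas with parameter n eta multiply to a single theta with parameter
    eta; the exponentials combine to ee(-n x / 2). One function then controls the zeros of all
    indices. *)
Lemma sigmaA_prod : exists2 k : C, k != 0 & forall x, \prod_(b < n) S (Posz b) x = k * sigma eta (n%:R * x).
Proof.
have [k k0 Hk] := theta_prod_eta eta0 n0.
pose c : C := \prod_(b < n) ee ((Posz b)%:~R ^+ 2 * eta / (2 * n%:R) - b%:R * eta / 2).
have c0 : c != 0 by apply/prodf_neq0 => i _; exact: ee_neq0.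
have E x m : \prod_(b < m) S (Posz b) x = (\prod_(b < m) ee ((Posz b)%:~R ^+ 2 * eta / (2 * n%:R) - b%:R * eta / 2)) *
   ee ('C(m, 2)%:R * x - m%:R * n%:R * x / 2) * \prod_(b < m) theta (n%:R * eta) (n%:R * x + b%:R * eta).
  elim: m => [|m IH]; first by rewrite !big_ord0 bin0n !mul0r subr0 ee0 !mulr1.
  rewrite !big_ord_recr /= IH /sigmaA /sigma -!pmulrn.
  set P1 := \prod_(i < m) _; set P2 := \prod_(i < m) _; set t := theta _ _.
  have E1 : ee ('C(m.+1, 2)%:R * x - m.+1%:R * n%:R * x / 2) *
     ee (m%:R ^+ 2 * eta / (2 * n%:R) - m%:R * eta / 2) =
     ee ('C(m, 2)%:R * x - m%:R * n%:R * x / 2) *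
     (ee (m%:R * x + m%:R ^+ 2 * eta / (2 * n%:R)) * ee (- (n%:R * x + m%:R * eta) / 2)).
    rewrite -!eeD; congr ee; rewrite binS bin1 natrD -[m.+1%:R]natr1; field.
    by rewrite nn.
  transitivity (P1 * P2 * t * (ee ('C(m, 2)%:R * x - m%:R * n%:R * x / 2) *
     (ee (m%:R * x + m%:R ^+ 2 * eta / (2 * n%:R)) * ee (- (n%:R * x + m%:R * eta) / 2)))).
    by ring.
  by rewrite -E1; ring.
exists (c * k); first by rewrite mulf_neq0.
move=> x; rewrite E -/c Hk /sigma.
have B : ('C(n, 2)%:R : C) = n%:R * (n%:R - 1) / 2.
  have := congr1 (fun m => m%:R : C) (bin2D n); rewrite natrD !natrM => H.
  have -> : n%:R * (n%:R - 1) = n%:R * n%:R - n%:R :> C by ring.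
  by rewrite -H; field.
have -> : 'C(n, 2)%:R * x - n%:R * n%:R * x / 2 = - (n%:R * x) / 2.
  by rewrite B; field.
by ring.
Qed.

Lemma thetaA_sigmaA : exists2 k : C, k != 0 & forall a x,
  thetaA n eta a x = k * ee (n%:R * x / 2 + a%:~R / (2 * n%:R)) * S a x.
Proof.
have [k k0 Hk] := theta_prod_root eta0 n0; exists k => // a x.
rewrite /thetaA /sigmaA /sigma.
under eq_bigr => m _ do rewrite addrAC.
rewrite Hk.
have -> : n%:R * (x + a%:~R * eta / n%:R) = n%:R * x + a%:~R * eta by field.
set t := theta _ _.
have E : ee (a%:~R * x + a%:~R / (2 * n%:R) + (a * (a - n%:Z))%:~R / (2 * n%:R) * eta) =
  ee (n%:R * x / 2 + a%:~R / (2 * n%:R)) *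
  (ee (a%:~R * x + a%:~R ^+ 2 * eta / (2 * n%:R)) * ee (- (n%:R * x + a%:~R * eta) / 2)).
  rewrite -!eeD; congr ee; rewrite rmorphM rmorphB /= -[n%:~R]pmulrn; field.
  by rewrite nn.
by rewrite E; ring.
Qed.

End Es2.

(** * Unitarity of the R-matrix *)

Lemma sum_periodic (V : nmodType) (n : nat) (F : int -> V) (g : 'I_n -> int) :
  (forall x c, F (x + c * n%:Z) = F x) ->
  (forall c d, (n%:Z %| g c - g d)%Z -> c = d) ->
  \sum_(c < n) F (g c) = \sum_(c < n) F (Posz c).
Proof.
move=> Fp gi; case: n g Fp gi => [|n] g Fp gi; first by rewrite !big_ord0.
have lt c : (`|(g c %% n.+1%:Z)%Z|%N < n.+1)%N.
  by rewrite -ltz_nat gez0_abs ?modz_ge0 // ltz_pmod.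
pose h c : 'I_n.+1 := Ordinal (lt c).
have hE c : Posz (h c) = (g c %% n.+1%:Z)%Z by rewrite /h /= gez0_abs ?modz_ge0.
have hi : injective h.
  move=> c d hcd; apply: gi; have := congr1 (fun x : 'I_n.+1 => Posz x) hcd.
  by rewrite /= -/(h c) !hE => /eqP; rewrite eqz_mod_dvd.
rewrite [RHS](reindex_inj hi) /=; apply: eq_bigr => c _.
rewrite -/(h c) -[in RHS](Fp _ (g c %/ n.+1%:Z)%Z) hE addrC -divz_eq.
by [].
Qed.

Section Unitarity.
Variable R : realType.
Local Notation C := (Cx R).
Variable eta : C.
Hypothesis eta0 : 0 < Imc eta.
Variables n k : nat.
Hypothesis n0 : (0 < n)%N.
Hypothesis nk : coprime n k.
Local Notation S := (sigmaA eta n).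

Definition Rweight (tau z : C) (a b : int) : C := S (a + b) (- z + tau) / (S a (- z) * S b tau).

Lemma Rweight_per tau z a b c d : Rweight tau z (a + c * n%:Z) (b + d * n%:Z) = Rweight tau z a b.
Proof.
have n10 : (-1 : C) != 0 by rewrite oppr_eq0 oner_eq0.
rewrite /Rweight; have -> : a + c * n%:Z + (b + d * n%:Z) = a + b + (c + d) * n%:Z by ring.
rewrite !(sigmaA_addMn eta0) // expfzDr //.
have c0 : (-1 : C) ^ c != 0 by rewrite expfz_neq0.
have d0 : (-1 : C) ^ d != 0 by rewrite expfz_neq0.
have -> : (-1) ^ c * S a (- z) * ((-1) ^ d * S b tau) =
  (-1) ^ c * (-1) ^ d * (S a (- z) * S b tau) by ring.
by rewrite invfM mulrACA divff ?mul1r // mulf_neq0.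
Qed.

Lemma Rweight_eqmod tau z a b a' b' : (n%:Z %| a - a')%Z -> (n%:Z %| b - b')%Z ->
  Rweight tau z a b = Rweight tau z a' b'.
Proof.
move=> /dvdzP[c Hc] /dvdzP[d Hd].
have -> : a = a' + c * n%:Z by rewrite -Hc; ring.
have -> : b = b' + d * n%:Z by rewrite -Hd; ring.
exact: Rweight_per.
Qed.

Definition Rscale (z : C) : C :=
  \prod_(al < n) thetaA n eta (Posz al) (- z) / \prod_(al < n | (0 < al)%N) thetaA n eta (Posz al) 0.

Variable kt : C.
Hypothesis kt0 : kt != 0.
Hypothesis Hkt : forall (a : int) x,
  thetaA n eta a x = kt * ee (n%:R * x / 2 + a%:~R / (2 * n%:R)) * S a x.

Let nn : (n%:R : C) != 0. Proof. by rewrite pnatr_eq0 -lt0n. Qed.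

(** The exponent n x / 2 + a / (2n) is additive in (a, x), so it cancels and only the constant
    survives. *)
Lemma thetaA_ratio (a b : int) x y :
  thetaA n eta (a + b) (x + y) / (thetaA n eta a x * thetaA n eta b y) =
  kt^-1 * (S (a + b) (x + y) / (S a x * S b y)).
Proof.
rewrite !Hkt.
have -> : ee (n%:R * (x + y) / 2 + (a + b)%:~R / (2 * n%:R)) =
  ee (n%:R * x / 2 + a%:~R / (2 * n%:R)) * ee (n%:R * y / 2 + b%:~R / (2 * n%:R)) :> C.
  by rewrite -eeD; congr ee; rewrite rmorphD /=; field.
have [e10 e20] := (ee_neq0 (n%:R * x / 2 + a%:~R / (2 * n%:R)), ee_neq0 (n%:R * y / 2 + b%:~R / (2 * n%:R))).
set e1 := ee (n%:R * x / 2 + _) in e10 *; set e2 := ee (n%:R * y / 2 + _) in e20 *.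
have -> : kt * e1 * S a x * (kt * e2 * S b y) = kt * (e1 * e2) * (kt * (S a x * S b y)) by ring.
by rewrite invfM mulrACA divff ?mul1r ?mulf_neq0 // invfM mulrCA.
Qed.

(** At most one r satisfies a = j - r and b = i + r modulo n, and one exists exactly when n divides
    i + j - (a + b). *)
Lemma Rmat_entry tau z p q :
  Rmat n k eta tau z p q =
  let i := Posz (enum_val p).1 in let j := Posz (enum_val p).2 in
  let a := Posz (enum_val q).1 in let b := Posz (enum_val q).2 in
  if (n%:Z %| i + j - (a + b))%Z then Rscale z / kt * Rweight tau z (a - i) (k%:Z * (j - a)) else 0.
Proof.
rewrite /Rmat mxE /= -/(Rscale z).
move: (enum_val p) (enum_val q) => [i j] [a b] /=.
case: ifP => [/dvdzP[m Hm]|Hn]; last first.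
  rewrite big1 ?mulr0 // => r _; case: ifP => // /andP[].
  rewrite !eqz_mod_dvd => /dvdzP[c Hc] /dvdzP[d Hd]; move/negP: Hn; case.
  by apply/dvdzP; exists (- c - d); rewrite mulrBl mulNr -Hc -Hd; ring.
have nz : n%:Z != 0 by rewrite eqz_nat -lt0n.
have [r0 [c Hc]] : exists (r0 : 'I_n) c, j%:Z - a%:Z = Posz r0 + c * n%:Z.
  have lt : (`|((j%:Z - a%:Z) %% n%:Z)%Z|%N < n)%N.
    by rewrite -ltz_nat gez0_abs ?modz_ge0 // ltz_pmod // ltz_nat.
  exists (Ordinal lt), ((j%:Z - a%:Z) %/ n%:Z)%Z.
  by rewrite /= gez0_abs ?modz_ge0 // [RHS]addrC -divz_eq.
rewrite (bigD1 r0) //= big1 ?addr0; last first.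
  move=> r rr0; case: ifP => // /andP[]; rewrite !eqz_mod_dvd => /dvdzP[d Hd] _.
  case/eqP: rr0; apply: val_inj => /=.
  have E : (Posz r - Posz r0) = (d + c) * n%:Z by rewrite mulrDl -Hd; lia.
  have h1 := ltn_ord r; have h2 := ltn_ord r0.
  move: E h1 h2; move: (d + c) => e; move: (nat_of_ord r) (nat_of_ord r0) => x y E h1 h2.
  case: e E => [[|e]|e] E; nia.
rewrite ifT; last first.
  rewrite !eqz_mod_dvd; apply/andP; split; apply/dvdzP.
    by exists (- c); rewrite mulNr; lia.
  by exists (c - m); rewrite mulrBl -Hm; lia.
have -> : j%:Z - i%:Z + Posz r0 * (k%:Z - 1) = (j%:Z - i%:Z - Posz r0) + (k%:Z * Posz r0) by ring.
rewrite thetaA_ratio mulrA; congr (_ * _); rewrite -/(Rweight _ _ _ _).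
apply: Rweight_eqmod; apply/dvdzP.
  by exists c; lia.
by exists (- (k%:Z * c)); rewrite Hc; ring.
Qed.

End Unitarity.

Lemma dvdz_lt (n : nat) (x : int) : (n%:Z %| x)%Z -> (`|x| < n%:Z) -> x = 0.
Proof. by move=> /dvdzP[c ->]; case: c => [[|c]|c]; nia. Qed.

Lemma sum_NN (V : nmodType) (n : nat) (G : 'I_n * 'I_n -> V) :
  \sum_(m < NN n) G (enum_val m) = \sum_(c < n) \sum_(d < n) G (c, d).
Proof.
rewrite pair_bigA /= -(big_enum_val G) /=.
by apply: eq_bigr => -[c d].
Qed.

Section Unitarity.
Variable R : realType.
Local Notation C := (Cx R).
Variable eta : C.
Hypothesis eta0 : 0 < Imc eta.
Variables n k : nat.
Hypothesis n0 : (0 < n)%N.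
Hypothesis nk : coprime n k.
Local Notation S := (sigmaA eta n).
Local Notation W := (Rweight eta n).
Local Notation K := (Rscale eta n).

(* The analogue of wp(y) - wp(x). *)
Definition sigma_diff (c : int) (x y : C) : C :=
  S (c + c) (x + y) * S 0 (x - y) / (S c x ^+ 2 * S c y ^+ 2).

Section Sums.
Variables tau z : C.
Hypothesis Sz : forall a, S a (- z) != 0.
Hypothesis St : forall a, S a tau != 0.

Let ratio_per (a b c : int) x y : S (a + c * n%:Z) x / S (b + c * n%:Z) y = S a x / S b y.
Proof.
have n10 : (-1 : C) != 0 by rewrite oppr_eq0 oner_eq0.
have c0 : (-1 : C) ^ c != 0 by rewrite expfz_neq0.
by rewrite !(sigmaA_addMn eta0) // invfM mulrACA divff // mul1r.
Qed.

(* By [sigmaA_fay] the summand is H c - H (c - (a - i)) with H periodic. *)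
Lemma Rweight_sum_offdiag (i j a : int) : ~~ (n%:Z %| a - i)%Z ->
  \sum_(c < n) W tau z (Posz c - i) (k%:Z * (j - Posz c)) *
     W tau (- z) (a - Posz c) (k%:Z * (i + j - Posz c - a)) = 0.
Proof.
move=> nA; pose A := a - i.
have SA : S A 0 != 0 by exact: sigmaA0_neq0.
have SkA : S (k%:Z * A) 0 != 0.
  apply: sigmaA0_neq0 => //; apply: contra nA.
  by rewrite !dvdzE /= abszM mulnC Gauss_dvdl.
pose H (c : int) := S (c - i + k%:Z * A) (- z) / S (c - i) (- z) *
   (S (k%:Z * (i + j - c - a) + A) tau / S (k%:Z * (i + j - c - a)) tau).
have Hper x c : H (x + c * n%:Z) = H x.
  rewrite /H.
  have -> : x + c * n%:Z - i + k%:Z * A = (x - i + k%:Z * A) + c * n%:Z by ring.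
  have -> : x + c * n%:Z - i = (x - i) + c * n%:Z by ring.
  have -> : k%:Z * (i + j - (x + c * n%:Z) - a) = k%:Z * (i + j - x - a) + (- (k%:Z * c)) * n%:Z by ring.
  have -> : k%:Z * (i + j - x - a) + (- (k%:Z * c)) * n%:Z + A =
     (k%:Z * (i + j - x - a) + A) + (- (k%:Z * c)) * n%:Z by ring.
  by congr (_ * _); apply: ratio_per.
have term (c : int) : W tau z (c - i) (k%:Z * (j - c)) *
     W tau (- z) (a - c) (k%:Z * (i + j - c - a)) * (S (k%:Z * A) 0 * S A 0) = H c - H (c - A).
  (* With these arguments u1 + u2 = 0 and v1 - v2 = 0, so the two extra factors of Fay's identity
     are S A 0 and S (k A) 0, which do not depend on c and are nonzero. *)
  have F := sigmaA_fay eta0 n0 (c - i) (k%:Z * (j - c)) (a - c) (k%:Z * (i + j - c - a)) (- z) tau z tau.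
  have e1 : k%:Z * (j - c) - k%:Z * (i + j - c - a) = k%:Z * A by rewrite /A; ring.
  have e2 : c - i + (a - c) = A by rewrite /A; ring.
  have e3 : c - i + k%:Z * (j - c) - k%:Z * (i + j - c - a) = c - i + k%:Z * A by rewrite /A; ring.
  have e4 : A + k%:Z * (i + j - c - a) = k%:Z * (i + j - c - a) + A by ring.
  have e5 : - (a - c) + k%:Z * (j - c) - k%:Z * (i + j - c - a) = c - A - i + k%:Z * A by rewrite /A; ring.
  have e6 : A + k%:Z * (j - c) = k%:Z * (i + j - (c - A) - a) + A by rewrite /A; ring.
  have e7 : k%:Z * (j - c) = k%:Z * (i + j - (c - A) - a) by rewrite /A; ring.
  have f1 : S (a - c) z = - S (c - A - i) (- z).
    by rewrite -(sigmaA_opp eta0) // opprK; congr (S _ _); rewrite /A; ring.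
  rewrite e1 e2 e3 e4 e5 e6 !addrK subrr addNr !add0r in F.
  rewrite /W /H /Rweight opprK f1 in F *.
  move: F; rewrite e7.
  set s1 := S (c - i) (- z); set s2 := S (k%:Z * (i + j - (c - A) - a)) tau.
  set s3 := S (c - A - i) (- z); set s4 := S (k%:Z * (i + j - c - a)) tau.
  have s10 : s1 != 0 by exact: Sz.
  have s20 : s2 != 0 by exact: St.
  have s30 : s3 != 0 by exact: Sz.
  have s40 : s4 != 0 by exact: St.
  set X1 := S _ (- z + tau); set X2 := S _ (z + tau) => F.
  have -> : X1 / (s1 * s2) * (X2 / (- s3 * s4)) * (S (k%:Z * A) 0 * S A 0) =
     - (X1 * X2 * S (k%:Z * A) 0 * S A 0) / (s1 * s2 * s3 * s4).
    by field; rewrite s10 s20 s30 s40.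
  rewrite F; field; by rewrite s10 s20 s30 s40.
have X : (\sum_(c < n) W tau z (Posz c - i) (k%:Z * (j - Posz c)) *
     W tau (- z) (a - Posz c) (k%:Z * (i + j - Posz c - a))) * (S (k%:Z * A) 0 * S A 0) = 0.
  rewrite mulr_suml; under eq_bigr do rewrite term.
  rewrite sumrB (@sum_periodic _ n H (fun c => Posz c - A)) ?subrr //.
  move=> c d; have -> : Posz c - A - (Posz d - A) = Posz c - Posz d by ring.
  move=> /dvdz_lt hcd; apply: val_inj => /=.
  have := ltn_ord c; have := ltn_ord d; lia.
by move/eqP: X; rewrite mulf_eq0 (negbTE (mulf_neq0 SkA SA)) orbF => /eqP.
Qed.

(** With (0, tau) as base point, [sigmaA_cocycle] turns each summand into f (c - i) (-z) - f (k (j -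
    c)) tau. Both indices run through all residues, k being invertible modulo n, so the dependence
    on i and j disappears. *)
Lemma Rweight_sum_diag (i j : int) :
  \sum_(c < n) W tau z (Posz c - i) (k%:Z * (j - Posz c)) *
     W tau (- z) (i - Posz c) (k%:Z * (j - Posz c)) = - \sum_(c < n) sigma_diff (Posz c) tau (- z).
Proof.
pose f (c : int) x := S c (x + tau) * S c (x - tau) / (S c x ^+ 2 * S 0 tau ^+ 2).
have coc (c d : int) x y : S c x != 0 -> S d y != 0 ->
    S (c + d) (x + y) * S (c - d) (x - y) / (S c x ^+ 2 * S d y ^+ 2) = f c x - f d y.
  move=> cx dy; have := sigmaA_cocycle eta0 n0 c d 0 x y tau.
  rewrite !addr0 ?subr0 /f => E.
  set X := S (c + d) (x + y) * S (c - d) (x - y) in E *.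
  have -> : X / (S c x ^+ 2 * S d y ^+ 2) = X * S 0 tau ^+ 2 / (S c x ^+ 2 * S d y ^+ 2 * S 0 tau ^+ 2).
    by field; rewrite St cx dy.
  by rewrite E; field; rewrite St cx dy.
have fper x (c d : int) : f (c + d * n%:Z) x = f c x.
  have n10 : (-1 : C) != 0 by rewrite oppr_eq0 oner_eq0.
  have c0 : (-1 : C) ^ d != 0 by rewrite expfz_neq0.
  rewrite /f !(sigmaA_addMn eta0) //.
  have -> : (-1) ^ d * S c (x + tau) * ((-1) ^ d * S c (x - tau)) =
     ((-1) ^ d) ^+ 2 * (S c (x + tau) * S c (x - tau)) by ring.
  have -> : ((-1) ^ d * S c x) ^+ 2 * S 0 tau ^+ 2 = ((-1) ^ d) ^+ 2 * (S c x ^+ 2 * S 0 tau ^+ 2) by ring.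
  by rewrite invfM mulrACA divff ?mul1r // expf_neq0.
have term (c : 'I_n) : W tau z (Posz c - i) (k%:Z * (j - Posz c)) *
     W tau (- z) (i - Posz c) (k%:Z * (j - Posz c)) =
     f (Posz c - i) (- z) - f (k%:Z * (j - Posz c)) tau.
  rewrite -coc // /W /Rweight opprK.
  set u := Posz c - i; set v := k%:Z * (j - Posz c).
  have -> : i - Posz c = - u by rewrite /u; ring.
  have -> : S (- u) z = - S u (- z) by rewrite -(sigmaA_opp eta0) // opprK.
  have -> : S (- u + v) (z + tau) = - S (u - v) (- z - tau).
    by rewrite -(sigmaA_opp eta0) //; congr (S _ _); ring.
  by field; rewrite Sz St.
under eq_bigr do rewrite term.
rewrite sumrB (@sum_periodic _ n (fun c => f c (- z)) (fun c => Posz c - i)) //; last first.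
  move=> c d; have -> : Posz c - i - (Posz d - i) = Posz c - Posz d by ring.
  move=> /dvdz_lt hcd; apply: val_inj => /=.
  have := ltn_ord c; have := ltn_ord d; lia.
rewrite (@sum_periodic _ n (fun c => f c tau) (fun c => k%:Z * (j - Posz c))) //; last first.
  move=> c d; have -> : k%:Z * (j - Posz c) - k%:Z * (j - Posz d) = (Posz d - Posz c) * k%:Z by ring.
  rewrite !dvdzE abszM Gauss_dvdl // -dvdzE => /dvdz_lt hcd; apply: val_inj => /=.
  have := ltn_ord c; have := ltn_ord d; lia.
rewrite -sumrB -sumrN; apply: eq_bigr => c _.
have := coc (Posz c) (Posz c) tau (- z) (St _) (Sz _).
by rewrite subrr /sigma_diff => ->; ring.
Qed.

End Sums.

End Unitarity.

Lemma ord_congr (n : nat) (s : int) : (0 < n)%N ->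
  exists d0 : 'I_n, forall d : 'I_n, (n%:Z %| s - Posz d)%Z = (d == d0).
Proof.
move=> n0; have nz : n%:Z != 0 by rewrite eqz_nat -lt0n.
have lt : (`|(s %% n%:Z)%Z|%N < n)%N.
  by rewrite -ltz_nat gez0_abs ?modz_ge0 // ltz_pmod // ltz_nat.
exists (Ordinal lt) => d; rewrite -eqz_mod_dvd -val_eqE /= -eqz_nat gez0_abs ?modz_ge0 //.
by rewrite (modz_small (m := Posz d)) ?ltz_nat ?ltn_ord // eq_sym.
Qed.

Section Product.
Variable R : realType.
Local Notation C := (Cx R).
Variable eta : C.
Hypothesis eta0 : 0 < Imc eta.
Variables n k : nat.
Hypothesis n0 : (0 < n)%N.
Hypothesis nk : coprime n k.
Local Notation S := (sigmaA eta n).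
Local Notation W := (Rweight eta n).
Local Notation K := (Rscale eta n).
Variable kt : C.
Hypothesis kt0 : kt != 0.
Hypothesis Hkt : forall (a : int) x,
  thetaA n eta a x = kt * ee (n%:R * x / 2 + a%:~R / (2 * n%:R)) * S a x.

Definition unitarity_factor (tau z : C) : C :=
  - (K z / kt * (K (- z) / kt)) * \sum_(c < n) sigma_diff eta n (Posz c) tau (- z).

Lemma Rmat_mul (tau z : C) : (forall a, S a (- z) != 0) -> (forall a, S a tau != 0) ->
  Rmat n k eta tau z *m Rmat n k eta tau (- z) = (unitarity_factor tau z)%:M.
Proof.
move=> Sz St; apply/matrixP => p q; rewrite !mxE.
under eq_bigr do rewrite !(Rmat_entry eta0 n0 nk kt0 Hkt).
pose G (cd : 'I_n * 'I_n) :=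
  (if (n%:Z %| Posz (enum_val p).1 + Posz (enum_val p).2 - (Posz cd.1 + Posz cd.2))%Z
   then K z / kt * W tau z (Posz cd.1 - Posz (enum_val p).1)
      (k%:Z * (Posz (enum_val p).2 - Posz cd.1)) else 0) *
  (if (n%:Z %| Posz cd.1 + Posz cd.2 - (Posz (enum_val q).1 + Posz (enum_val q).2))%Z
   then K (- z) / kt * W tau (- z) (Posz (enum_val q).1 - Posz cd.1)
      (k%:Z * (Posz cd.2 - Posz (enum_val q).1)) else 0).
rewrite -[LHS]/(\sum_(m < NN n) G (enum_val m)) sum_NN /G {G}.
have -> : (p == q) = (enum_val p == enum_val q) by rewrite (inj_eq enum_val_inj).
move: (enum_val p) (enum_val q) => [i j] [a b] /=.
(* Conservation of i + j modulo n leaves a single intermediate d for each c, so the matrix product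
   becomes a sum over c alone. *)
have step (c : 'I_n) : \sum_(d < n)
   (if (n%:Z %| Posz i + Posz j - (Posz c + Posz d))%Z
    then K z / kt * W tau z (Posz c - Posz i) (k%:Z * (Posz j - Posz c)) else 0) *
   (if (n%:Z %| Posz c + Posz d - (Posz a + Posz b))%Z
    then K (- z) / kt * W tau (- z) (Posz a - Posz c) (k%:Z * (Posz d - Posz a)) else 0) =
   if (n%:Z %| Posz i + Posz j - (Posz a + Posz b))%Z then
   K z / kt * (K (- z) / kt) * (W tau z (Posz c - Posz i) (k%:Z * (Posz j - Posz c)) *
      W tau (- z) (Posz a - Posz c) (k%:Z * (Posz i + Posz j - Posz c - Posz a))) else 0.
  have [d0 Hd0] := ord_congr (Posz i + Posz j - Posz c) n0.
  have h0 := Hd0 d0; rewrite eqxx in h0; move/dvdzP: (h0) => [m Hm].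
  rewrite (bigD1 d0) //= big1 ?addr0; last first.
    move=> d dd0; rewrite ifF ?mul0r //; apply/negbTE; apply: contra dd0.
    by rewrite -Hd0 opprD addrA.
  rewrite opprD addrA h0.
  have -> : (n%:Z %| Posz c + Posz d0 - (Posz a + Posz b))%Z =
            (n%:Z %| Posz i + Posz j - (Posz a + Posz b))%Z.
    have -> : Posz i + Posz j - (Posz a + Posz b) = (Posz c + Posz d0 - (Posz a + Posz b)) + m * n%:Z.
      by rewrite -Hm; ring.
    apply/dvdzP/dvdzP => -[e He]; first by exists (e + m); rewrite mulrDl -He.
    by exists (e - m); rewrite mulrBl -He addrK.
  case: ifP => _; last by rewrite mulr0.
  rewrite [W tau (- z) _ _](@Rweight_eqmod _ eta eta0 n n0 tau (- z) _ _ (Posz a - Posz c)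
     (k%:Z * (Posz i + Posz j - Posz c - Posz a))).
  - by ring.
  - by rewrite subrr dvdz0.
  - apply/dvdzP; exists (- (k%:Z * m)).
    have -> : Posz d0 = Posz i + Posz j - Posz c - m * n%:Z by rewrite -Hm; ring.
    by ring.
under eq_bigr do rewrite step.
case: (boolP (n%:Z %| Posz i + Posz j - (Posz a + Posz b))%Z) => [Hd|/negbTE Hn]; last first.
  rewrite big1 //; have -> : ((i, j) == (a, b)) = false; last by rewrite mulr0n.
  apply/negbTE/eqP => -[ia jb].
  by move: Hn; rewrite ia jb subrr dvdz0.
have -> : \sum_(c < n) K z / kt * (K (- z) / kt) * (W tau z (Posz c - Posz i) (k%:Z * (Posz j - Posz c)) *
      W tau (- z) (Posz a - Posz c) (k%:Z * (Posz i + Posz j - Posz c - Posz a))) =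
    K z / kt * (K (- z) / kt) * \sum_(c < n) (W tau z (Posz c - Posz i) (k%:Z * (Posz j - Posz c)) *
      W tau (- z) (Posz a - Posz c) (k%:Z * (Posz i + Posz j - Posz c - Posz a))).
  by rewrite mulr_sumr.
have [ia|ia] := eqVneq i a.
  subst a; have jb : j = b.
    apply: val_inj; move: Hd.
    have -> : Posz i + Posz j - (Posz i + Posz b) = Posz j - Posz b by ring.
    by move=> /dvdz_lt h /=; have := ltn_ord j; have := ltn_ord b; lia.
  subst b; rewrite eqxx mulr1n /unitarity_factor.
  under eq_bigr => c _ do (have -> : Posz i + Posz j - Posz c - Posz i = Posz j - Posz c by ring).
  by rewrite (Rweight_sum_diag eta0 n0 nk) // mulrN mulNr.
rewrite (Rweight_sum_offdiag eta0 n0 nk) ?mulr0 //.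
  have -> : ((i, j) == (a, b)) = false; last by rewrite mulr0n.
  by apply/negbTE/eqP => -[/eqP]; rewrite -val_eqE /= => /eqP /val_inj /eqP; rewrite (negbTE ia).
apply: contra ia => /dvdz_lt h; apply/eqP/val_inj => /=.
by have := ltn_ord a; have := ltn_ord i; lia.
Qed.

End Product.

Section Punctured.
Variable R : realType.
Local Notation C := (Cx R).

Lemma near_dnbhs (x : C) (P : C -> Prop) (r : R) : 0 < r ->
  (forall z, z != x -> nm (z - x) <= r -> P z) -> \forall z \near x^', P z.
Proof.
move=> r0 H; rewrite /dnbhs near_withinE.
by have := nbhs_nm x r0; apply: filterS => z h zx; exact: H.
Qed.

Lemma cvg_dnbhsC (f : C -> C) (x l : C) : f z @[z --> x] --> l -> f z @[z --> x^'] --> l.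
Proof.
move=> /(@cvg_nmP R C (nbhs x) (nbhs_filter x) f l) H.
apply: (@cvg_nmP R C (dnbhs x) _ f l).2 => e e0.
have [r r0 Hr] := nbhs_nmP (H e e0).
by apply: (near_dnbhs r0) => z _ h; exact: Hr.
Qed.

Lemma Lip_dcvg (f : C -> C) x : Lip f x -> f z @[z --> x^'] --> f x.
Proof. by move=> H; apply: cvg_dnbhsC; exact: Lip_cvg. Qed.

Lemma dcvg_unique (f : C -> C) (x l l' : C) :
  f z @[z --> x^'] --> l -> f z @[z --> x^'] --> l' -> l = l'.
Proof. exact: (@cvgC_unique R C (dnbhs x) _ f l l'). Qed.

End Punctured.

(** * Evaluation of the sum of Weierstrass-type differences *)

Section DnSum.
Variable R : realType.
Local Notation C := (Cx R).
Variable eta : C.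
Hypothesis eta0 : 0 < Imc eta.
Variables n : nat.
Hypothesis n0 : (0 < n)%N.
Local Notation S := (sigmaA eta n).
Local Notation D := (sigma_diff eta n).

Let nn : (n%:R : C) != 0. Proof. by rewrite pnatr_eq0 -lt0n. Qed.
Let neta0 := Imc_neta eta0 n0.

Lemma sigmaA0_bounds : exists c L r : R, [/\ 0 < c, 0 < L, 0 < r & forall h : C, nm h <= r ->
  c * nm h <= nm (S 0 h) <= L * nm h].
Proof.
have [c [L [r [c0 L0 r0 H]]]] := sigma_bounds neta0.
have N0 : 0 < nm (n%:R : C) by rewrite nm_gt0.
exists (c * nm (n%:R : C)), (L * nm (n%:R : C)), (r / nm (n%:R : C)); split; rewrite ?mulr_gt0 ?divr_gt0 //.
  by rewrite invr_gt0.
move=> h; rewrite ler_pdivlMr // mulrC -nmM => /H.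
have -> : S 0 h = sigma (n%:R * eta) (n%:R * h).
  rewrite /sigmaA; have -> : (0%:~R * h + 0%:~R ^+ 2 * eta / (2 * n%:R) : C) = 0.
    by rewrite mul0r add0r expr0n /= !mul0r.
  by rewrite ee0 mul1r mul0r addr0.
by rewrite nmM -!mulrA.
Qed.

Lemma sigmaA0_near_neq0 : \forall h \near (0 : C)^', S 0 h != 0.
Proof.
have [c [L [r [c0 L0 r0 H]]]] := sigmaA0_bounds.
apply: (near_dnbhs r0) => z z0; rewrite subr0 => /H/andP[h _].
by rewrite -nm_gt0; apply: lt_le_trans h; rewrite mulr_gt0 // nm_gt0.
Qed.

Lemma Lip_sigmaA_affine c (a b x : C) : Lip (fun e => S c (a * e + b)) x.
Proof. by apply: (@Lip_comp _ (S c)); [exact: Lip_affine|exact: Lip_sigmaA]. Qed.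

Section XY.
Variables x y : C.
Hypothesis Sx : forall c, S c x != 0.
Hypothesis Sy : forall c, S c y != 0.

Let Af (x : C) (c : nat) (e : C) : C := S c%:Z (x + e) * S c%:Z (x - e) / S c%:Z x ^+ 2.

Let Af_lip z c : Lip (Af z c) 0.
Proof.
rewrite /Af; apply: LipM; last exact: Lip_cst.
apply: LipM.
  by apply: eq_Lip (Lip_sigmaA_affine c%:Z 1 z 0) => e; rewrite mul1r addrC.
by apply: eq_Lip (Lip_sigmaA_affine c%:Z (-1) z 0) => e; rewrite mulN1r addrC.
Qed.

Let Af0 z c : (forall a, S a z != 0) -> Af z c 0 = 1.
Proof. by move=> Sz; rewrite /Af addr0 subr0 -expr2 divff // expf_neq0. Qed.

Let AB c e : Af x c e - Af y c e = S 0 e ^+ 2 * D c%:Z x y.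
Proof.
have := sigmaA_cocycle eta0 n0 c%:Z c%:Z 0 x y e.
rewrite !addr0 ?subr0 subrr /sigma_diff /Af => E.
have -> : S 0 e ^+ 2 * (S (c%:Z + c%:Z) (x + y) * S 0 (x - y) / (S c%:Z x ^+ 2 * S c%:Z y ^+ 2)) =
  (S (c%:Z + c%:Z) (x + y) * S 0 (x - y) * S 0 e ^+ 2) / (S c%:Z x ^+ 2 * S c%:Z y ^+ 2) by ring.
by rewrite E; field; rewrite Sx Sy.
Qed.

(* The telescoped difference of the two products [Af x], [Af y], divided by
   [S 0 e ^+ 2]. *)
Fixpoint Vf (m : nat) (e : C) : C :=
  if m is m'.+1 then Vf m' e * Af x m' e + (\prod_(c < m') Af y c e) * D m'%:Z x y else 0.

Let VfE m e : \prod_(c < m) Af x c e - \prod_(c < m) Af y c e = S 0 e ^+ 2 * Vf m e.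
Proof.
elim: m => [|m IH]; first by rewrite !big_ord0 subrr mulr0.
rewrite !big_ord_recr /=.
set P := \prod_(c < m) _; set Q := \prod_(c < m) _.
have -> : P * Af x m e - Q * Af y m e = (P - Q) * Af x m e + Q * (Af x m e - Af y m e) by ring.
by rewrite IH AB; ring.
Qed.

Let Vf_cvg m : Vf m e @[e --> (0 : C)^'] --> \sum_(c < m) D c%:Z x y.
Proof.
elim: m => [|m IH]; first by rewrite big_ord0; exact: cvg_cst.
rewrite big_ord_recr /= -[X in X + _]mulr1 -[X in _ + X]mul1r.
have H1 : Af x m e @[e --> (0 : C)^'] --> (1 : C).
  by have H := Lip_dcvg (Af_lip x m); rewrite Af0 // in H; exact: H.
have H2 : (\prod_(c < m) Af y c e) @[e --> (0 : C)^'] --> (1 : C).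
  have e1 : \prod_(c < m) Af y c 0 = 1 by apply: big1 => c _; exact: Af0.
  have L : Lip (fun e => \prod_(c < m) Af y c e) 0 by apply: Lip_prod => c; exact: Af_lip.
  by have H := Lip_dcvg L; rewrite e1 in H; exact: H.
exact: (cvgC_add (cvgC_mul IH H1) (cvgC_mul H2 (@cvgC_cst R C (dnbhs (0 : C)) _ _))).
Qed.

Let T (e : C) : C := \prod_(b < n.-1) S b.+1%:Z e.

Lemma sigmaA_prod0_neq0 : T 0 != 0.
Proof.
apply/prodf_neq0 => b _; apply: sigmaA0_neq0 => //.
apply/negP => /dvdz_lt h; have := ltn_ord b; have : Posz b.+1 = 0 by apply: h; have := ltn_ord b; lia.
by [].
Qed.

(* Multiplying S(c,x+e) S(c,x-e) / S(c,x)^2 over c turns S into sigma of the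
   lattice Z + Z eta; compare the terms of order e^2 at x and at y. *)
Lemma sigma_diff_sum_eq kp : kp != 0 -> (forall z, \prod_(b < n) S (Posz b) z = kp * sigma eta (n%:R * z)) ->
  \sum_(c < n) D c%:Z x y = T 0 ^+ 2 / kp ^+ 2 *
   (sigma eta (n%:R * (x + y)) * sigma eta (n%:R * (x - y)) / (sigma eta (n%:R * x) ^+ 2 * sigma eta (n%:R * y) ^+ 2)).
Proof.
move=> kp0 Hkp.
have sx : sigma eta (n%:R * x) != 0.
  have : kp * sigma eta (n%:R * x) != 0 by rewrite -Hkp; apply/prodf_neq0.
  by rewrite mulf_eq0 negb_or => /andP[].
have sy : sigma eta (n%:R * y) != 0.
  have : kp * sigma eta (n%:R * y) != 0 by rewrite -Hkp; apply/prodf_neq0.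
  by rewrite mulf_eq0 negb_or => /andP[].
set Q := _ / (sigma eta (n%:R * x) ^+ 2 * _).
have PA z e : sigma eta (n%:R * z) != 0 -> \prod_(c < n) Af z c e =
   sigma eta (n%:R * z + n%:R * e) * sigma eta (n%:R * z - n%:R * e) / sigma eta (n%:R * z) ^+ 2.
  move=> sz; rewrite /Af big_split /= big_split /= prodfV prodrXl !Hkp mulrDr mulrBr.
  by field; rewrite kp0 sz.
(* The same difference of products is computed twice: by telescoping over the indices, and by the
   three-term relation for the single function sigma. *)
have E1 e : Q * sigma eta (n%:R * e) ^+ 2 = S 0 e ^+ 2 * Vf n e.
  rewrite -VfE !PA //.
  have := sigma_three_term eta0 (n%:R * x) (n%:R * y) (n%:R * e) 0; rewrite !addr0 !subr0 => H.
  have H2 : sigma eta (n%:R * x + n%:R * y) * sigma eta (n%:R * x - n%:R * y) * (sigma eta (n%:R * e) * sigma eta (n%:R * e)) =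
     sigma eta (n%:R * x + n%:R * e) * sigma eta (n%:R * x - n%:R * e) * (sigma eta (n%:R * y) * sigma eta (n%:R * y)) -
     sigma eta (n%:R * x) * sigma eta (n%:R * x) * (sigma eta (n%:R * y + n%:R * e) * sigma eta (n%:R * y - n%:R * e)).
    by apply/eqP; rewrite -subr_eq0; apply/eqP; rewrite -[RHS]H; ring.
  rewrite /Q mulrDr mulrBr mulrAC expr2 H2; field.
  by rewrite sx sy.
have E2 e : kp * sigma eta (n%:R * e) = S 0 e * T e.
  rewrite -Hkp /T; move: (prednK n0) => <-; rewrite big_ord_recl /=.
  by congr (_ * _); apply: eq_bigr => i _.
(* Both sides of [E1] vanish doubly at e = 0; the common factor S 0 e ^+ 2 is divided out on a
   punctured neighbourhood before the limit is taken. *)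
have E3 : \forall e \near (0 : C)^', kp ^+ 2 * Vf n e = Q * T e ^+ 2.
  have := sigmaA0_near_neq0; apply: filterS => e se.
  have s2 : S 0 e ^+ 2 != 0 by rewrite expf_neq0.
  apply: (mulfI s2).
  have -> : S 0 e ^+ 2 * (kp ^+ 2 * Vf n e) = kp ^+ 2 * (S 0 e ^+ 2 * Vf n e) by ring.
  rewrite -E1; have -> : S 0 e ^+ 2 * (Q * T e ^+ 2) = Q * (S 0 e * T e) ^+ 2 by ring.
  by rewrite -E2; ring.
have L1 : (fun e => kp ^+ 2 * Vf n e) @ (0 : C)^' --> kp ^+ 2 * \sum_(c < n) D c%:Z x y.
  exact: (cvgC_mul (@cvgC_cst R C (dnbhs (0 : C)) _ _) (@Vf_cvg n)).
have LT : Lip T 0.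
  by apply: Lip_prod => b; apply: Lip_sigmaA.
have L2 : (fun e => Q * T e ^+ 2) @ (0 : C)^' --> Q * T 0 ^+ 2.
  exact: (cvgC_mul (@cvgC_cst R C (dnbhs (0 : C)) _ _) (cvgC_mul (Lip_dcvg LT) (Lip_dcvg LT))).
have L3 : (fun e => Q * T e ^+ 2) @ (0 : C)^' --> kp ^+ 2 * \sum_(c < n) D c%:Z x y.
  exact: cvgC_eq E3 L1.
have E := dcvg_unique L3 L2.
have kp2 : kp ^+ 2 != 0 by rewrite expf_neq0.
apply: (mulfI kp2); rewrite E; field; exact: kp0.
Qed.

End XY.

Lemma sigma_diff_sum : exists2 k0 : C, k0 != 0 & forall x y, (forall c, S c x != 0) -> (forall c, S c y != 0) ->
  \sum_(c < n) D c%:Z x y = k0 *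
   (sigma eta (n%:R * (x + y)) * sigma eta (n%:R * (x - y)) / (sigma eta (n%:R * x) ^+ 2 * sigma eta (n%:R * y) ^+ 2)).
Proof.
have [kp kp0 Hkp] := sigmaA_prod eta0 n0.
exists ((\prod_(b < n.-1) S b.+1%:Z 0) ^+ 2 / kp ^+ 2).
  by rewrite mulf_neq0 ?invr_eq0 ?expf_neq0 //; exact: sigmaA_prod0_neq0.
by move=> x y Sx Sy; exact: sigma_diff_sum_eq.
Qed.

End DnSum.

(** * Ranks *)

Section MatrixRank.
Variable R : realType.
Local Notation C := (Cx R).

Lemma Lip_sum (I : Type) (s : seq I) (P : pred I) (F : I -> C -> C) x :
  (forall i, Lip (F i) x) -> Lip (fun z => \sum_(i <- s | P i) F i z) x.
Proof.
move=> H; elim: s => [|i s IH].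
  by apply: eq_Lip (Lip_cst 0 x) => z; rewrite big_nil.
case Pi : (P i); last by apply: eq_Lip IH => z; rewrite big_cons Pi.
by apply: eq_Lip (LipD (H i) IH) => z; rewrite big_cons Pi.
Qed.

Definition quadratic_zero (w : C -> C) (x : C) := exists B r : R, [/\ 0 <= B, 0 < r &
  forall z, nm (z - x) <= r -> nm (w z) <= B * nm (z - x) ^+ 2].

Lemma quadratic_zeroM u v x : Lip u x -> Lip v x -> u x = 0 -> v x = 0 -> quadratic_zero (fun z => u z * v z) x.
Proof.
move=> [L [r [L0 r0 H]]] [L' [r' [L0' r0' H']]] ux vx.
exists (L * L'), (Num.min r r'); split; rewrite ?mulr_ge0 ?lt_min ?r0 //.
move=> z; rewrite le_min => /andP[h h'].
have := H z h; have := H' z h'; rewrite ux vx !subr0 => k' k.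
rewrite nmM; apply: le_trans (ler_pM (nm_ge0 _) (nm_ge0 _) k k') _.
by rewrite mulrACA -expr2.
Qed.

Lemma quadratic_zero_sum (I : Type) (s : seq I) (F : I -> C -> C) x :
  (forall i, quadratic_zero (F i) x) -> quadratic_zero (fun z => \sum_(i <- s) F i z) x.
Proof.
move=> H; elim: s => [|i s [B [r [B0 r0 IH]]]].
  by exists 0, 1; split=> // z _; rewrite big_nil nm0 mul0r.
have [B' [r' [B0' r0' H']]] := H i.
exists (B' + B), (Num.min r' r); split; rewrite ?addr_ge0 ?lt_min ?r0' //.
move=> z; rewrite le_min => /andP[h' h]; rewrite big_cons mulrDl.
by apply: le_trans (nmD _ _) _; apply: lerD; [exact: H'|exact: IH].
Qed.

(* If u kills [Rf x] on the left and v is killed by [Rg x] on the right, then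
   c(z) u v = (u Rf(z)) (Rg(z) v) is O(|z - x|^2) while |c(z)| is at least of
   order |z - x|; hence u v = 0. *)
Lemma rank_sum_ge N (Rf Rg : C -> 'M[C]_N) (c : C -> C) (x : C) (d r : R) :
  (forall p q, Lip (fun z => Rf z p q) x) -> (forall p q, Lip (fun z => Rg z p q) x) ->
  0 < d -> 0 < r ->
  (forall z, nm (z - x) <= r -> Rf z *m Rg z = (c z)%:M /\ d * nm (z - x) <= nm (c z)) ->
  (N <= \rank (Rf x) + \rank (Rg x))%N.
Proof.
move=> Lf Lg d0 r0 H.
pose K := kermx (Rf x); pose Q := cokermx (Rg x).
have X0 : K *m Q = 0.
  apply/matrixP => p q; rewrite [RHS]mxE; apply/eqP; rewrite -nm_eq0; apply/eqP.
  pose u l z := (K *m Rf z) p l; pose v l z := (Rg z *m Q) l q.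
  have Lu l : Lip (u l) x.
    rewrite /u; apply: (@eq_Lip _ (fun z => \sum_m K p m * Rf z m l)) => [z|].
      by rewrite mxE.
    by apply: Lip_sum => m; apply: LipM => //; exact: Lip_cst.
  have Lv l : Lip (v l) x.
    rewrite /v; apply: (@eq_Lip _ (fun z => \sum_m Rg z l m * Q m q)) => [z|].
      by rewrite mxE.
    by apply: Lip_sum => m; apply: LipM => //; exact: Lip_cst.
  have u0 l : u l x = 0 by rewrite /u mulmx_ker mxE.
  have v0 l : v l x = 0 by rewrite /v mulmx_coker mxE.
  have : quadratic_zero (fun z => \sum_l u l z * v l z) x.
    by apply: quadratic_zero_sum => l; exact: quadratic_zeroM.
  move=> [B [s [B0 s0 HB]]].
  set t := nm _; have t0 : 0 <= t by exact: nm_ge0.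
  have key (e : R) : 0 < e -> e <= r -> e <= s -> d * t <= B * e.
    move=> e0 er es; pose z : C := x + e%:C%C.
    have zx : z - x = e%:C%C by rewrite /z addrC addKr.
    have ne : nm (z - x) = e by rewrite zx nm_real ger0_norm // ltW.
    have [E1 E2] : Rf z *m Rg z = (c z)%:M /\ d * nm (z - x) <= nm (c z) by apply: H; rewrite ne.
    have E3 : c z * (K *m Q) p q = \sum_l u l z * v l z.
      have -> : \sum_l u l z * v l z = ((K *m Rf z) *m (Rg z *m Q)) p q by rewrite mxE.
      have -> : (K *m Rf z) *m (Rg z *m Q) = K *m (Rf z *m Rg z) *m Q by rewrite !mulmxA.
      by rewrite E1 mul_mx_scalar -scalemxAl [RHS]mxE.
    have := HB z; rewrite ne -E3 nmM -/t => /(_ es) h.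
    rewrite ne in E2.
    rewrite -(ler_pM2r e0) -mulrA [B * e * e]mulrAC -mulrA -expr2 (mulrC t).
    rewrite mulrA; apply: le_trans h; exact: ler_wpM2r.
  apply/eqP; rewrite eq_le t0 andbT; apply/ler_addgt0Pr => e e0; rewrite add0r.
  pose e' := Num.min (Num.min r s) (d * e / (B + 1)).
  have e'0 : 0 < e' by rewrite !lt_min r0 s0 divr_gt0 ?mulr_gt0 // ltr_wpDl.
  have h1 : e' <= r by rewrite /e' !ge_min lexx.
  have h2 : e' <= s by rewrite /e' !ge_min lexx orbT.
  have h3 : e' <= d * e / (B + 1) by rewrite /e' ge_min lexx orbT.
  rewrite ler_pdivlMr ?ltr_wpDl // in h3.
  have := key e' e'0 h1 h2 => h4.
  rewrite -(ler_pM2l d0); apply: le_trans h4 _; apply: le_trans h3.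
  by rewrite mulrC ler_wpM2l ?(ltW e'0) // lerDl.
have : (K <= Rg x)%MS by rewrite submxE X0 eqxx.
move/mxrankS; rewrite mxrank_ker leq_subLR.
by [].
Qed.

Lemma det_cvg T (F : set_system T) {FF : Filter F} m (f : T -> 'M[C]_m) (M : 'M[C]_m) :
  (forall p q, (fun x => f x p q) @ F --> M p q) -> (fun x => \det (f x)) @ F --> \det M.
Proof.
move=> H; rewrite /determinant.
apply: cvgC_sum => s _.
have Hp : (fun x => \prod_i f x i (s i)) @ F --> \prod_i M i (s i).
  by apply: cvgC_prod => i _; exact: H.
exact: (cvgC_mul (@cvgC_cst R T F _ _) Hp).
Qed.

(** One-sided inverses of the factors of a full-rank factorisation give P M Q = 1. The determinant
    of P f(x) Q tends to 1, so this square matrix of size rank M is eventually invertible. *)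
Lemma rank_lsc T (F : set_system T) {FF : ProperFilter F} m (f : T -> 'M[C]_m) (M : 'M[C]_m) :
  (forall p q, (fun x => f x p q) @ F --> M p q) -> \forall x \near F, (\rank M <= \rank (f x))%N.
Proof.
move=> H; pose P := pinvmx (col_base M); pose Q := pinvmx (row_base M).
have E : P *m M *m Q = 1%:M.
  transitivity (P *m (col_base M *m row_base M) *m Q); first by rewrite mulmx_base.
  rewrite mulmxA /P mulVpmx ?col_base_full // mul1mx.
  by rewrite mulmxVp // row_base_free.
have Hc p q : (fun x => (P *m f x *m Q) p q) @ F --> (P *m M *m Q) p q.
  have -> : (fun x => (P *m f x *m Q) p q) = (fun x => \sum_l (\sum_l' P p l' * f x l' l) * Q l q).
    by apply/funext => x; rewrite mxE; apply: eq_bigr => l _; rewrite mxE.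
  have -> : (P *m M *m Q) p q = \sum_l (\sum_l' P p l' * M l' l) * Q l q.
    by rewrite mxE; apply: eq_bigr => l _; rewrite mxE.
  apply: cvgC_sum => l _.
  have Hs : (fun x => \sum_l' P p l' * f x l' l) @ F --> \sum_l' P p l' * M l' l.
    by apply: cvgC_sum => l' _; exact: (cvgC_mul (@cvgC_cst R T F _ _) (H l' l)).
  exact: (cvgC_mul Hs (@cvgC_cst R T F _ _)).
have D : (fun x => \det (P *m f x *m Q)) @ F --> (1 : C).
  by rewrite -(det1 C (\rank M)) -E; exact: det_cvg Hc.
move/cvg_nmP: D => /(_ (1 / 2)); rewrite divr_gt0 // => /(_ isT).
apply: filterS => x h.
have dn : \det (P *m f x *m Q) != 0.
  by apply/eqP => d0; move: h; rewrite d0 sub0r nmN nm1; lra.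
have : (P *m f x *m Q) \in unitmx by rewrite unitmxE unitfE.
rewrite -row_full_unit => /eqP <-.
by apply: leq_trans (mxrankM_maxl _ _) _; exact: mxrankM_maxr.
Qed.

End MatrixRank.

Lemma leq_add_eqR (a b c d : nat) : (a <= b)%N -> (c <= d)%N -> (b + d = a + c)%N -> b = a.
Proof. lia. Qed.

(** * Rank sum and local constancy at generic points *)

Section Generic.
Variable R : realType.
Local Notation C := (Cx R).
Variable eta : C.
Hypothesis eta0 : 0 < Imc eta.
Variables n k : nat.
Hypothesis n0 : (0 < n)%N.
Hypothesis nk : coprime n k.
Local Notation S := (sigmaA eta n).
Local Notation K := (Rscale eta n).
Local Notation sge := (sigma eta).
Variable kt : C.
Hypothesis kt0 : kt != 0.
Hypothesis Hkt : forall (a : int) x,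
  thetaA n eta a x = kt * ee (n%:R * x / 2 + a%:~R / (2 * n%:R)) * S a x.

Let nn : (n%:R : C) != 0. Proof. by rewrite pnatr_eq0 -lt0n. Qed.

Lemma sigmaA_all_neq0 x : sge (n%:R * x) != 0 -> forall a, S a x != 0.
Proof.
have [kp kp0 Hkp] := sigmaA_prod eta0 n0.
move=> sx a; have : kp * sge (n%:R * x) != 0 by rewrite mulf_neq0.
rewrite -Hkp => /prodf_neq0 H.
have n10 : (-1 : C) != 0 by rewrite oppr_eq0 oner_eq0.
have lt : (`|(a %% n%:Z)%Z|%N < n)%N.
  by rewrite -ltz_nat gez0_abs ?modz_ge0 ?ltz_pmod ?ltz_nat // eqz_nat -lt0n.
have := H (Ordinal lt) isT; rewrite /= gez0_abs ?modz_ge0 ?eqz_nat -?lt0n // => h.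
rewrite (divz_eq a n) addrC sigmaA_addMn // mulf_neq0 //.
exact: expfz_neq0.
Qed.

Lemma Lip_thetaA (a : int) x : Lip (thetaA n eta a) x.
Proof.
apply: (@eq_Lip _ (fun x => kt * ee (n%:R * x / 2 + a%:~R / (2 * n%:R)) * S a x)) => [y|].
  by rewrite Hkt.
apply: LipM; last exact: Lip_sigmaA.
apply: LipM; first exact: Lip_cst.
apply: (@Lip_comp _ (@ee R)); last exact: Lip_ee.
by apply: (eq_Lip _ (Lip_affine (n%:R / 2) (a%:~R / (2 * n%:R)) x)) => y; rewrite mulrAC.
Qed.

Lemma Lip_Rscale x : Lip K x.
Proof.
apply: LipM; last exact: Lip_cst.
apply: Lip_prod => i; apply: (@Lip_comp _ (thetaA n eta i%:Z)); last exact: Lip_thetaA.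
by apply: LipN; exact: Lip_id.
Qed.

Lemma Lip_Rmat (f g : C -> C) t p q : Lip f t -> Lip g t ->
  (forall a, S a (- f t) != 0) -> (forall b, S b (g t) != 0) ->
  Lip (fun t => Rmat n k eta (g t) (f t) p q) t.
Proof.
move=> Lf Lg Sf Sg.
pose i := Posz (enum_val p).1; pose j := Posz (enum_val p).2.
pose a := Posz (enum_val q).1; pose b := Posz (enum_val q).2.
case E : (n%:Z %| i + j - (a + b))%Z; last first.
  by apply: (eq_Lip _ (Lip_cst 0 t)) => u; rewrite (Rmat_entry eta0 n0 nk kt0 Hkt) /= E.
apply: (@eq_Lip _ (fun u => K (f u) / kt * Rweight eta n (g u) (f u) (a - i) (k%:Z * (j - a)))) => [u|].
  by rewrite (Rmat_entry eta0 n0 nk kt0 Hkt) /= E.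
have LS c (h : C -> C) : Lip h t -> Lip (fun t => S c (h t)) t.
  by move=> Lh; apply: (@Lip_comp _ (S c)) => //; exact: Lip_sigmaA.
apply: LipM.
  apply: LipM; last exact: Lip_cst.
  by apply: (@Lip_comp _ K) => //; exact: Lip_Rscale.
rewrite /Rweight; apply: LipM.
  by apply: LS; apply: LipD => //; exact: LipN.
apply: LipV; first by rewrite mulf_neq0.
by apply: LipM; apply: LS => //; exact: LipN.
Qed.

Lemma thetaA_neq0 (a : int) x : S a x != 0 -> thetaA n eta a x != 0.
Proof.
move=> Sx; rewrite Hkt; apply: mulf_neq0 => //; apply: mulf_neq0 => //; exact: ee_neq0.
Qed.

Lemma Rscale_neq0 z : (forall a, S a (- z) != 0) -> K z != 0.
Proof.
move=> Sz; rewrite mulf_neq0 // ?invr_eq0.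
  by apply/prodf_neq0 => i _; exact: thetaA_neq0.
apply/prodf_neq0 => i i0; apply: thetaA_neq0; apply: sigmaA0_neq0 => //.
apply/negP => /dvdz_lt h; have h1 := ltn_ord i.
have : Posz i = 0 by apply: h; rewrite ger0_norm.
by move=> -[i00]; rewrite i00 in i0.
Qed.

(* 2 tau and tau are not in (1/n) Lambda. *)
Definition generic_pt (tau : C) : Prop := sge (n%:R * (tau + tau)) != 0 /\ sge (n%:R * tau) != 0.

Lemma generic_pt_near tau : generic_pt tau -> \forall t \near tau, generic_pt t.
Proof.
move=> [d1 d2].
have L1 : Lip (fun t => sge (n%:R * (t + t))) tau.
  apply: (@Lip_comp _ sge); last exact: Lip_sigma.
  by apply: (eq_Lip _ (Lip_affine (2 * n%:R) 0 tau)) => t; ring.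
have L2 : Lip (fun t => sge (n%:R * t)) tau.
  apply: (@Lip_comp _ sge); last exact: Lip_sigma.
  by apply: (eq_Lip _ (Lip_affine n%:R 0 tau)) => t; ring.
have [r r0 Hr] := Lip_lower (f := fun t => sge (n%:R * (t + t)) * sge (n%:R * t))
  (mulf_neq0 d1 d2) (LipM L1 L2).
have := nbhs_nm tau r0; apply: filterS => t /Hr h.
have : sge (n%:R * (t + t)) * sge (n%:R * t) != 0.
  by rewrite -nm_gt0; apply: lt_le_trans h; rewrite divr_gt0 // nm_gt0 mulf_neq0.
by rewrite mulf_eq0 negb_or => /andP[].
Qed.

Lemma generic_pt_inLat tau : ~ inLat eta (2 * n) tau -> generic_pt tau.
Proof.
move=> H; split; apply/eqP => /(sigma_root eta0)[a [b E]]; apply: H.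
  exists a, b; rewrite -E natrM; field; exact: nn.
exists (2 * a), (2 * b); rewrite !rmorphM /=.
have -> : 2 * a%:~R + 2 * b%:~R * eta = 2 * (a%:~R + b%:~R * eta) :> C by ring.
by rewrite -E natrM; field; exact: nn.
Qed.

Lemma sigma_scaled_opp x : sge (n%:R * - x) = - sge (n%:R * x).
Proof. by rewrite mulrN sigma_opp. Qed.

Lemma rank_sum tau : generic_pt tau ->
  (\rank (Rmat n k eta tau tau) + \rank (Rmat n k eta tau (- tau)))%N = NN n.
Proof.
move=> [d1 d2].
have St := sigmaA_all_neq0 d2.
have dm : sge (n%:R * - tau) != 0 by rewrite sigma_scaled_opp oppr_eq0.
have Sm := sigmaA_all_neq0 dm.
have [k0 k00 Hk0] := sigma_diff_sum eta0 n0.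
(* The last factor carries the zero at z = tau. The cofactor contains sge(n (tau + z)), which is
   nonzero at z = tau by the first half of [generic_pt]. *)
have ucE z : sge (n%:R * - z) != 0 -> unitarity_factor eta n kt tau z =
   (- (K z / kt * (K (- z) / kt)) * k0 * sge (n%:R * (tau + z)) /
    (sge (n%:R * tau) ^+ 2 * sge (n%:R * - z) ^+ 2)) * sge (n%:R * (tau - z)).
  by move=> /sigmaA_all_neq0 Sz; rewrite /unitarity_factor Hk0 // opprK; ring.
apply/eqP; rewrite eqn_leq; apply/andP; split.
  apply: mulmx0_rank_max; rewrite (Rmat_mul eta0 n0 nk kt0 Hkt) // ucE //.
  by rewrite subrr mulr0 sigma0 // mulr0 raddf0.
pose h z := - (K z / kt * (K (- z) / kt)) * k0 * sge (n%:R * (tau + z)) /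
    (sge (n%:R * tau) ^+ 2 * sge (n%:R * - z) ^+ 2).
have Lsg (a b : C) : Lip (fun z => sge (n%:R * (a * z + b))) tau.
  apply: (@Lip_comp _ sge); last exact: Lip_sigma.
  by apply: LipM; [exact: Lip_cst|exact: Lip_affine].
have L1 : Lip (fun z => sge (n%:R * - z)) tau.
  by apply: (eq_Lip _ (Lsg (-1) 0)) => z; rewrite mulN1r addr0.
have Lh : Lip h tau.
  apply: LipM; last first.
    apply: LipV; first by rewrite mulf_neq0 ?expf_neq0.
    apply: LipM; first exact: Lip_cst.
    by apply: (eq_Lip _ (LipM L1 L1)) => z; rewrite expr2.
  apply: LipM; last by apply: (eq_Lip _ (Lsg 1 tau)) => z; rewrite mul1r addrC.
  apply: LipM; last exact: Lip_cst.
  have LK : Lip (fun z => K (- z)) tau.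
    by apply: (@Lip_comp _ K); [apply: LipN; exact: Lip_id|exact: Lip_Rscale].
  exact: (LipN (LipM (LipM (Lip_Rscale tau) (Lip_cst _ _)) (LipM LK (Lip_cst _ _)))).
have h0 : h tau != 0.
  apply: mulf_neq0; last by rewrite invr_eq0 mulf_neq0 ?expf_neq0.
  apply: mulf_neq0 => //; apply: mulf_neq0 => //; rewrite oppr_eq0.
  apply: mulf_neq0; apply: mulf_neq0; rewrite ?invr_eq0 //; first exact: Rscale_neq0.
  by apply: Rscale_neq0 => a; rewrite opprK.
have [r1 r10 H1] := Lip_lower h0 Lh.
have [r2 r20 H2] := Lip_lower (f := fun z => sge (n%:R * - z)) dm L1.
have [c [L [r3 [c0 L0 r30 H3]]]] := sigma_bounds eta0.
have N0 : 0 < nm (n%:R : C) by rewrite nm_gt0.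
pose r := Num.min r1 (Num.min r2 (r3 / nm (n%:R : C))).
have r0 : 0 < r by rewrite !lt_min r10 r20 divr_gt0.
have d0 : 0 < nm (h tau) / 2 * (c * nm (n%:R : C)) by rewrite !mulr_gt0 ?invr_gt0 // nm_gt0.
have := @rank_sum_ge R (NN n) (fun z => Rmat n k eta tau z) (fun z => Rmat n k eta tau (- z))
  (unitarity_factor eta n kt tau) tau _ r _ _ d0 r0.
apply.
- move=> p q; apply: (@Lip_Rmat id (fun=> tau)) => //; first exact: Lip_id.
  exact: Lip_cst.
- move=> p q; apply: (@Lip_Rmat (fun z => - z) (fun=> tau)) => //.
  + by apply: LipN; exact: Lip_id.
  + exact: Lip_cst.
  + by move=> a; rewrite opprK.
move=> z; rewrite !le_min => /and3P[z1 z2 z3].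
have sz : sge (n%:R * - z) != 0.
  by rewrite -nm_gt0; apply: lt_le_trans (H2 z z2); rewrite divr_gt0 // nm_gt0.
split; first by apply: (Rmat_mul eta0 n0 nk kt0 Hkt) => //; exact: sigmaA_all_neq0.
rewrite ucE // -/(h z) (nmM (h z)) -[leLHS]mulrA.
apply: ler_pM; rewrite ?divr_ge0 ?mulr_ge0 ?nm_ge0 ?(ltW c0) //.
  exact: H1.
have e : nm (n%:R * (tau - z)) = nm (n%:R : C) * nm (z - tau) by rewrite nmM nmBC.
have := H3 (n%:R * (tau - z)); rewrite e -mulrA.
by rewrite ler_pdivlMr // mulrC in z3 => /(_ z3)/andP[].
Qed.

Lemma rank_locally_constant tau : generic_pt tau ->
  \forall t \near tau, \rank (Rmat n k eta t t) = \rank (Rmat n k eta tau tau).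
Proof.
move=> dt; have [d1 d2] := dt.
have St := sigmaA_all_neq0 d2.
have Sm : forall a, S a (- tau) != 0 by apply: sigmaA_all_neq0; rewrite sigma_scaled_opp oppr_eq0.
have A : \forall t \near tau, (\rank (Rmat n k eta tau tau) <= \rank (Rmat n k eta t t))%N.
  apply: (@rank_lsc R C (nbhs tau) _ _ (fun t => Rmat n k eta t t)) => p q.
  by apply: Lip_cvg; apply: (@Lip_Rmat id id) => //; exact: Lip_id.
have B : \forall t \near tau, (\rank (Rmat n k eta tau (- tau)) <= \rank (Rmat n k eta t (- t)))%N.
  apply: (@rank_lsc R C (nbhs tau) _ _ (fun t => Rmat n k eta t (- t))) => p q.
  apply: Lip_cvg; apply: (@Lip_Rmat (fun z => - z) id) => //.
  - by apply: LipN; exact: Lip_id.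
  - exact: Lip_id.
  - by move=> a; rewrite opprK.
have := generic_pt_near dt; move: A B; apply: filterS3 => t a b /rank_sum e.
have e' := rank_sum dt.
by apply: (leq_add_eqR a b); rewrite e e'.
Qed.

End Generic.

(** Connectedness of the line: seen as a real function, f has derivative 0 everywhere. *)
Lemma locally_constant_nat (R : realType) (f : R -> nat) :
  (forall x, \forall y \near x, f y = f x) -> forall x y, f x = f y.
Proof.
move=> H x y; apply/eqP; rewrite -(eqr_nat R); apply/eqP.
apply: (@is_derive_0_is_cst R (fun x => (f x)%:R)) => z.
have D : is_derive z (1 : R) (cst ((f z)%:R : R)) 0 by exact: is_derive_cst.
have E : \forall u \near z, cst ((f z)%:R : R) u = (f u)%:R.
  by have := H z; apply: filterS => u ->.
exact: (near_eq_is_derive E D).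
Qed.

(** * Connecting points in the complement of a lattice *)

Section Path.
Variable R : realType.
Local Notation C := (Cx R).
Variable eta : C.
Hypothesis eta0 : 0 < Imc eta.
Variable n : nat.
Hypothesis n0 : (0 < n)%N.

Let nn : (n%:R : C) != 0. Proof. by rewrite pnatr_eq0 -lt0n. Qed.

(* Real coordinates (a, b) with respect to the lattice (1/n) Lambda. *)
Definition lat_pt (a b : R) : C := (a%:C%C + b%:C%C * eta) / n%:R.

Lemma Im_real (a : R) : Imc (a%:C%C : C) = 0.
Proof. by []. Qed.

Lemma lat_pt_surj z : exists a b : R, z = lat_pt a b.
Proof.
pose w := n%:R * z; exists (complex.Re (w - (Imc w / Imc eta)%:C%C * eta)), (Imc w / Imc eta).
have -> : z = w / n%:R by rewrite /w mulrC mulKf.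
rewrite /lat_pt; congr (_ / _); rewrite -[LHS](subrK ((Imc w / Imc eta)%:C%C * eta)).
congr (_ + _); set v := w - _.
have : Imc v = 0 by rewrite /v ImcD ImcN Imc_realM divfK ?subrr // gt_eqF.
by case: v => x y /= ->.
Qed.

Lemma lat_pt_inLat a b : inLat eta n (lat_pt a b) -> (exists m : int, a = m%:~R) /\ (exists m : int, b = m%:~R).
Proof.
move=> [p [m E]].
have {}E : a%:C%C + b%:C%C * eta = p%:~R + m%:~R * eta :> C.
  by move/(congr1 (fun z => z * n%:R)): E; rewrite !divfK.
have bE : b = m%:~R.
  have := congr1 (@Imc R) E; rewrite !ImcD Im_real Imc_int Imc_realM Imc_intM !add0r.
  by move/(mulIf (lt0r_neq0 eta0)).
split; [exists p|by exists m].
move: E; rewrite bE; have -> : ((m%:~R : R)%:C)%C = m%:~R :> C by rewrite rmorph_int.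
move/addIr; have -> : (p%:~R : C) = ((p%:~R : R)%:C)%C by rewrite rmorph_int.
exact: complexI.
Qed.

(* On a line where one coordinate is a fixed non-integer, no lattice point is
   met; two such lines connect any point to (1/2, 1/2). *)
Lemma path_const (rho : C -> nat) :
  (forall t, ~ inLat eta n t -> \forall u \near t, rho u = rho t) ->
  forall t t', ~ inLat eta n t -> ~ inLat eta n t' -> rho t = rho t'.
Proof.
move=> H.
have N0 : 0 < nm (n%:R : C) by rewrite nm_gt0.
have hor b : ~ (exists m : int, b = m%:~R) -> forall a a', rho (lat_pt a b) = rho (lat_pt a' b).
  move=> nb; apply: locally_constant_nat => a.
  have nl : ~ inLat eta n (lat_pt a b) by move=> /lat_pt_inLat[_ /nb].
  have [r r0 Hr] := nbhs_nmP (H _ nl).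
  have := @nbhsx_ballx R R a (r * nm (n%:R : C)) (mulr_gt0 r0 N0).
  apply: filterS => a' ha; apply: Hr.
  have -> : lat_pt a' b - lat_pt a b = ((a' - a)%:C)%C / n%:R by rewrite /lat_pt rmorphB /=; field.
  rewrite nmM nmV ler_pdivrMr // nm_real; apply: ltW.
  by move: ha; rewrite /ball /= distrC.
have ver a : ~ (exists m : int, a = m%:~R) -> forall b b', rho (lat_pt a b) = rho (lat_pt a b').
  move=> na; apply: locally_constant_nat => b.
  have nl : ~ inLat eta n (lat_pt a b) by move=> /lat_pt_inLat[/na].
  have [r r0 Hr] := nbhs_nmP (H _ nl).
  have e1 : 0 < r * nm (n%:R : C) / (nm eta + 1).
    by rewrite divr_gt0 ?mulr_gt0 // ltr_wpDl ?nm_ge0.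
  have := @nbhsx_ballx R R b _ e1.
  apply: filterS => b' hb; apply: Hr.
  have -> : lat_pt a b' - lat_pt a b = ((b' - b)%:C)%C * eta / n%:R by rewrite /lat_pt rmorphB /=; field.
  rewrite nmM nmV ler_pdivrMr // nmM nm_real; apply: ltW.
  have hb' : `|b' - b| < r * nm (n%:R : C) / (nm eta + 1) by move: hb; rewrite /ball /= distrC.
  rewrite ltr_pdivlMr ?ltr_wpDl ?nm_ge0 // in hb'; apply: le_lt_trans hb'.
  by rewrite ler_wpM2l // lerDl.
have half : ~ exists m : int, (1 / 2 : R) = m%:~R.
  move=> [m Hm]; have : 1 = (m * 2)%:~R :> R by rewrite rmorphM /= -Hm mulfVK.
  by move/eqP; rewrite -[1]/(1%:~R) eqr_int => /eqP; lia.
have key t : ~ inLat eta n t -> rho t = rho (lat_pt (1 / 2) (1 / 2)).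
  have [a [b ->]] := lat_pt_surj t => nl.
  have [ha|ha] := pselect (exists m : int, a = m%:~R); last first.
    by rewrite (ver _ ha _ (1 / 2)); exact: hor.
  have [hb|hb] := pselect (exists m : int, b = m%:~R); last first.
    by rewrite (hor _ hb _ (1 / 2)); exact: ver.
  case: nl; case: ha => x ->; case: hb => y ->; exists x, y.
  by rewrite /lat_pt !rmorph_int.
by move=> t t' /key -> /key ->.
Qed.

Lemma near0_nonlattice (P : C -> Prop) : (\forall t \near (0 : C)^', P t) ->
  exists t, ~ inLat eta n t /\ P t.
Proof.
rewrite /dnbhs near_withinE => /nbhs_nmP[r r0 Hr].
(* The bound 1/2 keeps the coordinate e strictly between 0 and 1, hence off the lattice; the other
   bound puts the point (e, e) within distance r of 0. *)
pose e := Num.min (1 / 2) (r / (1 + nm eta)).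
have p1 : 0 < 1 + nm eta by rewrite ltr_pwDl ?nm_ge0.
have e0 : 0 < e by rewrite lt_min; apply/andP; split; exact: divr_gt0.
have e1 : e <= 1 / 2 by rewrite /e ge_min lexx.
have e2 : e <= r / (1 + nm eta) by rewrite /e ge_min lexx orbT.
have ne : ~ exists m : int, e = m%:~R.
  move=> [m Hm]; have h1 : (0 : R) < m%:~R by rewrite -Hm.
  have h2 : m%:~R < (1 : R) by rewrite -Hm; lra.
  rewrite ltr0z in h1; have : m%:~R < 1%:~R :> R by [].
  rewrite ltr_int; lia.
have nl : ~ inLat eta n (lat_pt e e) by move=> /lat_pt_inLat[/ne].
exists (lat_pt e e); split=> //.
apply: Hr; last first.
  by apply/eqP => z0; apply: nl; rewrite z0; exists 0, 0; rewrite mul0r addr0 mul0r.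
have n1 : 1 <= nm (n%:R : C) by rewrite nm_nat ler1n.
rewrite subr0 /lat_pt nmM nmV ler_pdivrMr; last by apply: lt_le_trans n1.
apply: (@le_trans _ _ r); last by apply: ler_peMr => //; exact: ltW.
have -> : e%:C%C + e%:C%C * eta = e%:C%C * (1 + eta) by ring.
rewrite nmM nm_real gtr0_norm //.
have h : nm (1 + eta) <= 1 + nm eta by rewrite -[X in _ <= X + _]nm1; exact: nmD.
apply: le_trans (ler_wpM2l (ltW e0) h) _.
by rewrite ler_pdivlMr ?ltr_pwDl ?nm_ge0 // in e2.
Qed.

End Path.

(* Full-rank factorisation E = C R gives R C = 1, so the trace counts the rank. *)
Lemma rank_idem (F : fieldType) N (E : 'M[F]_N) : E *m E = E -> (\rank E)%:R = \tr E.
Proof.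
move=> EE; have RC : row_base E *m col_base E = 1%:M.
  have := mulVpmx (col_base_full E); have := mulmxVp (row_base_free E).
  have := mulmx_base E.
  move: (row_base E) (col_base E) (pinvmx (row_base E)) (pinvmx (col_base E)).
  move=> r c Pr Pc cr rP Pc1.
  have H : Pc *m ((c *m r) *m (c *m r)) *m Pr = Pc *m (c *m r) *m Pr by rewrite cr EE.
  by move: H; rewrite !mulmxA Pc1 !mul1mx rP -!mulmxA rP !mulmx1.
have trE : \tr (col_base E *m row_base E) = \tr E by rewrite mulmx_base.
by rewrite -trE mxtrace_mulC RC mxtrace1.
Qed.

(** The matrix (1 + s D)/2 is idempotent, so its rank is its trace. *)
Lemma rank_involution (F : numFieldType) N (D : 'M[F]_N) (s : F) : s ^+ 2 = 1 -> D *m D = 1%:M ->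
  (\rank (1%:M + s *: D)%R)%:R = (N%:R + s * \tr D) / 2.
Proof.
move=> s2 DD; have two0 : (2 : F) != 0 by rewrite pnatr_eq0.
pose X : 'M[F]_N := 1%:M + s *: D; pose E : 'M[F]_N := 2^-1 *: X.
have EE : E *m E = E.
  have sDD : (s *: D) *m (s *: D) = 1%:M.
    by rewrite -scalemxAl -scalemxAr scalerA DD -expr2 s2 scale1r.
  rewrite /E -scalemxAl -scalemxAr scalerA /X mulmxDl mul1mx mulmxDr mulmx1 sDD.
  rewrite [s *: D + _]addrC -mulr2n -[(_ + _) *+ 2]scaler_nat scalerA; congr (_ *: _).
  by field.
rewrite -/X; have -> : \rank X = \rank E.
  by rewrite /E [RHS]mxrank_scale_nz // invr_eq0.
by rewrite rank_idem // /E mxtraceZ /X mxtraceD mxtraceZ mxtrace1 mulrC.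
Qed.

(** * Monomial matrices on pairs of residues *)

Section Pairs.
Variable F : numFieldType.
Variable n : nat.
Hypothesis n0 : (0 < n)%N.
Local Notation I2 := ('I_n * 'I_n)%type.

Definition monomial_mx (s : I2 -> I2) (u : I2 -> F) : 'M[F]_(NN n) :=
  \matrix_(p, q) if enum_val q == s (enum_val p) then u (enum_val p) else 0.

Lemma monomial_mxM s u s' u' : monomial_mx s u *m monomial_mx s' u' = monomial_mx (s' \o s) (fun x => u x * u' (s x)).
Proof.
apply/matrixP => p q; rewrite !mxE /=.
rewrite (bigD1 (enum_rank (s (enum_val p)))) //= !mxE enum_rankK eqxx big1 ?addr0.
  by case: ifP => // _; rewrite mulr0.
move=> m mp; rewrite !mxE; case: ifP => [/eqP e|_]; last by rewrite mul0r.
by case/eqP: mp; rewrite -e enum_valK.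
Qed.

Lemma monomial_mx1 s u : (forall x, s x = x) -> (forall x, u x = 1) -> monomial_mx s u = 1%:M.
Proof.
move=> sx ux; apply/matrixP => p q; rewrite !mxE sx ux (inj_eq enum_val_inj) eq_sym.
by case: ifP.
Qed.

Lemma monomial_mx_tr s u : \tr (monomial_mx s u) = \sum_(c < n) \sum_(d < n) (if (c, d) == s (c, d) then u (c, d) else 0).
Proof.
rewrite /mxtrace -(sum_NN (fun x => if x == s x then u x else 0)).
by apply: eq_bigr => p _; rewrite mxE.
Qed.

Definition swap_mx : 'M[F]_(NN n) := monomial_mx (fun x => (x.2, x.1)) (fun=> 1).

Lemma swap_mx_mul : swap_mx *m swap_mx = 1%:M.
Proof. by rewrite monomial_mxM monomial_mx1 // => -[i j] //=; rewrite mulr1. Qed.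

Lemma swap_mx_tr : \tr swap_mx = n%:R.
Proof.
rewrite monomial_mx_tr (eq_bigr (fun=> 1)); first by rewrite sumr_const card_ord.
move=> c _; rewrite (bigD1 c) //= eqxx big1 ?addr0 // => d dc.
by rewrite ifF //; apply/negbTE; apply: contra dc => /eqP[_ ->].
Qed.

Lemma cyc_shift_lt (c : int) (x : 'I_n) : (`|((Posz x + c) %% n%:Z)%Z|%N < n)%N.
Proof.
by rewrite -ltz_nat gez0_abs ?modz_ge0 ?ltz_pmod ?ltz_nat // eqz_nat -lt0n.
Qed.

(* Not addition in ['Z_n], whose carrier is wrong for n = 1. *)
Definition cyc_shift (c : int) (x : 'I_n) : 'I_n := Ordinal (cyc_shift_lt c x).

Lemma cyc_shiftP c (x d : 'I_n) : (n%:Z %| Posz x + c - Posz d)%Z = (d == cyc_shift c x).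
Proof.
have nz : n%:Z != 0 by rewrite eqz_nat -lt0n.
rewrite -eqz_mod_dvd -val_eqE /= -eqz_nat gez0_abs ?modz_ge0 //.
by rewrite (modz_small (m := Posz d)) ?ltz_nat ?ltn_ord // eq_sym.
Qed.

Lemma cyc_shift_ex c (x : 'I_n) : exists m : int, Posz (cyc_shift c x) = Posz x + c - m * n%:Z.
Proof.
have := cyc_shiftP c x (cyc_shift c x); rewrite eqxx => /dvdzP[m Hm]; exists m.
by rewrite -Hm opprB addrC subrK.
Qed.

Lemma cyc_shiftK c (x : 'I_n) : cyc_shift (- c) (cyc_shift c x) = x.
Proof.
have [m Hm] := cyc_shift_ex c x.
apply/esym/eqP; rewrite -cyc_shiftP Hm; apply/dvdzP; exists (- m); rewrite mulNr; ring.
Qed.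

Lemma cyc_shiftNK c (x : 'I_n) : cyc_shift c (cyc_shift (- c) x) = x.
Proof. by have := cyc_shiftK (- c) x; rewrite opprK. Qed.

Variables (k : nat) (w : F) (B : int).
Hypothesis wn : w ^+ n = 1.

Let w0 : w != 0.
Proof. by apply/eqP => w0; move/eqP: wn; rewrite w0 expr0n gtn_eqF // eq_sym oner_eq0. Qed.

Lemma expz_periodic (a c : int) : w ^ (a + c * n%:Z) = w ^ a.
Proof. by rewrite expfzDr // mulrC [c * _]mulrC -exprz_exp -exprnP wn exp1rz mul1r. Qed.

(** The permutation behind the involution D of the limit at (P + B eta)/n, with w = ee(-P/n) in
    [twist_coef]; for P = B = 0 it is the flip. *)
Definition twist (x : I2) : I2 := (cyc_shift (- B) x.2, cyc_shift B x.1).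
Definition twist_coef (x : I2) : F := w ^ (k%:Z * (Posz x.2 - Posz x.1 - B)).
Definition twist_mx : 'M[F]_(NN n) := monomial_mx twist twist_coef.

Lemma twist_mx_mul : twist_mx *m twist_mx = 1%:M.
Proof.
rewrite monomial_mxM monomial_mx1 // => -[i j] /=.
  by rewrite /twist /= cyc_shiftK cyc_shiftNK.
rewrite /twist_coef /twist /=.
have [m Hm] := cyc_shift_ex B i; have [m' Hm'] := cyc_shift_ex (- B) j.
rewrite -expfzDr // Hm Hm'.
have -> : k%:Z * (Posz j - Posz i - B) + k%:Z * (Posz i + B - m * n%:Z - (Posz j - B - m' * n%:Z) - B) =
  0 + (k%:Z * (m' - m)) * n%:Z by ring.
by rewrite expz_periodic expr0z.
Qed.

(** The fixed pairs are the n pairs with j = i + B modulo n, and there the exponent in [twist_coef]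
    is a multiple of n. *)
Lemma twist_mx_tr : \tr twist_mx = n%:R.
Proof.
rewrite monomial_mx_tr (eq_bigr (fun=> 1)); first by rewrite sumr_const card_ord.
move=> c _; rewrite (bigD1 (cyc_shift B c)) //= big1 ?addr0.
  rewrite ifT; last by rewrite /twist /= cyc_shiftK.
  have [m Hm] := cyc_shift_ex B c; rewrite /twist_coef /= Hm.
  have -> : k%:Z * (Posz c + B - m * n%:Z - Posz c - B) = 0 + (- (k%:Z * m)) * n%:Z by ring.
  by rewrite expz_periodic expr0z.
move=> d dc; rewrite ifF //; apply/negbTE; apply: contra dc.
by rewrite /twist /= => /eqP[_ ->].
Qed.

Lemma card_NN : NN n = (n * n)%N.
Proof. by rewrite /NN card_prod card_ord. Qed.

Lemma bin2_natr : ((n * n)%:R - n%:R) / 2 = 'C(n, 2)%:R :> F.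
Proof. by rewrite -bin2D natrD natrM addrK mulfK // pnatr_eq0. Qed.

Lemma rank_antisym (c : F) : c != 0 -> \rank (c *: ((1%:M - twist_mx) *m swap_mx))%R = 'C(n, 2).
Proof.
move=> c0; rewrite mxrank_scale_nz // mxrankMfree; last first.
  by rewrite row_free_unit; case: (mulmx1_unit swap_mx_mul).
apply/eqP; rewrite -(eqr_nat F); apply/eqP.
have := @rank_involution F _ twist_mx (-1) _ twist_mx_mul; rewrite scaleN1r => ->; last by rewrite sqrrN expr1n.
by rewrite twist_mx_tr card_NN mulN1r bin2_natr.
Qed.

Lemma rank_sym (c : F) : c != 0 -> \rank (c *: (1%:M + swap_mx))%R = ('C(n, 2) + n)%N.
Proof.
move=> c0; rewrite mxrank_scale_nz //.
apply/eqP; rewrite -(eqr_nat F); apply/eqP.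
have := @rank_involution F _ swap_mx 1 _ swap_mx_mul; rewrite scale1r => ->; last by rewrite expr1n.
rewrite swap_mx_tr card_NN mul1r natrD -bin2_natr.
by field.
Qed.

End Pairs.

Lemma sigma_subeta (R : realType) (eta : Cx R) (eta0 : 0 < Imc eta) u (B : int) :
  sigma eta (u - B%:~R * eta) = (-1) ^ B * ee (B%:~R * u - B%:~R ^+ 2 * eta / 2) * sigma eta u.
Proof.
have n10 : (-1 : Cx R) != 0 by rewrite oppr_eq0 oner_eq0.
have step v : sigma eta (v - eta) = - ee (v - eta / 2) * sigma eta v.
  have := sigma_addeta eta0 (v - eta); rewrite subrK => ->.
  rewrite mulrA mulrNN -eeD.
  have -> : v - eta / 2 + (- (v - eta) - eta / 2) = 0 by field.
  by rewrite ee0 mul1r.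
elim/int_ind: B u => [|b IH|b IH] u.
- by rewrite expr0z !mul0r subr0 expr0n /= !mul0r subr0 ee0 !mul1r.
- have -> : u - (b.+1%:Z)%:~R * eta = (u - eta) - (b%:Z)%:~R * eta.
    by rewrite -addn1 PoszD rmorphD /=; ring.
  rewrite IH step -!pmulrn -[b.+1]addn1 natrD PoszD expfzDr // expr1z.
  rewrite mulrA -[_ * ee _ * - _]mulrA mulrN -eeD.
  rewrite mulrN mulrN1 !mulNr; congr (- (_ * ee _ * _)).
  by field.
- have -> : u - (- (b.+1%:Z))%:~R * eta = (u - (- b%:Z)%:~R * eta) + eta.
    by rewrite -addn1 PoszD !rmorphN rmorphD /=; ring.
  have e : (-1) ^ (- (b.+1%:Z)) = - (-1) ^ (- b%:Z) :> Cx R.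
    by rewrite -addn1 PoszD opprD expfzDr // exprN1 invrN1 mulrN1.
  rewrite sigma_addeta // IH e !rmorphN /= -!pmulrn -[b.+1]addn1 natrD.
  rewrite mulrA mulNr [ee _ * (_ * _)]mulrCA -eeD.
  rewrite !mulNr; congr (- (_ * ee _ * _)).
  by field.
Qed.

Lemma big_ord_first (C : pzSemiRingType) (f : nat -> C) m : (0 < m)%N ->
  \prod_(b < m) f b = f 0 * \prod_(b < m.-1) f b.+1.
Proof. by case: m => // m _; rewrite big_ord_recl. Qed.

(** * Limits at the lattice points *)

Section Limits.
Variable R : realType.
Local Notation C := (Cx R).
Variable eta : C.
Hypothesis eta0 : 0 < Imc eta.
Variables n k : nat.
Hypothesis n0 : (0 < n)%N.
Hypothesis nk : coprime n k.
Local Notation S := (sigmaA eta n).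
Local Notation K := (Rscale eta n).
Variable kt : C.
Hypothesis kt0 : kt != 0.
Hypothesis Hkt : forall (a : int) x,
  thetaA n eta a x = kt * ee (n%:R * x / 2 + a%:~R / (2 * n%:R)) * S a x.

Let nn : (n%:R : C) != 0. Proof. by rewrite pnatr_eq0 -lt0n. Qed.
Let n10 : (-1 : C) != 0. Proof. by rewrite oppr_eq0 oner_eq0. Qed.

Section Shift.
Variables P B : int.
Local Notation tau := ((P%:~R + B%:~R * eta) / n%:R).

(** The scalar prefactor has a simple zero at each point of (1/n) Lambda. Its vanishing part is
    isolated as S 0 t, to be set against the poles of the weights at t = 0. *)
Lemma Rscale_shift : exists kap : C -> C, [/\ Lip kap 0, kap 0 != 0 &
  forall t, K (t + tau) = S 0 t * kap t].
Proof.
have [kp kp0 Hkp] := sigmaA_prod eta0 n0.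
pose c0 : C := \prod_(al < n | (0 < al)%N) thetaA n eta (Posz al) 0.
have c00 : c0 != 0.
  apply/prodf_neq0 => i i0; apply: (thetaA_neq0 kt0 Hkt); apply: sigmaA0_neq0 => //.
  apply/negP => /dvdz_lt h; have h1 := ltn_ord i.
  have : Posz i = 0 by apply: h; rewrite ger0_norm.
  by move=> -[i00]; rewrite i00 in i0.
(* [G] converts thetaA to sigmaA, [T] collects the indices that do not vanish at 0, and [H] is the
   quasi-periodicity factor of the translation by tau. *)
pose G (x : C) : C := \prod_(al < n) (kt * ee (n%:R * x / 2 + (Posz al)%:~R / (2 * n%:R))).
pose T (x : C) : C := \prod_(b < n.-1) S b.+1%:Z x.
pose H (t : C) : C := (-1) ^ P * ((-1) ^ B * ee (B%:~R * (n%:R * - t) - B%:~R ^+ 2 * eta / 2)).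
have Lneg : Lip (fun t : C => - t) 0 by apply: LipN; exact: Lip_id.
exists (fun t => - (G (- (t + tau)) * H t * T (- t) / c0)); split.
- apply: LipN; apply: LipM; last exact: Lip_cst.
  apply: LipM; [apply: LipM|].
  + apply: Lip_prod => i; apply: LipM; first exact: Lip_cst.
    apply: (@Lip_comp _ (@ee R)); last exact: Lip_ee.
    by apply: (eq_Lip _ (Lip_affine (- (n%:R / 2)) (- (n%:R * tau / 2) + (Posz i)%:~R / (2 * n%:R)) 0)) => t; ring.
  + apply: LipM; first exact: Lip_cst.
    apply: LipM; first exact: Lip_cst.
    apply: (@Lip_comp _ (@ee R)); last exact: Lip_ee.
    by apply: (eq_Lip _ (Lip_affine (- (B%:~R * n%:R)) (- (B%:~R ^+ 2 * eta / 2)) 0)) => t; ring.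
  + apply: Lip_prod => i; apply: (@Lip_comp _ (S _)) => //; exact: Lip_sigmaA.
- rewrite oppr_eq0 oppr0; apply: mulf_neq0; last by rewrite invr_eq0.
  apply: mulf_neq0; last exact: (sigmaA_prod0_neq0 eta0 n0).
  apply: mulf_neq0; last by rewrite !mulf_neq0 ?ee_neq0 ?expfz_neq0.
  by apply/prodf_neq0 => i _; rewrite mulf_neq0 ?ee_neq0.
move=> t; rewrite /Rscale -/c0.
have -> : \prod_(al < n) thetaA n eta (Posz al) (- (t + tau)) =
   G (- (t + tau)) * \prod_(al < n) S (Posz al) (- (t + tau)).
  by rewrite -big_split; apply: eq_bigr => i _; rewrite Hkt.
rewrite Hkp.
have -> : n%:R * - (t + tau) = n%:R * - t - B%:~R * eta - P%:~R by field.
rewrite sigma_subint // sigma_subeta //.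
have E : kp * sigma eta (n%:R * - t) = - S 0 t * T (- t).
  rewrite -Hkp (big_ord_first (fun b : nat => S (Posz b) (- t)) n0); congr (_ * _).
  by rewrite -(sigmaA_opp eta0 n0) oppr0.
rewrite [LHS](_ : _ = G (- (t + tau)) * H t * (kp * sigma eta (n%:R * - t)) / c0); last by rewrite /H; ring.
by rewrite E; ring.
Qed.

End Shift.

Local Notation ind a := ((n%:Z %| a)%Z%:R : C).

Let LS0 c (a : C) : (fun t : C => S c (a * t)) @ (0 : C)^' --> S c 0.
Proof.
have L : Lip (fun t : C => S c (a * t + 0)) 0 by exact: (Lip_sigmaA_affine eta0 n0).
by have := Lip_dcvg L; rewrite mulr0 addr0; under eq_fun do rewrite addr0.
Qed.

Let LSp c : (fun t : C => S c t) @ (0 : C)^' --> S c 0.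
Proof. by have := @LS0 c 1; under eq_fun do rewrite mul1r. Qed.
Let LSm c : (fun t : C => S c (- t)) @ (0 : C)^' --> S c 0.
Proof. by have := @LS0 c (-1); under eq_fun do rewrite mulN1r. Qed.
Let LSd c : (fun t : C => S c (t + t)) @ (0 : C)^' --> S c 0.
Proof. by have := @LS0 c 2; under eq_fun do rewrite mulr2n mulrDl mul1r. Qed.

Let S0_near : \forall t \near (0 : C)^', S 0 t != 0.
Proof. exact: sigmaA0_near_neq0. Qed.

Let sgn0 (c : int) : (-1) ^ c != 0 :> C.
Proof. exact: expfz_neq0. Qed.

Let S_mul c x : S (c * n%:Z) x = (-1) ^ c * S 0 x.
Proof. by rewrite -[c * _]add0r sigmaA_addMn. Qed.

Let ratio_cvg c (f : C -> C) : ~~ (n%:Z %| c)%Z -> ((fun t => S c (f t)) @ (0 : C)^' --> S c 0) ->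
  (fun t => S c 0 / S c (f t)) @ (0 : C)^' --> (1 : C).
Proof.
move=> nc H; rewrite -(divff (sigmaA0_neq0 eta0 n0 nc)).
exact: (cvgC_div (sigmaA0_neq0 eta0 n0 nc) (@cvgC_cst R C _ _ _) H).
Qed.

Let ratio_cvg2 c (f g : C -> C) : ~~ (n%:Z %| c)%Z -> ((fun t => S c (f t)) @ (0 : C)^' --> S c 0) ->
  ((fun t => S c (g t)) @ (0 : C)^' --> S c 0) ->
  (fun t => S c (g t) / S c (f t)) @ (0 : C)^' --> (1 : C).
Proof.
move=> nc H H'; rewrite -(divff (sigmaA0_neq0 eta0 n0 nc)).
exact: (cvgC_div (sigmaA0_neq0 eta0 n0 nc) H' H).
Qed.

Let cancel_sign (m s x y : C) : m != 0 -> s != 0 -> s * (m * x / (m * s * y)) = x / y.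
Proof. by move=> m0 s0; rewrite !invfM; move: (y^-1) => z; field; rewrite s0 m0. Qed.

(** A pole at t = 0 comes only from an index divisible by n, and oddness of S 0 gives the two cases
    opposite signs. If both are divisible, the numerator S (a + b) 0 is itself 0. *)
Lemma Rweight_lim (a b : int) :
  (fun t => S 0 t * (S (a + b) 0 / (S a (- t) * S b t))) @ (0 : C)^' --> ind b - ind a.
Proof.
case: (boolP (n%:Z %| a)%Z) => [/dvdzP[c ->]|na]; case: (boolP (n%:Z %| b)%Z) => [/dvdzP[d ->]|nb].
- rewrite -mulrDl S_mul sigmaA00 // subrr.
  by under eq_fun do rewrite mulr0 mul0r mulr0; exact: cvgC_cst.
- rewrite sub0r; have H := ratio_cvg nb (@LSp b).
  apply: cvgC_eq (cvgC_opp H); near=> t.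
  have st : S 0 t != 0 by near: t.
  rewrite addrC sigmaA_addMn // S_mul.
  have -> : S 0 (- t) = - S 0 t by rewrite -(sigmaA_opp eta0 n0) oppr0.
  by rewrite mulrN mulNr invrN !mulrN cancel_sign.
- rewrite subr0; have H := ratio_cvg na (@LSm a).
  apply: cvgC_eq H; near=> t.
  have st : S 0 t != 0 by near: t.
  rewrite sigmaA_addMn // S_mul.
  by rewrite [S a (- t) * _]mulrC cancel_sign.
rewrite subrr -[X in _ --> X](mul0r (S (a + b) 0 / (S a 0 * S b 0))).
have S0 : (fun t : C => S 0 t) @ (0 : C)^' --> (0 : C).
  by rewrite -[X in _ --> X](sigmaA00 eta0 n0); exact: LSp.
have ab0 : S a 0 * S b 0 != 0 by rewrite mulf_neq0 // sigmaA0_neq0.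
exact: (cvgC_mul S0 (cvgC_div ab0 (@cvgC_cst R C _ _ _) (cvgC_mul (@LSm a) (@LSp b)))).
Unshelve. all: by end_near.
Qed.

Let S0_dbl : \forall t \near (0 : C)^', S 0 (t + t) != 0.
Proof.
have [c [L [r [c0 L0 r0 H]]]] := sigmaA0_bounds eta0 n0.
have r20 : 0 < r / 2 by rewrite divr_gt0.
apply: (near_dnbhs r20) => z z0; rewrite subr0 => hz.
have h2 : nm (z + z) <= r by apply: le_trans (nmD _ _) _; lra.
have /andP[h _] := H _ h2.
rewrite -nm_gt0; apply: lt_le_trans h; rewrite mulr_gt0 // nm_gt0 -mulr2n.
by rewrite mulrn_eq0.
Qed.

Let S0_sq : (fun t => S 0 t * S 0 t / S 0 (t + t)) @ (0 : C)^' --> (0 : C).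
Proof.
have [c [L [r [c0 L0 r0 H]]]] := sigmaA0_bounds eta0 n0.
apply: (@cvg_nmP R C (dnbhs (0 : C)) _ _ _).2 => e e0.
have m0 : 0 < Num.min (r / 2) (e * (2 * c) / L ^+ 2).
  by rewrite lt_min !divr_gt0 // ?mulr_gt0 ?exprn_gt0.
apply: (near_dnbhs m0) => z z0; rewrite !subr0 le_min => /andP[h1 h2].
have z0' : 0 < nm z by rewrite nm_gt0.
have zz : nm (z + z) = 2 * nm z by rewrite (_ : z + z = 2 * z) ?nmM ?nm_nat //; ring.
have hr : nm (z + z) <= r by rewrite zz; lra.
have hr1 : nm z <= r by lra.
have /andP[a1 _] := H _ hr; have /andP[_ a2] := H _ hr1.
have p0 : 0 < c * nm (z + z) by rewrite zz !mulr_gt0.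
have d0 : 0 < nm (S 0 (z + z)) by apply: lt_le_trans a1.
rewrite (nmM (S 0 z * S 0 z)) (nmM (S 0 z)) nmV ler_pdivrMr //.
have b1 : nm (S 0 z) * nm (S 0 z) <= (L * nm z) * (L * nm z) by rewrite ler_pM ?nm_ge0.
apply: (le_trans b1).
have b2 : e * (c * nm (z + z)) <= e * nm (S 0 (z + z)) by rewrite ler_pM2l.
apply: le_trans _ b2; rewrite zz.
move: h2; rewrite ler_pdivlMr ?exprn_gt0 // => h2.
have -> : L * nm z * (L * nm z) = nm z * L ^+ 2 * nm z by ring.
have -> : e * (c * (2 * nm z)) = e * (2 * c) * nm z by ring.
by rewrite ler_pM2r.
Qed.

(** If both indices were divisible by n, the expression would be S 0 (2t) / S 0 t, whose limit
    involves the derivative of S 0; that case is left to the rescaled version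
    [Rweight_lim_opp_diag]. *)
Lemma Rweight_lim_opp (a b : int) : ~~ ((n%:Z %| a)%Z && (n%:Z %| b)%Z) ->
  (fun t => S 0 t * (S (a + b) (t + t) / (S a t * S b t))) @ (0 : C)^' --> ind b + ind a.
Proof.
have cancel1 c x : ~~ (n%:Z %| x)%Z ->
    (fun t => S 0 t * (S (c * n%:Z + x) (t + t) / (S (c * n%:Z) t * S x t))) @ (0 : C)^' --> (1 : C).
  move=> nx; have H := ratio_cvg2 nx (@LSp x) (@LSd x).
  apply: cvgC_eq H; near=> t.
  have st : S 0 t != 0 by near: t.
  by rewrite [c * _ + x]addrC sigmaA_addMn // S_mul cancel_sign.
move=> nab; case: (boolP (n%:Z %| a)%Z) nab => [/dvdzP[c ->]|na];
  case: (boolP (n%:Z %| b)%Z) => [/dvdzP[d ->]|nb] nab.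
- by case/negP: nab.
- by have H := @cancel1 c b nb; rewrite /= add0r.
- have H := @cancel1 d a na; rewrite /= addr0; apply: cvgC_eq H; near=> t.
  by rewrite [a + _]addrC [S a t * _]mulrC.
rewrite addr0 -[X in _ --> X](mul0r (S (a + b) 0 / (S a 0 * S b 0))).
have S0 : (fun t : C => S 0 t) @ (0 : C)^' --> (0 : C).
  by rewrite -[X in _ --> X](sigmaA00 eta0 n0); exact: LSp.
have ab0 : S a 0 * S b 0 != 0 by rewrite mulf_neq0 // sigmaA0_neq0.
exact: (cvgC_mul S0 (cvgC_div ab0 (@LSd (a + b)) (cvgC_mul (@LSp a) (@LSp b)))).
Unshelve. all: by end_near.
Qed.

(** The prefactor makes the doubly divisible case identically 2. If neither index is divisible, the
    limit is 0 because S 0 t ^ 2 / S 0 (2t) is of order t. *)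
Lemma Rweight_lim_opp_diag (a b : int) : (n%:Z %| a)%Z = (n%:Z %| b)%Z ->
  (fun t => 2 * S 0 t / S 0 (t + t) * (S 0 t * (S (a + b) (t + t) / (S a t * S b t)))) @ (0 : C)^'
    --> ind b + ind a.
Proof.
move=> e; rewrite e; case: (boolP (n%:Z %| b)%Z) e => [/dvdzP[d ->] /dvdzP[c ->]|nb /negbT na].
  have H : (fun=> 1 + 1 : C) @ (0 : C)^' --> (1 + 1 : C) by exact: cvg_cst.
  have -> : true%:R + true%:R = 1 + 1 :> C by [].
  move: H; apply: cvgC_eq; near=> t.
  have st : S 0 t != 0 by near: t.
  have st2 : S 0 (t + t) != 0 by near: t.
  rewrite -mulrDl !S_mul expfzDr //.
  move: (sgn0 c) (sgn0 d) st st2.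
  move: ((-1) ^ c) ((-1) ^ d) (S 0 t) (S 0 (t + t)) => x y u v x0 y0 u0 v0.
  by field; rewrite x0 y0 u0 v0.
rewrite addr0 -[X in _ --> X](mulr0 (2 * (S (a + b) 0 / (S a 0 * S b 0)))).
have ab0 : S a 0 * S b 0 != 0 by rewrite mulf_neq0 // sigmaA0_neq0.
have H : (fun t => 2 * (S (a + b) (t + t) / (S a t * S b t)) * (S 0 t * S 0 t / S 0 (t + t))) @ (0 : C)^'
    --> 2 * (S (a + b) 0 / (S a 0 * S b 0)) * 0.
  exact: (cvgC_mul (cvgC_mul (@cvgC_cst R C _ _ _)
    (cvgC_div ab0 (@LSd (a + b)) (cvgC_mul (@LSp a) (@LSp b)))) S0_sq).
by apply: cvgC_eq H; near=> t; ring.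
Unshelve. all: by end_near.
Qed.

Local Notation dv i j a b := (n%:Z %| Posz i + Posz j - (Posz a + Posz b))%Z.

Let cyc_shift0 (i : 'I_n) : cyc_shift n0 0 i = i.
Proof. by apply/esym/eqP; rewrite -(cyc_shiftP n0) addr0 subrr dvdz0. Qed.

Lemma pair_swap_eq (i j a b : 'I_n) :
  ((a, b) == (j, i)) = dv i j a b && (n%:Z %| k%:Z * (Posz j - Posz a))%Z.
Proof.
have nkz : coprimez n%:Z k%:Z by [].
rewrite Gauss_dvdzr // xpair_eqE -{1}(cyc_shift0 i) -{1}(cyc_shift0 j) -!(cyc_shiftP n0) !addr0 andbC.
apply: andb_id2r => h.
have -> : Posz i + Posz j - (Posz a + Posz b) = (Posz j - Posz a) + (Posz i - Posz b) by ring.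
by rewrite [RHS]rpredDl.
Qed.

Lemma pair_sh_eq (B : int) (i j a b : 'I_n) :
  ((a, b) == (cyc_shift n0 B i, cyc_shift n0 (- B) j)) = dv i j a b && (n%:Z %| Posz a - Posz i - B)%Z.
Proof.
rewrite xpair_eqE -!(cyc_shiftP n0) andbC.
have -> : Posz a - Posz i - B = - (Posz i + B - Posz a) by ring.
rewrite rpredN; apply: andb_id2r => h.
have -> : Posz i + Posz j - (Posz a + Posz b) = (Posz i + B - Posz a) + (Posz j - B - Posz b) by ring.
by rewrite [RHS]rpredDl.
Qed.

Section Shifted.
Variables P B : int.
Local Notation tau := ((P%:~R + B%:~R * eta) / n%:R).
Local Notation w := (ee (- P%:~R / n%:R) : C).

Lemma ee_root_unity : w ^+ n = 1.
Proof. by rewrite -ee_natM mulrC divfK // -rmorphN ee_int. Qed.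

Let w0 : w != 0. Proof. exact: ee_neq0. Qed.

(** The power w^(k (j - a)) can be pulled out of both terms: it is 1 where the identity part is
    supported, and equals [twist_coef] where the twisted part is. *)
Lemma antisym_entry c p q :
  (c *: ((1%:M - twist_mx n0 k w B) *m swap_mx C n)) p q =
  let i := (enum_val p).1 in let j := (enum_val p).2 in
  let a := (enum_val q).1 in let b := (enum_val q).2 in
  if dv i j a b then c * (w ^ (k%:Z * (Posz j - Posz a)) *
     (ind (k%:Z * (Posz j - Posz a))%R - ind (Posz a - Posz i - B)%R)) else 0.
Proof.
rewrite mulmxBl mul1mx monomial_mxM !mxE /twist_coef.
move: (enum_val p) (enum_val q) => [i j] [a b] /=.
rewrite pair_swap_eq pair_sh_eq mulr1.
case: (dv i j a b) => /=; last by rewrite subrr mulr0.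
have H1 : (n%:Z %| k%:Z * (Posz j - Posz a))%Z -> w ^ (k%:Z * (Posz j - Posz a)) = 1.
  by move=> /dvdzP[m ->]; rewrite -[m * _]add0r (expz_periodic n0 ee_root_unity).
have H2 : (n%:Z %| Posz a - Posz i - B)%Z ->
    w ^ (k%:Z * (Posz j - Posz a)) = w ^ (k%:Z * (Posz j - Posz i - B)).
  move=> /dvdzP[m E].
  have -> : k%:Z * (Posz j - Posz a) = k%:Z * (Posz j - Posz i - B) + (- (k%:Z * m)) * n%:Z.
    by rewrite mulNr -mulrA -E; ring.
  by rewrite (expz_periodic n0 ee_root_unity).
congr (_ * _); rewrite [RHS]mulrBr.
congr (_ - _).
  by case: ifP => [/H1 ->|_]; rewrite ?mulr1 ?mulr0.
by case: ifP => [/H2 ->|_]; rewrite ?mulr1 ?mulr0.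
Qed.

Lemma Rweight_shift t (a b : int) :
  Rweight eta n t (t + tau) (B + a) b = ee (B%:~R * t) * w ^ b * (S (a + b) 0 / (S a (- t) * S b t)).
Proof.
rewrite /Rweight.
(* Numerator and denominator are both translated by -tau, so [sigmaA_shift] applies to each and most
   factors cancel. *)
have -> : - (t + tau) + t = 0 - tau by ring.
have -> : - (t + tau) = - t - tau by ring.
rewrite -addrA (sigmaA_shift eta0 n0 P B (a + b) 0) (sigmaA_shift eta0 n0 P B a (- t)).
rewrite mulr0 ee0 mulrN eeN expfzDr //.
have := ee_neq0 (- B%:~R * tau + B%:~R ^+ 2 * eta / (2 * n%:R)).
have := ee_neq0 (B%:~R * t); have := expfz_neq0 a w0; have := sgn0 P.
move: (ee (- B%:~R * tau + _)) (ee (B%:~R * t)) (w ^ a) (w ^ b) ((-1) ^ P) => x1 x2 x3 x4 x5.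
move: (S (a + b) 0) (S a (- t)) (S b t) => y1 y2 y3 h5 h3 h2 h1.
rewrite !invfM; move: (y2^-1) (y3^-1) => z2 z3.
by field; rewrite h1 h2 h3 h5.
Qed.

Lemma Rmat_cvg : exists2 c : C, c != 0 & forall p q,
  (fun t => Rmat n k eta t (t + tau) p q) @ (0 : C)^' -->
  (c *: ((1%:M - twist_mx n0 k w B) *m swap_mx C n)) p q.
Proof.
have [kap [Lk k0 Hk]] := Rscale_shift P B.
exists (kap 0 / kt) => [|p q]; first by rewrite mulf_neq0 // invr_neq0.
rewrite antisym_entry /=.
pose i := Posz (enum_val p).1; pose j := Posz (enum_val p).2.
pose a := Posz (enum_val q).1; pose b := Posz (enum_val q).2.
rewrite -/i -/j -/a -/b.
case E : (n%:Z %| i + j - (a + b))%Z; last first.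
  have -> : (fun t => Rmat n k eta t (t + tau) p q) = fun=> 0.
    by apply/funext => t; rewrite (Rmat_entry eta0 n0 nk kt0 Hkt) /= E.
  exact: (@cvgC_cst R C (dnbhs (0 : C)) _ 0).
have -> : (fun t => Rmat n k eta t (t + tau) p q) = fun t => kap t / kt *
   (ee (B%:~R * t) * w ^ (k%:Z * (j - a)) *
   (S 0 t * (S (a - i - B + k%:Z * (j - a)) 0 / (S (a - i - B) (- t) * S (k%:Z * (j - a)) t)))).
  apply/funext => t; rewrite (Rmat_entry eta0 n0 nk kt0 Hkt) /= E Hk -/i -/j -/a -/b.
  have -> : a - i = B + (a - i - B) by ring.
  by rewrite Rweight_shift [B + _]addrC subrK; ring.
have H := @Rweight_lim (a - i - B) (k%:Z * (j - a)).
have LB : Lip (fun t : C => ee (B%:~R * t)) 0.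
  apply: (@Lip_comp _ (@ee R)); last exact: Lip_ee.
  by apply: (eq_Lip _ (Lip_affine B%:~R 0 0)) => t; rewrite addr0.
have LBc : (fun t : C => ee (B%:~R * t)) @ (0 : C)^' --> (1 : C).
  by have := Lip_dcvg LB; rewrite mulr0 ee0.
have Lkc : (fun t : C => kap t / kt) @ (0 : C)^' --> kap 0 / kt.
  exact: (cvgC_mul (Lip_dcvg Lk) (@cvgC_cst R C _ _ kt^-1)).
move: (w ^ _) => v.
have Lw : (fun t : C => ee (B%:~R * t) * v) @ (0 : C)^' --> v.
  rewrite -[X in _ --> X]mul1r.
  exact: (cvgC_mul LBc (@cvgC_cst R C (dnbhs (0 : C)) _ v)).
exact: (cvgC_mul Lkc (cvgC_mul Lw H)).
Qed.

Lemma limit_matrix : exists M : 'M[C]_(NN n), (forall p q,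
  (fun t => Rmat n k eta t (t + tau) p q) @ (0 : C)^' --> M p q) /\ \rank M = 'C(n, 2).
Proof.
have [c c0 Hc] := Rmat_cvg; exists (c *: ((1%:M - twist_mx n0 k w B) *m swap_mx C n)); split=> //.
exact: (rank_antisym n0 k B ee_root_unity c0).
Qed.

End Shifted.

Let d (x : 'I_n * 'I_n) (t : C) : C := if x.1 == x.2 then 2 * S 0 t / S 0 (t + t) else 1.

Lemma sym_entry c p q :
  (c *: (1%:M + swap_mx C n)) p q =
  let i := (enum_val p).1 in let j := (enum_val p).2 in
  let a := (enum_val q).1 in let b := (enum_val q).2 in
  if dv i j a b then c * (ind (k%:Z * (Posz j - Posz a))%R + ind (Posz a - Posz i)%R) else 0.
Proof.
rewrite !mxE -[p == q](inj_eq enum_val_inj).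
move: (enum_val p) (enum_val q) => [i j] [a b] /=.
rewrite [(i, j) == _]eq_sym (pair_swap_eq i j a b) -{1}(cyc_shift0 i) -{1}(cyc_shift0 j).
have -> : cyc_shift n0 0 j = cyc_shift n0 (- 0) j by rewrite oppr0.
rewrite pair_sh_eq subr0.
case: (dv i j a b) => /=; last by rewrite addr0 mulr0.
by rewrite addrC; congr (c * (_ + _)); case: ifP.
Qed.

(* The factor [d] spares the derivative of S 0 at 0 (that S 0 (2 t) ~ 2 S 0 t)
   in the rows (i, i); scaling rows cannot increase the rank. *)
Lemma rank_neg_near0 :
  \forall t \near (0 : C)^', ('C(n, 2) + n <= \rank (Rmat n k eta t (- t)))%N.
Proof.
have [kap [Lk k0 Hk]] := Rscale_shift 0 0.
pose c := - (kap 0 / kt).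
have c0 : c != 0 by rewrite oppr_eq0 mulf_neq0 // invr_neq0.
pose f t : 'M[C]_(NN n) := diag_mx (\row_p d (enum_val p) t) *m Rmat n k eta t (- t).
have Lkc : (fun t : C => - (kap (- t) / kt)) @ (0 : C)^' --> c.
  have L : Lip (fun t => - (kap (- t) / kt)) 0.
    apply: LipN; apply: LipM; last exact: Lip_cst.
    apply: (@Lip_comp _ kap); first by apply: LipN; exact: Lip_id.
    by rewrite oppr0.
  by have := Lip_dcvg L; rewrite oppr0.
have H : forall p q, (fun t => f t p q) @ (0 : C)^' --> (c *: (1%:M + swap_mx C n)) p q.
  move=> p q; rewrite sym_entry /=.
  pose i := Posz (enum_val p).1; pose j := Posz (enum_val p).2.
  pose a := Posz (enum_val q).1; pose b := Posz (enum_val q).2.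
  rewrite -/i -/j -/a -/b.
  case E : (n%:Z %| i + j - (a + b))%Z; last first.
    have -> : (fun t => f t p q) = fun=> 0.
      apply/funext => t.
      by rewrite /f mul_diag_mx mxE (Rmat_entry eta0 n0 nk kt0 Hkt) mxE /= E mulr0.
    exact: (@cvgC_cst R C (dnbhs (0 : C)) _ 0).
  pose g t := S 0 t * (S (a - i + k%:Z * (j - a)) (t + t) / (S (a - i) t * S (k%:Z * (j - a)) t)).
  have -> : (fun t => f t p q) = fun t => - (kap (- t) / kt) * (d (enum_val p) t * g t).
    apply/funext => t.
    rewrite /f mul_diag_mx mxE (Rmat_entry eta0 n0 nk kt0 Hkt) mxE /= E -/i -/j -/a -/b.
    have -> : K (- t) = - S 0 t * kap (- t).
      have := Hk (- t); rewrite mul0r addr0 mul0r addr0 => ->.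
      by rewrite -(sigmaA_opp eta0 n0) oppr0.
    rewrite /Rweight opprK /g; ring.
  have Hg : (fun t => d (enum_val p) t * g t) @ (0 : C)^' -->
      ind (k%:Z * (j - a)) + ind (a - i).
    have nkz : coprimez n%:Z k%:Z by [].
    rewrite /d; case: (boolP ((enum_val p).1 == (enum_val p).2)) => [/eqP ij|ij].
      apply: Rweight_lim_opp_diag.
      rewrite Gauss_dvdzr // /i /j ij -[RHS]rpredN opprB //.
    have H : (fun t => g t) @ (0 : C)^' --> ind (k%:Z * (j - a)) + ind (a - i).
      (* Off the rows (i, i) the two poles never coincide: n dividing both a - i and j - a would
         give i = j. *)
      apply: Rweight_lim_opp; rewrite Gauss_dvdzr //; apply/negP => /andP[h1 h2].
      case/eqP: ij.
      have : (n%:Z %| j + 0 - i)%Z.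
        by rewrite (_ : j + 0 - i = (a - i) + (j - a)); [rewrite rpredD|ring].
      by rewrite (cyc_shiftP n0) cyc_shift0 => /eqP.
    by apply: cvgC_eq H; near=> t; rewrite mul1r.
  exact: (cvgC_mul Lkc Hg).
have X : \forall t \near (0 : C)^', (\rank (c *: (1%:M + swap_mx C n))%R <= \rank (f t))%N.
  exact: (@rank_lsc R C (dnbhs (0 : C)) _ _ f).
apply: filterS X => t; rewrite rank_sym // => X.
by apply: (leq_trans X); exact: mxrankM_maxr.
Unshelve. all: by end_near.
Qed.

(** Semicontinuity bounds each of the two ranks only from below, but the bounds already add up to
    n^2, so [rank_sum] leaves no slack. *)
Lemma rank_near0 : \forall t \near (0 : C)^', generic_pt eta n t -> \rank (Rmat n k eta t t) = 'C(n, 2).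
Proof.
have [c c0 Hc] := Rmat_cvg 0 0.
have H : \forall t \near (0 : C)^', ('C(n, 2) <= \rank (Rmat n k eta t t))%N.
  rewrite -(rank_antisym n0 k 0 (ee_root_unity 0) c0).
  apply: (@rank_lsc R C (dnbhs (0 : C)) _ _ (fun t => Rmat n k eta t t)) => p q.
  have e : (fun t => Rmat n k eta t t p q) =
           (fun t => Rmat n k eta t (t + (0%:~R + 0%:~R * eta) / n%:R) p q).
    by apply/funext => t; rewrite mul0r addr0 mul0r addr0.
  by rewrite e; exact: Hc.
have H2 := rank_neg_near0.
apply: filterS2 H H2 => t h1 h2 /(rank_sum eta0 n0 nk kt0 Hkt) e.
apply: leq_add_eqR h1 h2 _; rewrite e.
by rewrite card_NN -bin2D muln2 -addnn addnA.
Qed.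

End Limits.

(** * Dimension of the quadratic relations, off (1/n) Lambda and on it *)

Theorem theorem5p10 (R : realType) (n k : nat) (eta : Cx R) :
  (1 <= k)%N -> (k < n)%N -> coprime n k -> 0 < Imc eta ->
  forall tau : Cx R,
    ~ (inLat eta (2 * n) tau /\ ~ inLat eta n tau) ->
    rel_dim n k eta tau 'C(n, 2).
Proof.
move=> k0 kn nk eta0 tau Htau.
have n0 : (0 < n)%N by apply: leq_trans kn.
have n20 : (0 < 2 * n)%N by rewrite muln_gt0.
have [kt kt0 Hkt] := thetaA_sigmaA eta0 n0.
split=> [ntau|[P [B ->]]]; last exact: (limit_matrix eta0 n0 nk kt0 Hkt).
have n2tau : ~ inLat eta (2 * n) tau by move=> h; apply: Htau.
have loc t : ~ inLat eta (2 * n) t ->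
    \forall u \near t, \rank (Rmat n k eta u u) = \rank (Rmat n k eta t t).
  by move=> /(generic_pt_inLat eta0 n0); exact: (rank_locally_constant eta0 n0 nk kt0 Hkt).
(* The rank is locally constant only off (1/2n) Lambda, so the base point and the connecting path
   are taken for the finer lattice, with 2 n in place of n. *)
have [t [nt Ht]] := near0_nonlattice eta0 n20 (rank_near0 eta0 n0 nk kt0 Hkt).
have /= -> := @path_const R eta eta0 (2 * n) n20 (fun t => \rank (Rmat n k eta t t)) loc tau t n2tau nt.
by apply: Ht; exact: generic_pt_inLat.
Qed.
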